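(* Fix $p>1$. Let $F:\mathbb R^+\to\mathbb R$ be a $C^2$ non-decreasing function satisfying $F(1)=0$. For all $q\ge0$ define $\tau_q(x):=x^p e^{qF(x^p)}$. (i) Assume that: - there exists a non-negative function $k$ on $\mathbb R^+$ such that for all $q\ge0$, $\tau_q''\tau_q\ge\frac{k(q)}{4}(\tau_q')^2$ (hence $\tau_q$ is a Young function); - there exist a non-negative function $\ell$ on $\mathbb R^+$ and a constant $m\ge0$ such that $\tau_q(x)F(x^p)\le\ell(q)\,\tau_q(x)F(\tau_q(x))+m$ for all $q\ge0$ and all $x\ge0$; - the probability measure $\mu$ satisfies the homogeneous $F$-Sobolev inequality with constants $C_F$ and $\widetilde C_F$: for every smooth enough $f$, $$\int f^2F\left(\frac{f^2}{\mu(f^2)}\right)d\mu\le C_F\int|\nabla f|^2d\mu+\widetilde C_F\int f^2d\mu .$$ Then for all non-decreasing $C^1$ functions $q:\mathbb R^+\to\mathbb R^+$ with $q(0)=0$ and satisfying $q'\le\frac{k(q)}{\ell(q)C_F}$ (that is, $q'(t)\le \frac{k(q(t))}{\ell(q(t))C_F}$ for all $t\ge0$), the following holds for all $f$ (and all $t\ge0$): $$N_{\tau_{q(t)}}(\mathbf P_tf)\le e^{\frac1p\left[m\,q(t)+\widetilde C_F\int_0^{q(t)}\ell(u)\,du\right]}\,\|f\|_p .$$ (ii) Conversely, assume that there exist two non-decreasing functions $q,r:\mathbb R^+\to\mathbb R^+$, differentiable at $0$, with $q(0)=0$, such that for any $f$ (and all $t\ge0$), $$N_{\tau_{q(t)}}(\mathbf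 P_tf)\le e^{r(t)}\|f\|_p .$$ Then $\mu$ satisfies the following homogeneous $F$-Sobolev inequality: for all $f$ smooth enough, $$\int f^2F\left(\frac{f^2}{\mu(f^2)}\right)d\mu\le\frac{4(p-1)}{p\,q'(0)}\int|\nabla f|^2d\mu+\frac{p\,r'(0)e^{r(0)}}{q'(0)}\int f^2d\mu .$$
   Context: $\mu$ is a probability measure and $(\mathbf P_t)_{t\ge0}$ is a $\mu$-symmetric diffusion (Markov) semigroup with generator $\mathbf L$ and carré du champ $|\nabla f|^2:=\Gamma(f,f)$, normalized so that $\int\mathbf Lf\,\phi(f)\,d\mu=-\int|\nabla f|^2\phi'(f)\,d\mu$ for smooth $\phi$ (for instance $d\mu=e^{-V}dx$ on $\mathbb R^n$ and $\mathbf L=\Delta-\nabla V\cdot\nabla$). $\mu(g)=\int g\,d\mu$ and $\|f\|_p$ is the $L^p(\mu)$ norm. For a Young function $\tau$, the gauge norm is $N_\tau(f)=\inf\{\lambda>0:\ \int\tau(f/\lambda)\,d\mu\le\tau(1)\}$, where $\tau$ is extended to $\mathbb R$ as an even function; here $\tau_q(1)=1$ for all $q$.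
   Formalization: In (ii) the hypothesis r(0)=0 is added, since the claim fails for r(0)>0 (constant r>0 on the circle heat semigroup); q'(0)>0 is made explicit, and in (i) ℓ is assumed measurable so that its integral makes sense. *)

(* Defs.v *)
From HB Require Import structures.
From mathcomp Require Import all_boot all_order all_algebra.
From mathcomp Require Import all_classical all_reals all_analysis.

Set Implicit Arguments.
Unset Strict Implicit.
Unset Printing Implicit Defensive.

Import Order.TTheory GRing.Theory Num.Theory.
Import numFieldNormedType.Exports.

Local Open Scope ring_scope.
Local Open Scope classical_set_scope.

Section real_functions.
Context {R : realType}.
Implicit Types (D : set R) (f df : R -> R).

(* [D] is meant to be open: the derivatives are two-sided. *)
Definition C2_on D f := forall x, D x ->
  [/\ derivable f x 1, derivable f^`() x 1 & {for x, continuous f^`(2)}].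

(* Derivative at [t] of a function defined on [0, +oo[; right derivative at 0.
   The values of [f] at negative reals are irrelevant. *)
Definition has_derivative_Rplus f (t df : R) :=
  (f s - f t) / (s - t) @[s --> within [set s | 0 <= s] t^'] --> df.

Definition C1_Rplus f df :=
  (forall t : R, 0 <= t -> has_derivative_Rplus f t (df t)) /\
  {within `[0, +oo[, continuous df}.

Definition nondecreasing_Rplus f := forall s t : R, 0 <= s -> s <= t -> f s <= f t.

Definition nonnegative_Rplus f := forall t : R, 0 <= t -> 0 <= f t.

(* Evaluated at nonnegative [x] only. *)
Definition tau (p : R) (F : R -> R) (q x : R) : R :=
  x `^ p * expR (q * F (x `^ p)).

End real_functions.

Section semigroup.
Context d (T : measurableType d) (R : realType).
Variable mu : probability T R.
Implicit Types (f g : T -> R).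

(* The absolute value implements the even extension of [phi]. The infimum of
   the empty set is +oo. *)
Definition gauge_norm (phi : R -> R) f : \bar R :=
  ereal_inf [set l%:E | l in
    [set l : R | 0 < l /\
      (\int[mu]_x (phi (`|f x| / l))%:E <= (phi 1)%:E)%E]].

(* A mu-symmetric Markov semigroup in its realization on L^1(mu), acting on
   representatives; compatibility with equality mu-a.e. follows from linearity
   and positivity. *)
Record symmetric_Markov_semigroup (P : R -> (T -> R) -> (T -> R)) : Prop := {
  sg_L1 : forall (t : R) f, 0 <= t -> f \in Lfun mu 1%E -> P t f \in Lfun mu 1%E ;
  sg_linear : forall (t a : R) f g, 0 <= t ->
    f \in Lfun mu 1%E -> g \in Lfun mu 1%E ->
    {ae mu, forall x, P t (fun y => a * f y + g y) x = a * P t f x + P t g x} ;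
  sg_ge0 : forall (t : R) f, 0 <= t -> f \in Lfun mu 1%E ->
    {ae mu, forall x, 0 <= f x} -> {ae mu, forall x, 0 <= P t f x} ;
  sg_1 : forall t : R, 0 <= t -> {ae mu, forall x, P t (cst 1) x = 1} ;
  sg_0 : forall f, f \in Lfun mu 1%E -> {ae mu, forall x, P 0 f x = f x} ;
  sg_add : forall (s t : R) f, 0 <= s -> 0 <= t -> f \in Lfun mu 1%E ->
    {ae mu, forall x, P (s + t) f x = P s (P t f) x} ;
  sg_sym : forall (t : R) f g, 0 <= t -> f \in Lfun mu 1%E -> g \in Lfun mu +oo%E ->
    (\int[mu]_x (P t f x * g x)%:E = \int[mu]_x (f x * P t g x)%:E)%E ;
  sg_cvg : forall f, f \in Lfun mu 1%E ->
    ('N[mu]_1[EFin \o (fun x => P t f x - f x)%R])%E @[t --> 0^'+] --> 0%E }.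

(* [f] is in the domain of the L^1(mu)-generator, and its image is [g]. *)
Definition generates (P : R -> (T -> R) -> (T -> R)) f g :=
  [/\ f \in Lfun mu 1%E, g \in Lfun mu 1%E &
      ('N[mu]_1[EFin \o (fun x => (P t f x - f x) / t - g x)%R])%E
        @[t --> 0^'+] --> 0%E].

Definition dom P f := exists g, generates P f g.

Definition carre_du_champ (L : (T -> R) -> (T -> R)) f g : T -> R :=
  fun x => 2^-1 * (L (fun y => f y * g y) x - f x * L g x - g x * L f x).

(* The "smooth enough" functions: bounded elements of the domain of the
   L^1-generator. For a symmetric diffusion semigroup this is an algebra, stable
   under the semigroup and under C^2 functions, and dense in every L^p,
   1 <= p < +oo. *)
Definition smooth P f := f \in Lfun mu +oo%E /\ dom P f.

(* The diffusion property is the chain rule for [L]. Since [L h] has zero mean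
   for every [h] in the domain, applying it to a primitive of [phi] gives
   \int L f * phi(f) = - \int Gamma(f, f) * phi'(f) for [phi] of class C^1. *)
Record symmetric_diffusion_semigroup
    (P : R -> (T -> R) -> (T -> R)) (L : (T -> R) -> (T -> R)) : Prop := {
  diff_markov : symmetric_Markov_semigroup P ;
  diff_generator : forall f, dom P f -> generates P f (L f) ;
  diff_chain : forall f (phi : R -> R), smooth P f -> C2_on setT phi ->
    dom P (phi \o f) /\
    {ae mu, forall x, L (phi \o f) x =
      (phi^`())%classic (f x) * L f x + (phi^`(2))%classic (f x) * carre_du_champ L f f x} }.

Definition F_Sobolev P L (F : R -> R) (C Ct : R) :=
  forall f, smooth P f ->
    (\int[mu]_x (f x ^+ 2 * F (f x ^+ 2 / (\int[mu]_y (f y ^+ 2))%R)%R)%:E <=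
     C%:E * \int[mu]_x (carre_du_champ L f f x)%:E +
     Ct%:E * \int[mu]_x (f x ^+ 2)%:E)%E.

End semigroup.

(* Main.v *)
Require Import Defs.
From mathcomp Require Import all_boot all_order all_algebra.
From mathcomp Require Import all_classical all_reals all_analysis.
From mathcomp Require Import measurable_realfun ess_sup_inf.
From mathcomp Require Import ring lra.

Set Implicit Arguments.
Unset Strict Implicit.
Unset Printing Implicit Defensive.

Import Order.TTheory GRing.Theory Num.Theory.
Import numFieldNormedType.Exports.

Local Open Scope ring_scope.
Local Open Scope classical_set_scope.

(** From the F-Sobolev inequality to the bound. Put
    lambda(t) = ||f||_p exp ((m q(t) + Ct \int_0^{q(t)} l) / p) and follow
    e(t) = E[tau_{q(t)}(P_t f / lambda(t))], where E is integration against mu.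
    The claim is e(t) <= 1, and e(0) = 1. Suppose that e(t) = 1 and write v for
    P_t f / lambda(t). The semigroup contributes
    E[tau'(v) L v] = - E[tau''(v) Gamma(v)] <= - k E[Gamma(sqrt(tau(v)))], by the
    hypothesis on k. The growth of q contributes q' E[tau(v) F(v^p)], at most
    q' (l E[tau(v) F(tau(v))] + m) by the hypothesis on l. As sqrt(tau(v)) has
    mean square 1, the Sobolev inequality applies to it and bounds the second
    contribution by q' l C E[Gamma(sqrt(tau(v)))] + q' (m + l Ct). Since
    q' l C <= k the two energies cancel ([drift_bound]), and what is left,
    q' (m + l Ct), is compensated by the growth of lambda: since F is
    nondecreasing, x |-> tau_q(x) scales at least like x^p ([tau_scale]).

    Several points need care, since P_t f is differentiable in t in L^1 only.

    - The differential inequality is replaced by a first-order expansion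
      ([tau_expansion]) for f with 0 < c <= f <= M, a range that P_t preserves.
      The Taylor remainder is of size E[(P_h v - v)^2], and this is o(h) by
      symmetry ([quadratic_variation]). The sharp expansion matters only at times
      where e(t) = 1; elsewhere any first-order bound will do. The bound propagates
      by induction on the real line ([real_induction], [tau_mean_le1]), with a slack
      epsilon t in the exponent that makes the inequalities strict.

    - The function l is only measurable. It may be replaced at each point by the
      least constant that satisfies the hypothesis, and that constant is lower
      semicontinuous in q ([least_rate]); so \int l grows at least at the rate
      required ([rate_integral_ge]).

    - The generator obeys a chain rule for C^2 functions on the line, while
      tau_q is C^2 on the positive half-line only; [lift_pos] bridges the gap
      ([chain_pos]). That Gamma >= 0 follows from P_h((f - a)^2) >= 0
      ([Gamma_ge0]).

    - A general f in L^p is reached by truncating |f| and averaging it along the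
      semigroup, which gives elements of the domain of L ([dom_dense],
      [approx_Lp]); |P_t f| <= P_t |f| and Fatou's lemma conclude ([fatou_step],
      [gauge_bound]).

    From the bound to the F-Sobolev inequality. For f bounded, bounded away from
    0 and with E[f^p] = 1, the inequality E[tau_{q(t)}(e^{-r(t)} P_t f)] <= 1 is
    an equality at t = 0, so the derivative at 0 is nonpositive:
    q'(0) E[f^p F(f^p)] <= p r'(0) + p (p-1) E[f^{p-2} Gamma(f)]
    ([derivative_at_0]). Taking f^p = (g^2 + delta) / (E[g^2] + delta) turns the
    last term into the energy of g ([root_energy]), and delta tends to 0 by
    dominated convergence, as x F(x) tends to 0 at 0 ([converse_Sobolev]). *)

(** * Integration on a probability space *)

Section integration.
Context d (T : measurableType d) (R : realType).
Variable mu : probability T R.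
Implicit Types (f g h : T -> R).

Definition L1norm f : R := \int[mu]_x `|f x|.

(** Membership in L^oo, in a form that exhibits the bound. *)
Definition ess_bdd f := measurable_fun [set: T] f /\
  exists M : R, {ae mu, forall x, `|f x| <= M}.

Local Notation L1 f := (f \in Lfun mu 1%E).
Local Notation N1 := L1norm.
Local Notation E f := (\int[mu]_x f x).

Lemma L1_integrable f : L1 f -> mu.-integrable [set: T] (EFin \o f).
Proof. by move/Lfun1_integrable. Qed.

Lemma L1_meas f : L1 f -> measurable_fun [set: T] f.
Proof. by move=> /L1_integrable /measurable_int /measurable_EFinP. Qed.

Lemma L1_dom f g : measurable_fun [set: T] f -> L1 g ->
  {ae mu, forall x, `|f x| <= g x} -> L1 f.
Proof.
move=> mf /L1_integrable ig fg; apply/Lfun1_integrable/integrableP; split.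
  exact/measurable_EFinP.
have /integrableP[mg] := ig; apply: le_lt_trans.
apply: ae_ge0_le_integral => //.
- by apply/measurableT_comp/measurable_EFinP.
- by apply/measurableT_comp.
- apply: filterS fg => x fg _ /=; rewrite lee_fin.
  exact: le_trans (ler_norm _).
Qed.

Lemma L1_cst (a : R) : (fun _ => a) \in Lfun mu 1%E.
Proof. exact: Lfun_cst. Qed.

Lemma L1D f g : L1 f -> L1 g -> (fun x => f x + g x) \in Lfun mu 1%E.
Proof.
move=> /L1_integrable f1 /L1_integrable g1; apply/Lfun1_integrable.
exact: (integrableD measurableT f1 g1).
Qed.

Lemma L1Z (a : R) f : L1 f -> (fun x => a * f x) \in Lfun mu 1%E.
Proof.
move=> /L1_integrable f1; apply/Lfun1_integrable.
have -> : EFin \o (fun x => a * f x) = fun x => (a%:E * (EFin \o f) x)%E by [].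
exact: integrableZl.
Qed.

Lemma L1N f : L1 f -> (fun x => - f x) \in Lfun mu 1%E.
Proof.
move=> /(L1Z (-1)) h.
by have -> : (fun x => - f x) = (fun x => -1 * f x) by apply/funext => x; rewrite mulN1r.
Qed.

Lemma L1B f g : L1 f -> L1 g -> (fun x => f x - g x) \in Lfun mu 1%E.
Proof. by move=> f1 g1; apply: L1D => //; exact: L1N. Qed.

Lemma L1_norm f : L1 f -> (fun x => `|f x|) \in Lfun mu 1%E.
Proof. exact: Lfun_norm. Qed.

Lemma L1_bdd f : ess_bdd f -> L1 f.
Proof.
by move=> [mf [M fM]]; apply: (@L1_dom _ (cst M)) => //; exact: L1_cst.
Qed.

Lemma L1M f g : ess_bdd f -> L1 g -> (fun x => f x * g x) \in Lfun mu 1%E.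
Proof.
move=> [mf [M fM]] g1.
apply: (@L1_dom _ (fun x => M * `|g x|)).
- by apply: measurable_funM => //; exact: L1_meas.
- by apply: L1Z; exact: L1_norm.
- by apply: filterS fM => x fM; rewrite normrM ler_wpM2r.
Qed.

Lemma L1_sum (I : Type) (s : seq I) (F : I -> T -> R) :
  (forall i, L1 (F i)) -> (fun x => \sum_(i <- s) F i x) \in Lfun mu 1%E.
Proof.
move=> F1; elim: s => [|a s IH].
  by under eq_fun do rewrite big_nil; exact: L1_cst.
by under eq_fun do rewrite big_cons; exact: L1D.
Qed.

Lemma E_fin f : L1 f -> (\int[mu]_x (f x)%:E)%E = (E f)%:E.
Proof.
move=> /L1_integrable f1; rewrite /Rintegral fineK//; exact: integrable_fin_num.
Qed.

Lemma ED f g : L1 f -> L1 g -> E (fun x => f x + g x) = E f + E g.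
Proof. by move=> /L1_integrable f1 /L1_integrable g1; rewrite RintegralD. Qed.

Lemma EB f g : L1 f -> L1 g -> E (fun x => f x - g x) = E f - E g.
Proof. by move=> /L1_integrable f1 /L1_integrable g1; rewrite RintegralB. Qed.

Lemma EZ (a : R) f : L1 f -> E (fun x => a * f x) = a * E f.
Proof. by move=> /L1_integrable f1; rewrite RintegralZl. Qed.

Lemma E_cst (a : R) : E (fun _ => a) = a.
Proof.
rewrite Rintegral_cst//.
by rewrite -[RHS]mulr1; congr (_ * _); exact: (congr1 fine (probability_setT mu)).
Qed.

Lemma E_ae f g : L1 f -> L1 g -> {ae mu, forall x, f x = g x} -> E f = E g.
Proof.
move=> f1 g1 fg; congr fine; apply: ae_eq_integral => //.
- by apply/measurable_EFinP; exact: L1_meas.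
- by apply/measurable_EFinP; exact: L1_meas.
- by apply: filterS fg => x + _ /= => ->.
Qed.

Lemma L1_ae f g : measurable_fun [set: T] g -> L1 f ->
  {ae mu, forall x, f x = g x} -> L1 g.
Proof.
move=> mg f1 fg; apply: (@L1_dom _ (fun x => `|f x|)) => //; first exact: L1_norm.
by apply: filterS fg => x ->.
Qed.

Lemma le_E f g : L1 f -> L1 g -> {ae mu, forall x, f x <= g x} -> E f <= E g.
Proof.
move=> f1 g1 fg; rewrite -subr_ge0 -EB//.
rewrite (@E_ae _ (fun x => `|g x - f x|)).
- exact: Rintegral_ge0.
- exact: L1B.
- by apply: L1_norm; exact: L1B.
- by apply: filterS fg => x fg; rewrite ger0_norm// subr_ge0.
Qed.

Lemma E_ge0 f : L1 f -> {ae mu, forall x, 0 <= f x} -> 0 <= E f.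
Proof. by move=> f1 f0; rewrite -(E_cst 0); apply: le_E => //; exact: L1_cst. Qed.

Lemma normE_le f : L1 f -> `|E f| <= N1 f.
Proof. by move=> /L1_integrable f1; exact: le_normr_Rintegral. Qed.

Lemma N1_ge0 f : 0 <= N1 f.
Proof. exact: Rintegral_ge0. Qed.

Lemma N1E f : L1 f -> 'N[mu]_1[EFin \o f]%E = (N1 f)%:E.
Proof. by move=> f1; rewrite Lnorm1 -E_fin//; exact: L1_norm. Qed.

Lemma le_N1 f g : L1 f -> L1 g -> {ae mu, forall x, `|f x| <= `|g x|} -> N1 f <= N1 g.
Proof. by move=> f1 g1; apply: le_E; exact: L1_norm. Qed.

Lemma eq_N1 f g : L1 f -> L1 g -> {ae mu, forall x, f x = g x} -> N1 f = N1 g.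
Proof.
by move=> f1 g1 fg; apply: E_ae; [exact: L1_norm..|apply: filterS fg => x ->].
Qed.

Lemma N1_cst (a : R) : N1 (fun _ => a) = `|a|.
Proof. exact: E_cst. Qed.

Lemma N1Z (a : R) f : L1 f -> N1 (fun x => a * f x) = `|a| * N1 f.
Proof.
move=> f1; rewrite /N1 -EZ//; last exact: L1_norm.
by congr Rintegral; apply/funext => x; rewrite normrM.
Qed.

Lemma N1N f : N1 (fun x => - f x) = N1 f.
Proof. by congr Rintegral; apply/funext => x; rewrite normrN. Qed.

Lemma N1_subC f g : N1 (fun x => f x - g x) = N1 (fun x => g x - f x).
Proof. by congr Rintegral; apply/funext => x; rewrite distrC. Qed.

Lemma N1D f g : L1 f -> L1 g -> N1 (fun x => f x + g x) <= N1 f + N1 g.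
Proof.
move=> f1 g1; rewrite /N1 -ED; [|exact: L1_norm..].
apply: le_E; first by apply: L1_norm; exact: L1D.
  by apply: L1D; exact: L1_norm.
by apply: aeW => x; exact: ler_normD.
Qed.

Lemma N1_trans h f g : L1 f -> L1 g -> L1 h ->
  N1 (fun x => f x - g x) <= N1 (fun x => f x - h x) + N1 (fun x => h x - g x).
Proof.
move=> f1 g1 h1.
have -> : (fun x => f x - g x) = (fun x => (f x - h x) + (h x - g x)).
  by apply/funext => x; rewrite subrKA.
by apply: N1D; exact: L1B.
Qed.

Lemma N1_sum (I : Type) (s : seq I) (F : I -> T -> R) :
  (forall i, L1 (F i)) ->
  N1 (fun x => \sum_(i <- s) F i x) <= \sum_(i <- s) N1 (F i).
Proof.
move=> F1; elim: s => [|a s IH].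
  by under eq_fun do rewrite big_nil; rewrite big_nil N1_cst normr0.
rewrite big_cons; under eq_fun do rewrite big_cons.
by apply: le_trans (N1D _ _) _ => //; [exact: L1_sum|rewrite lerD2l].
Qed.

Lemma N1_eq0 f : L1 f -> N1 f <= 0 -> {ae mu, forall x, f x = 0}.
Proof.
move=> f1 f0.
have : (\int[mu]_x `|(EFin \o f) x| = 0)%E.
  rewrite -[LHS]/(\int[mu]_x (`|f x|)%:E)%E E_fin; last exact: L1_norm.
  by congr EFin; apply/eqP; rewrite eq_le f0 N1_ge0.
move/ae_eq_integral_abs => /(_ measurableT).
rewrite /=; move=> h; have {}h := h (proj2 (measurable_EFinP _ _) (L1_meas f1)).
by apply: filterS h => x /(_ I) [].
Qed.

Lemma ess_bddP f : f \in Lfun mu +oo%E <-> ess_bdd f.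
Proof.
have mu1 : mu [set: T] = 1%:E by exact: probability_setT.
have mu0 : (0 < mu [set: T])%E by rewrite mu1 lte01.
split.
- move=> /andP[]; rewrite !inE/= => mf; rewrite /finite_norm unlock mu0 => fM.
  split => //.
  have [M hM] : exists M : R, (ess_sup mu (abse \o (EFin \o f)) <= M%:E)%E.
    have : (0 <= ess_sup mu (abse \o (EFin \o f)))%E.
      by apply: (ess_sup_gee mu0); apply: aeW => t; exact: abse_ge0.
    move: fM; case: (ess_sup _ _) => // r _ _.
    by exists r.
  exists M; move/ess_supP: hM; apply: filterS => x /=.
  by rewrite lee_fin.
- move=> [mf [M fM]]; apply/andP; rewrite !inE/=; split => //.
  rewrite /finite_norm unlock mu0.
  apply: (@le_lt_trans _ _ M%:E); last exact: ltry.
  by apply/ess_supP; apply: filterS fM => x /=; rewrite lee_fin.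
Qed.

Lemma ess_bdd_cst (a : R) : ess_bdd (fun _ => a).
Proof. by split; [exact: measurable_cst|exists `|a|; apply: aeW]. Qed.

Lemma ess_bddM f g : ess_bdd f -> ess_bdd g -> ess_bdd (fun x => f x * g x).
Proof.
move=> [mf [M fM]] [mg [K gK]]; split; first exact: measurable_funM.
exists (M * K); apply: filterS2 fM gK => x fM gK.
by rewrite normrM ler_pM.
Qed.

Lemma ess_bddD f g : ess_bdd f -> ess_bdd g -> ess_bdd (fun x => f x + g x).
Proof.
move=> [mf [M fM]] [mg [K gK]]; split; first exact: measurable_funD.
exists (M + K); apply: filterS2 fM gK => x fM gK.
by rewrite (le_trans (ler_normD _ _))// lerD.
Qed.

Lemma N1_bddM f g M : measurable_fun [set: T] f -> {ae mu, forall x, `|f x| <= M} -> L1 g ->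
  N1 (fun x => f x * g x) <= M * N1 g.
Proof.
move=> mf fM g1.
have bf : ess_bdd f by split => //; exists M.
rewrite /N1 -EZ; last exact: L1_norm.
apply: le_E; first by apply: L1_norm; exact: L1M.
  by apply: L1Z; exact: L1_norm.
by apply: filterS fM => x fM; rewrite normrM ler_wpM2r.
Qed.

End integration.

(** * Convergence in L^1 *)

Section convergence.
Context d (T : measurableType d) (R : realType).
Variable mu : probability T R.
Implicit Types (f g h : T -> R).

Local Notation L1 f := (f \in Lfun mu 1%E).
Local Notation E f := (\int[mu]_x f x).
Local Notation N1 := (L1norm mu).

Lemma sum_half (n : nat) : \sum_(i < n) (2^-1 : R) ^+ i = 2 - 2 * 2^-1 ^+ n.
Proof.
elim: n => [|n IH]; first by rewrite big_ord0 expr0 mulr1 subrr.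
by rewrite big_ord_recr/= IH exprS; lra.
Qed.

(** Monotone convergence: the sum of the |v_n| is integrable, hence finite almost
    everywhere. *)
Lemma L1_summable (v : nat -> T -> R) : (forall n, L1 (v n)) ->
  (forall n, N1 (v n) <= 2^-1 ^+ n) ->
  exists2 s, L1 s & {ae mu, forall x n, \sum_(i < n) `|v i x| <= s x}.
Proof.
move=> v1 vn.
pose S x := (\sum_(n <oo) (`|v n x|)%:E)%E.
have mv n : measurable_fun [set: T] (fun x => (`|v n x|)%:E).
  by apply/measurable_EFinP; apply: measurableT_comp => //; exact: L1_meas.
have S0 x : (0 <= S x)%E by apply: nneseries_ge0 => n _ _; rewrite lee_fin.
have mS : measurable_fun [set: T] S.
  by apply: ge0_emeasurable_sum => // n x _ _; rewrite lee_fin.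
have IS : (\int[mu]_x S x <= 2%:E)%E.
  rewrite integral_nneseries//.
  apply: lime_le.
    by apply: is_cvg_nneseries => n _ _; apply: integral_ge0 => x _; rewrite lee_fin.
  apply: nearW => n; rewrite big_mkord.
  rewrite (eq_bigr (fun i : 'I_n => (N1 (v i))%:E)); last first.
    by move=> i _; apply: E_fin; exact: L1_norm.
  rewrite sumEFin lee_fin.
  apply: le_trans (_ : \sum_(i < n) (2^-1 : R) ^+ i <= _); first exact: ler_sum.
  by rewrite sum_half gerBl mulr_ge0// exprn_ge0.
have iS : mu.-integrable [set: T] S.
  apply/integrableP; split => //; under eq_integral do rewrite gee0_abs//.
  by rewrite (le_lt_trans IS)// ltry.
have Sfin := integrable_ae measurableT iS.
exists (fine \o S).
  apply/Lfun1_integrable.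
  apply/integrableP; split; first by apply/measurable_EFinP; exact: measurableT_comp.
  apply: le_lt_trans (_ : (\int[mu]_x S x < +oo)%E); last by rewrite (le_lt_trans IS)// ltry.
  apply: ae_ge0_le_integral => //.
    by apply: measurableT_comp => //; apply/measurable_EFinP; exact: measurableT_comp.
  apply: filterS Sfin => x /(_ I) Sx _ /=.
  by rewrite ger0_norm ?fine_ge0// fineK.
apply: filterS Sfin => x /(_ I) Sx n.
rewrite -lee_fin -sumEFin /= fineK// -(big_mkord xpredT (fun i => (`|v i x|)%:E)).
by apply: nneseries_lim_ge => i _ _; rewrite lee_fin.
Qed.

Lemma cvg_of_bounded_abs (u : nat -> R) (K : R) :
  (forall n, \sum_(i < n) `|u i| <= K) -> cvgn (series u).
Proof.
move=> uK; apply: normed_cvg; apply: nondecreasing_is_cvgn.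
  by apply: nondecreasing_series => n _ _; exact: normr_ge0.
exists K => _ [n _ <-]; by have := uK n; rewrite -(big_mkord xpredT (fun i => `|u i|)).
Qed.

(** Borel-Cantelli: L^1-convergence at a summable rate is convergence almost
    everywhere. *)
Lemma fast_cvg_ae (u : nat -> T -> R) g : (forall n, L1 (u n)) -> L1 g ->
  (forall n, N1 (fun x => u n x - g x) <= 2^-1 ^+ n) ->
  {ae mu, forall x, u n x @[n --> \oo] --> g x}.
Proof.
move=> u1 g1 ug.
have [s s1] := L1_summable (fun n => L1B (u1 n) g1) ug.
apply: filterS => x hx.
have /cvg_series_cvg_0 := @cvg_of_bounded_abs (fun i => u i x - g x) _ hx.
by move/subr_cvg0.
Qed.

(** Dominated convergence, with values in the real numbers. *)
Lemma N1_cvg_dominated (u : nat -> T -> R) f g : (forall n, L1 (u n)) -> measurable_fun [set: T] f ->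
  L1 g -> {ae mu, forall x, u n x @[n --> \oo] --> f x} ->
  {ae mu, forall x n, `|u n x| <= g x} ->
  L1 f /\ forall e : R, 0 < e -> \forall n \near \oo, N1 (fun x => u n x - f x) <= e.
Proof.
move=> u1 mf g1 uf ug.
have [] := @dominated_convergence _ T R mu _ measurableT (fun n => EFin \o u n) (EFin \o f) (EFin \o g).
- by move=> n; apply/measurable_EFinP; exact: L1_meas.
- exact/measurable_EFinP.
- by apply: filterS uf => x uf _; apply: cvg_EFin => //; apply: nearW.
- exact: L1_integrable.
- by apply: filterS ug => x ug n _ /=; rewrite lee_fin.
move=> fi c0 _.
have f1 : L1 f by apply/Lfun1_integrable.
split => // e e0.
have : (\forall n \near \oo, (N1 (fun x => u n x - f x))%:E <= e%:E)%E.
  move/fine_cvgP: c0 => [fc c0].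
  have /cvgrPdist_le := c0 => /(_ e e0).
  apply: filterS => n /=.
  have -> : (\int[mu]_x `|(u n x)%:E - (f x)%:E| = (N1 (fun x => u n x - f x))%:E)%E.
    by rewrite -[LHS]/(\int[mu]_x (`|u n x - f x|)%:E)%E E_fin//; apply: L1_norm; exact: L1B.
  by rewrite lee_fin sub0r normrN/= => /(le_trans (ler_norm _)).
by apply: filterS => n; rewrite lee_fin.
Qed.

(** Completeness of L^1, for sequences with geometrically small increments. *)
Lemma L1_complete (u : nat -> T -> R) : (forall n, L1 (u n)) ->
  (forall n, N1 (fun x => u n.+1 x - u n x) <= 2^-1 ^+ n) ->
  exists2 g, L1 g & (forall e : R, 0 < e -> \forall n \near \oo, N1 (fun x => u n x - g x) <= e)
    /\ {ae mu, forall x, u n x @[n --> \oo] --> g x}.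
Proof.
move=> u1 du.
have [s s1 hs] := L1_summable (fun n => L1B (u1 n.+1) (u1 n)) du.
pose g x := fine (limn_esup (fun n => (u n x)%:E)).
have mg : measurable_fun [set: T] g.
  apply: measurableT_comp => //; apply: measurable_fun_limn_esup => n.
  by apply/measurable_EFinP; exact: L1_meas.
have tel n x : u n x = u 0%N x + \sum_(i < n) (u i.+1 x - u i x).
  elim: n => [|n IH]; first by rewrite big_ord0 addr0.
  by rewrite big_ord_recr/= addrA -IH; lra.
have ug : {ae mu, forall x, u n x @[n --> \oo] --> g x}.
  apply: filterS hs => x hx.
  have /cvg_ex[l hl] := @cvg_of_bounded_abs (fun i => u i.+1 x - u i x) _ hx.
  have ul : u n x @[n --> \oo] --> u 0%N x + l.
    have -> : (fun n => u n x) = (fun n => u 0%N x + series (fun i => u i.+1 x - u i x) n).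
      by apply/funext => n; rewrite tel seriesEord.
    by apply: cvgD => //; exact: cvg_cst.
  suff -> : g x = u 0%N x + l by [].
  have ulE : (u n x)%:E @[n --> \oo] --> (u 0%N x + l)%:E.
    by apply: cvg_EFin => //; exact: nearW.
  rewrite /g is_cvg_limn_esupE; last by apply/cvg_ex; eexists; exact: ulE.
  by rewrite (cvg_lim _ ulE).
have bnd : {ae mu, forall x n, `|u n x| <= `|u 0%N x| + s x}.
  apply: filterS hs => x hx n; rewrite tel (le_trans (ler_normD _ _))// lerD2l.
  by apply: le_trans (hx n); exact: ler_norm_sum.
have [g1 cg] := N1_cvg_dominated u1 mg (L1D (L1_norm (u1 0%N)) s1) ug bnd.
by exists g.
Qed.

End convergence.

(** * Symmetric Markov semigroups *)

Section right_limits.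
Context {R : realType}.

Lemma near_rightP (a : R) (Q : R -> Prop) :
  (\forall t \near a^'+, Q t) <->
  exists2 r : R, 0 < r & forall t, a < t -> t < a + r -> Q t.
Proof.
split.
- rewrite /at_right near_withinE => /nbhs_ballP[r /= r0 hr]; exists r => // t t0 tr.
  by apply: hr => //; rewrite /ball/= distrC gtr0_norm ?subr_gt0// ltrBlDl.
- move=> [r r0 hr]; rewrite /at_right near_withinE; apply/nbhs_ballP; exists r => // t /=.
  rewrite /ball/= => tr t0; apply: hr => //.
  by move: tr; rewrite distrC gtr0_norm ?subr_gt0// ltrBlDl.
Qed.

End right_limits.

Section Markov.
Context d (T : measurableType d) (R : realType).
Variable mu : probability T R.
Variable P : R -> (T -> R) -> (T -> R).
Hypothesis hP : symmetric_Markov_semigroup mu P.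
Implicit Types (f g h : T -> R) (t s a c M : R).

Local Notation L1 f := (f \in Lfun mu 1%E).
Local Notation E f := (\int[mu]_x f x).
Local Notation N1 := (L1norm mu).

Lemma P_L1 t f : 0 <= t -> L1 f -> L1 (P t f).
Proof. exact: sg_L1. Qed.

Lemma P_B t f g : 0 <= t -> L1 f -> L1 g ->
  {ae mu, forall x, P t (fun y => f y - g y) x = P t f x - P t g x}.
Proof.
move=> t0 f1 g1.
have -> : (fun y => f y - g y) = (fun y => -1 * g y + f y).
  by apply/funext => y; rewrite mulN1r addrC.
by apply: filterS (sg_linear hP (-1) t0 g1 f1) => x ->; rewrite mulN1r addrC.
Qed.

Lemma P_0 t : 0 <= t -> {ae mu, forall x, P t (fun _ => 0) x = 0}.
Proof.
move=> t0; have := P_B t0 (L1_cst mu 0) (L1_cst mu 0).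
have -> : (fun _ : T => 0 - 0 : R) = (fun _ => 0) by apply/funext => y; rewrite subrr.
by apply: filterS => x ->; rewrite subrr.
Qed.

Lemma P_Z t a f : 0 <= t -> L1 f -> {ae mu, forall x, P t (fun y => a * f y) x = a * P t f x}.
Proof.
move=> t0 f1; have := sg_linear hP a t0 f1 (L1_cst mu 0).
have -> : (fun y => a * f y + 0) = (fun y => a * f y) by apply/funext => y; rewrite addr0.
by apply: filterS2 (P_0 t0) => x -> ->; rewrite addr0.
Qed.

Lemma P_D t f g : 0 <= t -> L1 f -> L1 g ->
  {ae mu, forall x, P t (fun y => f y + g y) x = P t f x + P t g x}.
Proof.
move=> t0 f1 g1; have := sg_linear hP 1 t0 f1 g1.
have -> : (fun y => 1 * f y + g y) = (fun y => f y + g y).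
  by apply/funext => y; rewrite mul1r.
by apply: filterS => x ->; rewrite mul1r.
Qed.

Lemma P_cst t a : 0 <= t -> {ae mu, forall x, P t (fun _ => a) x = a}.
Proof.
move=> t0; have := P_Z a t0 (L1_cst mu 1).
have -> : (fun _ : T => a * 1) = (fun _ => a) by apply/funext => y; rewrite mulr1.
by apply: filterS2 (sg_1 hP t0) => x -> ->; rewrite mulr1.
Qed.

Lemma P_mono t f g : 0 <= t -> L1 f -> L1 g ->
  {ae mu, forall x, f x <= g x} -> {ae mu, forall x, P t f x <= P t g x}.
Proof.
move=> t0 f1 g1 fg; have := sg_ge0 hP t0 (L1B g1 f1).
move=> /(_ _) h; apply: filterS2 (h _) (P_B t0 g1 f1).
  by move=> x h0 hx; rewrite -subr_ge0 -hx.
by apply: filterS fg => x fg; rewrite subr_ge0.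
Qed.

Lemma P_ae t f g : 0 <= t -> L1 f -> L1 g ->
  {ae mu, forall x, f x = g x} -> {ae mu, forall x, P t f x = P t g x}.
Proof.
move=> t0 f1 g1 fg.
have h1 : {ae mu, forall x, P t f x <= P t g x}.
  by apply: P_mono => //; apply: filterS fg => x ->.
have h2 : {ae mu, forall x, P t g x <= P t f x}.
  by apply: P_mono => //; apply: filterS fg => x ->.
by apply: filterS2 h1 h2 => x h1 h2; apply/eqP; rewrite eq_le h1 h2.
Qed.

Lemma P_ge t c f : 0 <= t -> L1 f -> {ae mu, forall x, c <= f x} ->
  {ae mu, forall x, c <= P t f x}.
Proof.
move=> t0 f1 cf.
by apply: filterS2 (P_cst c t0) (P_mono t0 (L1_cst mu c) f1 cf) => x ->.
Qed.

Lemma P_le t c f : 0 <= t -> L1 f -> {ae mu, forall x, f x <= c} ->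
  {ae mu, forall x, P t f x <= c}.
Proof.
move=> t0 f1 cf.
by apply: filterS2 (P_cst c t0) (P_mono t0 f1 (L1_cst mu c) cf) => x ->.
Qed.

Lemma P_abs t f : 0 <= t -> L1 f ->
  {ae mu, forall x, `|P t f x| <= P t (fun y => `|f y|) x}.
Proof.
move=> t0 f1; have f2 := L1_norm f1.
have h1 := P_mono t0 f1 f2 (aeW _ (fun x => ler_norm (f x))).
have h2 := P_mono t0 (L1Z (-1) f1) f2 (aeW _ (fun x => _)).
have {}h2 : {ae mu, forall x, P t (fun x => -1 * f x) x <= P t (fun x => `|f x|) x}.
  by apply: h2 => x; rewrite mulN1r lerNl lerNnormlW.
apply: filterS3 h1 h2 (P_Z (-1) t0 f1) => x h1 + h2.
by rewrite h2 mulN1r => h3; rewrite ler_norml lerNl h1 h3.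
Qed.

Lemma P_bdd t f : 0 <= t -> ess_bdd mu f -> ess_bdd mu (P t f).
Proof.
move=> t0 bf; have f1 := L1_bdd bf; split; first by apply: (@L1_meas _ _ _ mu); exact: P_L1.
case: bf => mf [M fM]; exists M.
apply: filterS2 (P_abs t0 f1) (P_le t0 (L1_norm f1) fM) => x.
exact: le_trans.
Qed.

Lemma P_sym t f g : 0 <= t -> L1 f -> ess_bdd mu g ->
  E (fun x => P t f x * g x) = E (fun x => f x * P t g x).
Proof.
by move=> t0 f1 /ess_bddP bg; congr fine; exact: sg_sym.
Qed.

Lemma P_mean t f : 0 <= t -> L1 f -> E (P t f) = E f.
Proof.
move=> t0 f1; have := P_sym t0 f1 (ess_bdd_cst mu 1).
have -> : (fun x => P t f x * 1) = P t f by apply/funext => x; rewrite mulr1.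
move=> ->; apply: E_ae => //.
  have -> : (fun x => f x * P t (fun _ => 1) x) = (fun x => P t (fun _ => 1) x * f x).
    by apply/funext => x; rewrite mulrC.
  by apply: L1M => //; apply: P_bdd => //; exact: ess_bdd_cst.
by apply: filterS (sg_1 hP t0) => x /= ->; rewrite mulr1.
Qed.

(** Contractivity in L^1: positivity and invariance of the measure. *)
Lemma P_N1 t f : 0 <= t -> L1 f -> N1 (P t f) <= N1 f.
Proof.
move=> t0 f1; rewrite /L1norm -(P_mean t0 (L1_norm f1)).
apply: le_E; first by apply: L1_norm; exact: P_L1.
  by apply: P_L1 => //; exact: L1_norm.
exact: P_abs.
Qed.

Lemma P_N1B t f g : 0 <= t -> L1 f -> L1 g ->
  N1 (fun x => P t f x - P t g x) <= N1 (fun x => f x - g x).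
Proof.
move=> t0 f1 g1; apply: le_trans (P_N1 t0 (L1B f1 g1)).
rewrite (@eq_N1 _ _ _ _ _ (P t (fun x => f x - g x)))//.
- by apply: L1B; exact: P_L1.
- by apply: P_L1 => //; exact: L1B.
- by apply: filterS (P_B t0 f1 g1) => x ->.
Qed.

Lemma P_sum (I : Type) (r : seq I) (F : I -> T -> R) t : 0 <= t -> (forall i, L1 (F i)) ->
  {ae mu, forall x, P t (fun y => \sum_(i <- r) F i y) x = \sum_(i <- r) P t (F i) x}.
Proof.
move=> t0 F1; elim: r => [|i r IH].
  have -> : (fun y => \sum_(i <- [::]) F i y) = (fun _ => 0).
    by apply/funext => y; rewrite big_nil.
  by apply: filterS (P_0 t0) => x ->; rewrite big_nil.
have -> : (fun y => \sum_(j <- i :: r) F j y) = (fun y => F i y + \sum_(j <- r) F j y).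
  by apply/funext => y; rewrite big_cons.
apply: filterS2 IH (P_D t0 (F1 i) (L1_sum r F1)) => x IH ->.
by rewrite IH big_cons.
Qed.

(** Differentiating in L^1 norm from the right at 0, in epsilon-delta form. *)
Lemma N1_cvg0P (u : R -> T -> R) : (forall t, 0 < t -> L1 (u t)) ->
  ('N[mu]_1[EFin \o u t])%E @[t --> 0^'+] --> 0%E <->
  (forall e, 0 < e -> \forall t \near 0^'+, N1 (u t) <= e).
Proof.
move=> u1; split.
- move=> /fine_cvgP[_ /cvgrPdist_le c0] e e0.
  have t0 : \forall t \near (0:R)^'+, 0 < t by exact: nbhs_right_gt.
  apply: filterS2 t0 (c0 e e0) => t t0 /=.
  by rewrite N1E ?u1//= sub0r normrN => /(le_trans (ler_norm _)).
- move=> h.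
  have t0 : \forall t \near (0:R)^'+, 0 < t by exact: nbhs_right_gt.
  apply/fine_cvgP; split.
    by apply: filterS t0 => t t0; rewrite N1E ?u1.
  apply/cvgrPdist_le => e e0; apply: filterS2 t0 (h e e0) => t t0 /=.
  by rewrite N1E ?u1//= sub0r normrN ger0_norm// N1_ge0.
Qed.

Lemma P_cont f e : L1 f -> 0 < e ->
  exists2 r, 0 < r & forall t, 0 <= t -> t < r -> N1 (fun x => P t f x - f x) <= e.
Proof.
move=> f1 e0.
have : \forall t \near 0^'+, N1 (fun x => P t f x - f x) <= e.
  move: e e0; apply/N1_cvg0P => [t t0|]; last exact: sg_cvg.
  by apply: L1B => //; apply: P_L1 => //; exact: ltW.
move=> /near_rightP[r r0 hr]; exists r => // t; rewrite le_eqVlt => /predU1P[<- _|t0 tr].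
  rewrite (@eq_N1 _ _ _ _ _ (fun _ => 0)).
  - by rewrite N1_cst normr0 ltW.
  - by apply: L1B => //; exact: P_L1.
  - exact: L1_cst.
  - by apply: filterS (sg_0 hP f1) => x ->; rewrite subrr.
by apply: hr; rewrite ?add0r.
Qed.

(** Moving along the semigroup does not increase the modulus of continuity. *)
Lemma P_shift s t f : 0 <= s -> 0 <= t -> L1 f ->
  N1 (fun x => P (s + t) f x - P s f x) <= N1 (fun x => P t f x - f x).
Proof.
move=> s0 t0 f1; have Pf1 := P_L1 t0 f1.
rewrite (@eq_N1 _ _ _ _ _ (fun x => P s (P t f) x - P s f x)).
- exact: P_N1B.
- by apply: L1B; apply: P_L1 => //; exact: addr_ge0.
- by apply: L1B; exact: P_L1.
- by apply: filterS (sg_add hP s0 t0 f1) => x ->.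
Qed.

Lemma generates_P f g : generates mu P f g <->
  [/\ L1 f, L1 g & forall e, 0 < e -> \forall h \near 0^'+,
    N1 (fun x => P h f x - f x - h * g x) <= e * h].
Proof.
have key (h : R) f' g' : 0 < h -> L1 f' -> L1 g' ->
    N1 (fun x => P h f' x - f' x - h * g' x) = h * N1 (fun x => (P h f' x - f' x) / h - g' x).
  move=> h0 f1 g1.
  have h1 : L1 (fun x => (P h f' x - f' x) / h - g' x).
    apply: L1B => //.
    have -> : (fun x => (P h f' x - f' x) / h) = (fun x => h^-1 * (P h f' x - f' x)).
      by apply/funext => x; rewrite mulrC.
    by apply: L1Z; apply: L1B => //; apply: P_L1 => //; exact: ltW.
  rewrite -[X in X * _](gtr0_norm h0) -N1Z//; congr L1norm; apply/funext => x.
  by rewrite mulrBr mulrCA divff ?mulr1 ?gt_eqF.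
split=> [[f1 g1 c]|[f1 g1 c]]; split => //.
- have := c; move/N1_cvg0P => h e e0.
  have {}h : \forall h \near 0^'+, N1 (fun x => (P h f x - f x) / h - g x) <= e.
    apply: h => // t t0; apply: L1B => //.
    have -> : (fun x => (P t f x - f x) / t) = (fun x => t^-1 * (P t f x - f x)).
      by apply/funext => x; rewrite mulrC.
    by apply: L1Z; apply: L1B => //; apply: P_L1 => //; exact: ltW.
  have t0 : \forall t \near (0:R)^'+, 0 < t by exact: nbhs_right_gt.
  by apply: filterS2 t0 h => t t0 ht; rewrite key// mulrC ler_pM2r.
- apply/N1_cvg0P => [t t0|e e0].
    apply: L1B => //.
    have -> : (fun x => (P t f x - f x) / t) = (fun x => t^-1 * (P t f x - f x)).
      by apply/funext => x; rewrite mulrC.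
    by apply: L1Z; apply: L1B => //; apply: P_L1 => //; exact: ltW.
  have t0 : \forall t \near (0:R)^'+, 0 < t by exact: nbhs_right_gt.
  apply: filterS2 t0 (c e e0) => t t0; rewrite key// mulrC ler_pM2r//.
Qed.

End Markov.

(** * Means along orbits of the semigroup *)

Section averages.
Context d (T : measurableType d) (R : realType).
Variable mu : probability T R.
Variable P : R -> (T -> R) -> (T -> R).
Hypothesis hP : symmetric_Markov_semigroup mu P.
Implicit Types (f g : T -> R) (t s a c M h e : R).

Local Notation L1 f := (f \in Lfun mu 1%E).
Local Notation E f := (\int[mu]_x f x).
Local Notation N1 := (L1norm mu).

(** [orbit_mean f s n] is the Riemann sum of (1/s) \int_0^s P_r f dr with n steps.
    Working with finite sums avoids the joint measurability of (r, x) |-> P_r f x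
    that a genuine time integral would require. *)
Definition orbit_sum f h (n : nat) : T -> R := fun x => \sum_(0 <= k < n) P (k%:R * h) f x.

Definition orbit_mean f s (n : nat) : T -> R := fun x => n%:R^-1 * orbit_sum f (s / n%:R) n x.

Lemma orbit_sum_L1 f h n : 0 <= h -> L1 f -> L1 (orbit_sum f h n).
Proof.
move=> h0 f1; apply: L1_sum => k; apply: (P_L1 hP) => //.
by rewrite mulr_ge0.
Qed.

Lemma orbit_mean_L1 f s n : 0 <= s -> L1 f -> L1 (orbit_mean f s n).
Proof. by move=> s0 f1; apply: L1Z; apply: orbit_sum_L1 => //; rewrite divr_ge0. Qed.

(** Each of the n coarse points is compared with the m fine points that follow
    it; these lie at distance at most m h along the orbit. *)
Lemma orbit_sum_refine f h e (n m : nat) : 0 <= h -> L1 f ->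
  (forall t, 0 <= t -> t <= m%:R * h -> N1 (fun x => P t f x - f x) <= e) ->
  N1 (fun x => orbit_sum f h (n * m) x - m%:R * orbit_sum f (m%:R * h) n x)
    <= (n * m)%:R * e.
Proof.
move=> h0 f1 he; elim: n => [|n IH].
  rewrite mul0n mul0r /orbit_sum; apply: le_trans (_ : N1 (fun=> 0) <= _); last first.
    by rewrite N1_cst normr0.
  apply: le_N1; last by apply: aeW => x; rewrite !big_geq// mulr0 subrr.
    apply: L1B; [|apply: L1Z]; exact: (@orbit_sum_L1 f _ 0%N _ f1) || 
      by apply: orbit_sum_L1 => //; rewrite mulr_ge0.
  exact: L1_cst.
have mh0 : 0 <= m%:R * h by rewrite mulr_ge0.
have -> : (fun x => orbit_sum f h (n.+1 * m) x - m%:R * orbit_sum f (m%:R * h) n.+1 x) =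
  (fun x => (orbit_sum f h (n * m) x - m%:R * orbit_sum f (m%:R * h) n x) +
    \sum_(0 <= j < m) (P (n%:R * (m%:R * h) + j%:R * h) f x - P (n%:R * (m%:R * h)) f x)).
  apply/funext => x; rewrite /orbit_sum.
  rewrite big_nat_recr//= (@big_cat_nat _ _ _ (n * m))//=; last by rewrite leq_mul2r leqnSn orbT.
  have -> : \sum_(n * m <= i < n.+1 * m) P (i%:R * h) f x =
     \sum_(0 <= j < m) P (n%:R * (m%:R * h) + j%:R * h) f x.
    rewrite -{1}[(n * m)%N]add0n big_addn mulSn addnK; apply: eq_bigr => j _.
    by congr (P _ f x); rewrite natrD natrM; ring.
  rewrite sumrB sumr_const_nat subn0 -mulr_natl; ring.
apply: le_trans (N1D _ _) _.
- by apply: L1B; [|apply: L1Z]; apply: orbit_sum_L1.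
- by apply: L1_sum => j; apply: L1B; apply: (P_L1 hP) => //; rewrite ?addr_ge0// !mulr_ge0.
rewrite mulSn addnC natrD mulrDl lerD//.
apply: le_trans (N1_sum _ _) _.
  by move=> j; apply: L1B; apply: (P_L1 hP) => //; rewrite ?addr_ge0// !mulr_ge0.
have -> : m%:R * e = \sum_(0 <= j < m) e by rewrite sumr_const_nat subn0 mulr_natl.
rewrite !big_nat; apply: ler_sum => j /= jm.
apply: le_trans (P_shift hP _ _ f1) _ => //; rewrite ?mulr_ge0//.
by apply: he; rewrite ?mulr_ge0// ler_wpM2r// ler_nat ltnW.
Qed.

Lemma orbit_mean_refine f s e (n m : nat) : 0 <= s -> L1 f -> (0 < n)%N -> (0 < m)%N ->
  (forall t, 0 <= t -> t <= s / n%:R -> N1 (fun x => P t f x - f x) <= e) ->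
  N1 (fun x => orbit_mean f s (n * m) x - orbit_mean f s n x) <= e.
Proof.
move=> s0 f1 n0 m0 he.
have n0' : (0 : R) < n%:R by rewrite ltr0n.
have m0' : (0 : R) < m%:R by rewrite ltr0n.
set h := s / (n * m)%:R.
have h0 : 0 <= h by rewrite divr_ge0.
have mh : m%:R * h = s / n%:R by rewrite /h natrM; field; rewrite !gt_eqF.
have -> : (fun x => orbit_mean f s (n * m) x - orbit_mean f s n x) =
  (fun x => (n * m)%:R^-1 * (orbit_sum f h (n * m) x - m%:R * orbit_sum f (m%:R * h) n x)).
  apply/funext => x; rewrite /orbit_mean mh -/h natrM; field.
  by rewrite !gt_eqF.
rewrite N1Z; last by apply: L1B; [|apply: L1Z]; apply: orbit_sum_L1 => //; rewrite mulr_ge0.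
rewrite ger0_norm ?invr_ge0// ler_pdivrMl; last by rewrite ltr0n muln_gt0 n0.
by apply: orbit_sum_refine => // t; rewrite mh; exact: he.
Qed.

Lemma orbit_mean_near f s e (n : nat) : 0 <= s -> L1 f -> (0 < n)%N ->
  (forall t, 0 <= t -> t <= s -> N1 (fun x => P t f x - f x) <= e) ->
  N1 (fun x => orbit_mean f s n x - f x) <= e.
Proof.
move=> s0 f1 n0 he.
have n0' : (0 : R) < n%:R by rewrite ltr0n.
have h0 (j : nat) : 0 <= j%:R * (s / n%:R) by rewrite mulr_ge0// divr_ge0.
have -> : (fun x => orbit_mean f s n x - f x) =
  (fun x => n%:R^-1 * \sum_(0 <= k < n) (P (k%:R * (s / n%:R)) f x - f x)).
  apply/funext => x; rewrite /orbit_mean /orbit_sum sumrB sumr_const_nat subn0 -mulr_natl.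
  by field; rewrite gt_eqF.
have PL j : L1 (fun x => P (j%:R * (s / n%:R)) f x - f x).
  by apply: L1B => //; exact: (P_L1 hP).
rewrite N1Z; last exact: L1_sum.
rewrite ger0_norm ?invr_ge0// ler_pdivrMl//.
apply: le_trans (N1_sum _ _) _ => //.
have -> : n%:R * e = \sum_(0 <= j < n) e by rewrite sumr_const_nat subn0 mulr_natl.
rewrite !big_nat; apply: ler_sum => j /= jn.
by apply: he => //; rewrite mulrCA ler_piMr// ler_pdivrMr// mul1r ler_nat ltnW.
Qed.

Lemma orbit_mean_ge f s c (n : nat) : 0 <= s -> L1 f -> (0 < n)%N ->
  {ae mu, forall x, c <= f x} -> {ae mu, forall x, c <= orbit_mean f s n x}.
Proof.
move=> s0 f1 n0 cf.
have n0' : (0 : R) < n%:R by rewrite ltr0n.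
have h0 (j : nat) : 0 <= j%:R * (s / n%:R) by rewrite mulr_ge0// divr_ge0.
have := ae_foralln (fun j => P_ge hP (h0 j) f1 cf).
apply: filterS => x hx; rewrite /orbit_mean ler_pdivlMl//.
have -> : n%:R * c = \sum_(0 <= j < n) c by rewrite sumr_const_nat subn0 mulr_natl.
exact: ler_sum.
Qed.

Lemma orbit_mean_le f s c (n : nat) : 0 <= s -> L1 f -> (0 < n)%N ->
  {ae mu, forall x, f x <= c} -> {ae mu, forall x, orbit_mean f s n x <= c}.
Proof.
move=> s0 f1 n0 cf.
have n0' : (0 : R) < n%:R by rewrite ltr0n.
have h0 (j : nat) : 0 <= j%:R * (s / n%:R) by rewrite mulr_ge0// divr_ge0.
have := ae_foralln (fun j => P_le hP (h0 j) f1 cf).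
apply: filterS => x hx; rewrite /orbit_mean ler_pdivrMl//.
have -> : n%:R * c = \sum_(0 <= j < n) c by rewrite sumr_const_nat subn0 mulr_natl.
exact: ler_sum.
Qed.

(** The increments along the orbit points 0, h, ..., n h = s telescope. *)
Lemma P_orbit_mean f s (n : nat) : 0 < s -> L1 f -> (0 < n)%N ->
  {ae mu, forall x, P (s / n%:R) (orbit_mean f s n) x - orbit_mean f s n x =
    s / n%:R * ((P s f x - f x) / s)}.
Proof.
move=> s0 f1 n0.
have n0' : (0 : R) < n%:R by rewrite ltr0n.
set h := s / n%:R; have h0 : 0 <= h by rewrite divr_ge0// ltW.
have h0' (j : nat) : 0 <= j%:R * h by rewrite mulr_ge0.
have e1 := P_Z hP n%:R^-1 h0 (orbit_sum_L1 n h0 f1).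
have e2 := P_sum hP (index_iota 0 n) h0 (fun j => P_L1 hP (h0' j) f1).
have e3 := ae_foralln (fun j => sg_add hP h0 (h0' j) f1).
apply: filterS3 (sg_0 hP f1) e1 (filterI e2 e3) => x x0 x1 [x2 x3].
rewrite {1}/orbit_mean -/h x1 x2 /orbit_mean -/h -mulrBr /orbit_sum -sumrB.
have -> : \sum_(0 <= i < n) (P h (P (i%:R * h) f) x - P (i%:R * h) f x) =
   \sum_(0 <= i < n) (P (i.+1%:R * h) f x - P (i%:R * h) f x).
  by apply: eq_bigr => j _; rewrite -x3; congr (P _ f x - _); rewrite -natr1; ring.
rewrite telescope_sumr// mul0r x0.
have -> : n%:R * h = s by rewrite /h; field; rewrite gt_eqF.
by rewrite /h; field; rewrite !gt_eqF.
Qed.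

(** If one step of size h moves f by h w, then j steps move it by jh w up to
    the modulus of continuity of [w]. *)
Lemma P_steps f w h e (j : nat) : 0 <= h -> L1 f -> L1 w ->
  {ae mu, forall x, P h f x - f x = h * w x} ->
  (forall t, 0 <= t -> t <= j%:R * h -> N1 (fun x => P t w x - w x) <= e) ->
  N1 (fun x => P (j%:R * h) f x - f x - j%:R * h * w x) <= j%:R * h * e.
Proof.
move=> h0 f1 w1 fw; elim: j => [|j IH] he.
  rewrite !mul0r; apply: le_trans (_ : N1 (fun=> 0) <= _); last by rewrite N1_cst normr0.
  apply: le_N1; [|exact: L1_cst|].
    by apply: L1B; [apply: L1B => //; exact: (P_L1 hP)|exact: L1Z].
  by apply: filterS (sg_0 hP f1) => x ->; rewrite !mul0r !subrr.
have h0' (i : nat) : 0 <= i%:R * h by rewrite mulr_ge0.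
have PL i : L1 (P (i%:R * h) f) by exact: (P_L1 hP).
have PW i : L1 (P (i%:R * h) w) by exact: (P_L1 hP).
have jh : j%:R * h <= j.+1%:R * h by rewrite ler_wpM2r// ler_nat.
rewrite (@eq_N1 _ _ _ _ _ (fun x => (P (j%:R * h) f x - f x - j%:R * h * w x) +
   h * (P (j%:R * h) w x - w x))).
- apply: le_trans (N1D _ _) _.
  + by apply: L1B; [exact: L1B|exact: L1Z].
  + by apply: L1Z; exact: L1B.
  have -> : j.+1%:R * h * e = j%:R * h * e + h * e by rewrite -natr1; ring.
  rewrite lerD// ?IH//.
    by move=> t t0 tj; apply: he => //; exact: le_trans jh.
  rewrite N1Z; last exact: L1B.
  by rewrite ger0_norm// ler_wpM2l// he.
- by apply: L1B; [exact: L1B|exact: L1Z].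
- by apply: L1D; [apply: L1B; [exact: L1B|exact: L1Z]|apply: L1Z; exact: L1B].
- have e1 := sg_add hP (h0' j) h0 f1.
  have e2 := P_B hP (h0' j) (P_L1 hP h0 f1) f1.
  have e3 := P_ae hP (h0' j) (L1B (P_L1 hP h0 f1) f1) (L1Z h w1) fw.
  have e4 := P_Z hP h (h0' j) w1.
  apply: filterS2 (filterI e1 e2) (filterI e3 e4) => x [x1 x2] [x3 x4].
  have -> : j.+1%:R * h = j%:R * h + h by rewrite -natr1; ring.
  by rewrite x1; move: x2; rewrite x3 x4 => x2; lra.
Qed.

End averages.

(** * Density of the domain of the generator *)

Section density.
Context d (T : measurableType d) (R : realType).
Variable mu : probability T R.
Variable P : R -> (T -> R) -> (T -> R).
Hypothesis hP : symmetric_Markov_semigroup mu P.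
Implicit Types (f g : T -> R) (t s a c M h e : R).

Local Notation L1 f := (f \in Lfun mu 1%E).
Local Notation E f := (\int[mu]_x f x).
Local Notation N1 := (L1norm mu).

Lemma N1_sum5 (a b c d' g : T -> R) : L1 a -> L1 b -> L1 c -> L1 d' -> L1 g ->
  N1 (fun x => a x + b x + c x + d' x + g x) <= N1 a + N1 b + N1 c + N1 d' + N1 g.
Proof.
move=> a1 b1 c1 d1 g1.
have ab := L1D a1 b1; have abc := L1D ab c1; have abcd := L1D abc d1.
apply: le_trans (N1D abcd g1) _; rewrite lerD2r.
apply: le_trans (N1D abc d1) _; rewrite lerD2r.
apply: le_trans (N1D ab c1) _; rewrite lerD2r.
exact: N1D.
Qed.

(** The time averages (1/s) \int_0^s P_r f dr, obtained as L^1-limits of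
    Riemann sums, lie in the domain of the generator; they approximate [f] and
    keep its bounds. *)
Lemma dom_dense f e : L1 f -> 0 < e ->
  exists g, [/\ dom mu P g, N1 (fun x => g x - f x) <= e,
    (forall c, {ae mu, forall x, c <= f x} -> {ae mu, forall x, c <= g x}) &
    (forall c, {ae mu, forall x, f x <= c} -> {ae mu, forall x, g x <= c})].
Proof.
move=> f1 e0.
have e20 : 0 < e / 2 by rewrite divr_gt0.
have [r r0 hr] := P_cont hP f1 e20.
pose s := r / 2; have s0 : 0 < s by rewrite divr_gt0.
have half0 k : (0 : R) < 2^-1 ^+ k by rewrite exprn_gt0.
have halfS k : (2^-1 : R) ^+ k.+1 <= 2^-1 ^+ k.
  by rewrite exprS; have := half0 k; lra.
have : forall k, exists n, [/\ (0 < n)%N, s / n%:R <= 2^-1 ^+ k &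
    forall t, 0 <= t -> t <= s / n%:R -> N1 (fun x => P t f x - f x) <= 2^-1 ^+ k.+1 / 2].
  move=> k.
  have ek : 0 < (2^-1 : R) ^+ k.+1 / 2 by rewrite divr_gt0.
  have [r' r'0 hr'] := P_cont hP f1 ek.
  pose m := Num.min r' (2^-1 ^+ k); have m0 : 0 < m by rewrite lt_min r'0 half0.
  have sn : s / (Num.truncn (s / m)).+1%:R < m.
    by rewrite ltr_pdivrMr// mulrC -ltr_pdivrMr// truncnS_gt.
  exists (Num.truncn (s / m)).+1; split => //.
    by rewrite (le_trans (ltW sn))// ge_min lexx orbT.
  move=> t t0 ts; apply: hr' => //; rewrite (le_lt_trans ts)// (lt_le_trans sn)//.
  by rewrite ge_min lexx.
move=> /choice[n hn].
pose A k := orbit_mean P f s (n k).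
have A1 k : L1 (A k) by apply: (orbit_mean_L1 hP) => //; exact: ltW.
have dA k : N1 (fun x => A k.+1 x - A k x) <= 2^-1 ^+ k.
  have [n0 nk hk] := hn k; have [n0' nk' hk'] := hn k.+1.
  have h1 : N1 (fun x => orbit_mean P f s (n k * n k.+1) x - A k x) <= 2^-1 ^+ k / 2.
    apply: (orbit_mean_refine hP) => // [|t t0 /hk]; first exact: ltW.
    by move/(_ t0)/le_trans; apply; have := halfS k; lra.
  have h2 : N1 (fun x => orbit_mean P f s (n k.+1 * n k) x - A k.+1 x) <= 2^-1 ^+ k / 2.
    apply: (orbit_mean_refine hP) => // [|t t0 /hk']; first exact: ltW.
    by move/(_ t0)/le_trans; apply; have := halfS k; have := halfS k.+1; lra.
  apply: le_trans (N1_trans (h := orbit_mean P f s (n k * n k.+1)) _ _ _) _ => //.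
    by apply: (orbit_mean_L1 hP) => //; exact: ltW.
  rewrite N1_subC {1}mulnC; apply: le_trans (lerD h2 h1) _.
  lra.
have [g g1 [Ag Ag']] := L1_complete A1 dA.
have n_gt0 k : (0 < n k)%N by have [] := hn k.
exists g; split.
- pose w x := (P s f x - f x) / s.
  have w1 : L1 w.
    rewrite (_ : w = (fun x => s^-1 * (P s f x - f x))); last first.
      by apply/funext => x; rewrite /w mulrC.
    by apply: L1Z; apply: L1B => //; apply: (P_L1 hP) => //; exact: ltW.
  exists w; apply/(generates_P hP); split => // e' e'0.
  have e'2 : 0 < e' / 2 by rewrite divr_gt0.
  have [r' r'0 hr'] := P_cont hP w1 e'2.
  apply/near_rightP; exists r' => // t t0; rewrite add0r => tr'.
  (* what remains besides the main term must vanish along the approximation *)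
  have t20 := ltW t0.
  suff main : forall q, 0 < q -> N1 (fun x => P t g x - g x - t * w x) <=
      t * (e' / 2) + (5 + N1 w) * q.
    have K0 : 0 < 5 + N1 w by rewrite ltr_wpDr// N1_ge0.
    have := main (t * (e' / 2) / (5 + N1 w)).
    rewrite divr_gt0//; last by rewrite mulr_gt0.
    move=> /(_ isT)/le_trans; apply.
    have -> : (5 + N1 w) * (t * (e' / 2) / (5 + N1 w)) = t * (e' / 2).
      by field; rewrite gt_eqF.
    lra.
  move=> q q0.
  have [rq rq0 hrq] := P_cont hP g1 q0.
  have cvg_half : \forall k \near \oo, (2^-1 : R) ^+ k < Num.min q rq.
    have : (2^-1 : R) ^+ k @[k --> \oo] --> 0.
      by apply: cvg_expr; rewrite ger0_norm ?invf_lt1 ?ltr1n.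
    by move=> /cvgrPdist_lt/(_ (Num.min q rq)); rewrite lt_min q0 rq0 => /(_ isT); apply: filterS => k;
      rewrite sub0r normrN ger0_norm// ltW.
  (* a step h = s / n k that is small compared with t, and an approximation of g
     by a Riemann sum with that step *)
  have [k [hk1 hk2]] := @filter_ex _ \oo _ _ (filterI cvg_half (Ag q q0)).
  have [nk0 nk _] := hn k; set h := s / (n k)%:R in nk.
  have h0 : 0 < h by rewrite divr_gt0// ltr0n.
  have [hq hrq'] : h < q /\ h < rq.
    by move: hk1; rewrite lt_min => /andP[]; split; exact: le_lt_trans nk _.
  (* on a multiple of h the increment of a Riemann sum is explicit; the remaining
     time u < h is absorbed by continuity *)
  pose j := Num.truncn (t / h).
  have jt : j%:R * h <= t by rewrite -ler_pdivlMr// truncn_le// divr_ge0// ltW.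
  have tj : t < j%:R * h + h.
    have := truncnS_gt (t / h); rewrite -/j ltr_pdivrMr//.
    by rewrite -natr1 mulrDl mul1r.
  set u := t - j%:R * h.
  have u0 : 0 <= u by rewrite subr_ge0.
  have uh : u < h by rewrite /u ltrBlDl.
  have jh0 : 0 <= j%:R * h by rewrite mulr_ge0// ltW.
  have Pt k' : 0 <= k' -> L1 (P k' g) by move=> ?; exact: (P_L1 hP).
  have PA k' : 0 <= k' -> L1 (P k' (A k)) by move=> ?; exact: (P_L1 hP).
  have -> : (fun x => P t g x - g x - t * w x) = (fun x =>
     (P t g x - P t (A k) x) + (P t (A k) x - P (j%:R * h) (A k) x) +
     (P (j%:R * h) (A k) x - A k x - j%:R * h * w x) + (A k x - g x) + (- u) * w x).
    by apply/funext => x; rewrite /u; ring.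
  apply: le_trans (N1_sum5 _ _ _ _ _) _.
  + by apply: L1B; [exact: Pt|exact: PA].
  + by apply: L1B; exact: PA.
  + by apply: L1B; [apply: L1B => //; exact: PA|exact: L1Z].
  + exact: L1B.
  + exact: L1Z.
  have b1 : N1 (fun x => P t g x - P t (A k) x) <= q.
    by apply: le_trans (P_N1B hP _ g1 (A1 k)) _ => //; rewrite N1_subC.
  have b2 : N1 (fun x => P t (A k) x - P (j%:R * h) (A k) x) <= 3 * q.
    have tE : t = j%:R * h + u by rewrite /u; ring.
    rewrite {1}tE; apply: le_trans (P_shift hP jh0 u0 (A1 k)) _.
    apply: le_trans (N1_trans (h := P u g) _ _ _) _ => //; [exact: PA|exact: Pt|].
    have c1 : N1 (fun x => P u (A k) x - P u g x) <= q.
      by apply: le_trans (P_N1B hP _ _ _) _.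
    have c2 : N1 (fun x => P u g x - A k x) <= q + q.
      apply: le_trans (N1_trans (h := g) _ _ _) _ => //; first exact: Pt.
      by apply: lerD; [apply: hrq => //; exact: lt_trans uh _|rewrite N1_subC].
    by apply: le_trans (lerD c1 c2) _; lra.
  have b3 : N1 (fun x => P (j%:R * h) (A k) x - A k x - j%:R * h * w x) <= j%:R * h * (e' / 2).
    apply: (P_steps hP) => //; first exact: ltW.
      exact: (P_orbit_mean hP).
    by move=> t' t'0 t'j; apply: hr' => //; rewrite (le_lt_trans t'j)// (le_lt_trans jt).
  have b5 : N1 (fun x => - u * w x) <= q * N1 w.
    rewrite N1Z// normrN ger0_norm// ler_wpM2r ?N1_ge0// (le_trans (ltW uh))//.
    exact: ltW.
  have b3' : j%:R * h * (e' / 2) <= t * (e' / 2) by rewrite ler_wpM2r// ltW.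
  lra.
- apply: le_trans (_ : e / 2 + e / 2 <= _); last by lra.
  have [k hk] := @filter_ex _ \oo _ _ (Ag (e / 2) e20).
  apply: le_trans (N1_trans (h := A k) g1 f1 (A1 k)) _.
  rewrite lerD//; first by rewrite N1_subC.
  apply: (orbit_mean_near hP) => // [|t t0 ts]; first exact: ltW.
  by apply: hr => //; rewrite (le_lt_trans ts)// /s ltr_pdivrMr// ltr_pMr// ltr1n.
- move=> c cf.
  have := ae_foralln (fun k => orbit_mean_ge hP (ltW s0) f1 (n_gt0 k) cf).
  apply: filterS2 Ag' => x Agx hx.
  by apply: (ler_cvg_to (cvg_cst c) Agx); exact: nearW.
- move=> c cf.
  have := ae_foralln (fun k => orbit_mean_le hP (ltW s0) f1 (n_gt0 k) cf).
  apply: filterS2 Ag' => x Agx hx.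
  by apply: (ler_cvg_to Agx (cvg_cst c)); exact: nearW.
Qed.

End density.

(** * Functions of class C^2 *)

Section C2_calculus.
Context {R : realType}.
Implicit Types (D : set R) (f g : R -> R) (x : R).

(** [C2_on] with named derivatives, which composes better. *)
Definition has_C2 D f f1 f2 := forall x, D x ->
  [/\ is_derive x 1 f (f1 x), is_derive x 1 f1 (f2 x) & {for x, continuous f2}].

Lemma has_C2P D f : C2_on D f -> has_C2 D f (f^`()) (f^`(2)).
Proof.
move=> h x Dx; have [d1 d2 c] := h x Dx; split.
- exact (DeriveDef d1 (esym (derive1E f x))).
- exact (DeriveDef d2 (esym (derive1E f^`() x))).
- exact: c.
Qed.

Lemma derive1_eq (f : R -> R) x (df : R) : is_derive x 1 f df -> f^`() x = df.
Proof. by move=> [_ <-]; rewrite derive1E. Qed.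

Lemma has_C2_val D f f1 f2 x : open D -> has_C2 D f f1 f2 -> D x ->
  f^`() x = f1 x /\ f^`(2) x = f2 x.
Proof.
move=> oD h Dx; have [d1 d2 c] := h x Dx; split; first exact: derive1_eq.
rewrite derive1nS derive1n1; apply: derive1_eq.
apply: near_eq_is_derive d2; near=> y; apply/esym/derive1_eq.
by have [] := h y; [near: y; exact: open_nbhs_nbhs|].
Unshelve. all: by end_near. Qed.

Lemma has_C2_on D f f1 f2 : open D -> has_C2 D f f1 f2 -> C2_on D f.
Proof.
move=> oD h x Dx; have [d1 d2 c] := h x Dx; split.
- by case: d1.
- have [] // : is_derive x 1 f^`() (f2 x).
  apply: near_eq_is_derive d2; near=> y; apply/esym/derive1_eq.
  by have [] := h y; [near: y; exact: open_nbhs_nbhs|].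
- have E := (has_C2_val oD h Dx).2.
  suff H : f^`(2) y @[y --> x] --> f2 x by rewrite -E in H; exact: H.
  have nD : \forall y \near x, D y by exact: open_nbhs_nbhs.
  apply: cvg_trans c; apply: near_eq_cvg; apply: filterS nD => y Dy.
  by rewrite (has_C2_val oD h Dy).2.
Unshelve. all: by end_near. Qed.

Lemma has_C2_ext D f g f1 f2 g1 g2 : open D -> has_C2 D f f1 f2 ->
  (forall x, D x -> f x = g x) -> (forall x, D x -> f1 x = g1 x) ->
  (forall x, D x -> f2 x = g2 x) -> has_C2 D g g1 g2.
Proof.
move=> oD h fg fg1 fg2 x Dx; have [d1 d2 c] := h x Dx.
have nD : \forall y \near x, D y by exact: open_nbhs_nbhs.
split.
- rewrite -fg1//; apply: near_eq_is_derive d1; apply: filterS nD => y Dy.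
  by rewrite fg.
- rewrite -fg2//; apply: near_eq_is_derive d2; apply: filterS nD => y Dy.
  by rewrite fg1.
- have E := fg2 x Dx.
  suff H : g2 y @[y --> x] --> f2 x by rewrite E in H; exact: H.
  apply: cvg_trans c; apply: near_eq_cvg.
  by apply: filterS nD => y Dy; rewrite fg2.
Qed.

Lemma is_derive_cont f x (df : R) : is_derive x 1 f df -> {for x, continuous f}.
Proof. by move=> [h _]; apply: differentiable_continuous; exact/derivable1_diffP. Qed.

Lemma has_C2_cst D a : has_C2 D (fun=> a) (fun=> 0) (fun=> 0).
Proof. by move=> x _; split; [exact: is_derive_cst..|exact: cvg_cst]. Qed.

Lemma has_C2_id D : has_C2 D (fun x => x) (fun=> 1) (fun=> 0).
Proof. by move=> x _; split; [exact: is_derive_id|exact: is_derive_cst|exact: cvg_cst]. Qed.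

Lemma has_C2D D f f1 f2 g g1 g2 : has_C2 D f f1 f2 -> has_C2 D g g1 g2 ->
  has_C2 D (fun x => f x + g x) (fun x => f1 x + g1 x) (fun x => f2 x + g2 x).
Proof.
move=> hf hg x Dx; have [d1 d2 c] := hf x Dx; have [d1' d2' c'] := hg x Dx.
by split; [exact: is_deriveD|exact: is_deriveD|exact: cvgD].
Qed.

Lemma has_C2M D f f1 f2 g g1 g2 : has_C2 D f f1 f2 -> has_C2 D g g1 g2 ->
  has_C2 D (fun x => f x * g x) (fun x => f1 x * g x + f x * g1 x)
    (fun x => f2 x * g x + 2 * (f1 x * g1 x) + f x * g2 x).
Proof.
move=> hf hg x Dx; have [d1 d2 c] := hf x Dx; have [d1' d2' c'] := hg x Dx.
split.
- by apply: is_derive_eq (is_deriveM d1 d1') _; rewrite /GRing.scale/=; ring.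
- apply: is_derive_eq (is_deriveD (is_deriveM d2 d1') (is_deriveM d1 d2')) _.
  by rewrite /GRing.scale/=; ring.
- have cf := is_derive_cont d1; have cf1 := is_derive_cont d2.
  have cg := is_derive_cont d1'; have cg1 := is_derive_cont d2'.
  apply: cvgD; [apply: cvgD|]; apply: cvgM => //; [exact: cvg_cst|exact: cvgM].
Qed.

Lemma has_C2_comp D D' f f1 f2 g g1 g2 : has_C2 D' f f1 f2 -> has_C2 D g g1 g2 ->
  (forall x, D x -> D' (g x)) ->
  has_C2 D (fun x => f (g x)) (fun x => f1 (g x) * g1 x)
    (fun x => f2 (g x) * g1 x ^+ 2 + f1 (g x) * g2 x).
Proof.
move=> hf hg DD' x Dx; have [d1 d2 c] := hf (g x) (DD' x Dx).
have [d1' d2' c'] := hg x Dx.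
have cg := is_derive_cont d1'; have cg1 := is_derive_cont d2'.
have cf1 := is_derive_cont d2.
split.
- exact: is_derive1_comp.
- apply: is_derive_eq (is_deriveM (is_derive1_comp (f := f1) (g := g) _ _) d2') _.
  by rewrite /GRing.scale/=; ring.
- apply: cvgD; apply: cvgM => //.
  + exact: (continuous_comp cg c).
  + by rewrite expr2; under eq_fun do rewrite expr2; exact: cvgM.
  + exact: (continuous_comp cg cf1).
Qed.

Lemma has_C2_expR D : has_C2 D expR expR expR.
Proof. by move=> x _; split; [exact: is_derive_expR..|exact: continuous_expR]. Qed.

Lemma has_C2_powR (a : R) : has_C2 [set x | 0 < x] (fun x => x `^ a)
  (fun x => a * x `^ (a - 1)) (fun x => a * ((a - 1) * x `^ (a - 1 - 1))).
Proof.
move=> x /= x0; split.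
- exact: is_derive1_powR.
- have := is_deriveZ a (is_derive1_powR (a - 1) x0).
  exact.
- have c := is_derive_cont (is_derive1_powR (a - 1 - 1) x0).
  by apply: cvgM; [exact: cvg_cst|apply: cvgM => //; exact: cvg_cst].
Qed.

Lemma open_pos : open [set x : R | 0 < x].
Proof. exact: open_gt. Qed.

(** A C^2 function that is the identity on [c, +oo[ and positive everywhere:
    composing with it turns C^2 functions on the positive half-line into C^2
    functions on the line without changing them beyond [c]. *)
Definition lift_pos (c x : R) : R := x + c^-1 ^+ 2 * (Num.max (c - x) 0) ^+ 3.

Lemma lift_posE c x : c <= x -> lift_pos c x = x.
Proof.
by move=> cx; rewrite /lift_pos max_r ?subr_le0// expr0n/= mulr0 addr0.
Qed.

Lemma lift_pos_gt0 c x : 0 < c -> 0 < lift_pos c x.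
Proof.
move=> c0; have [cx|xc] := leP c x; first by rewrite lift_posE// (lt_le_trans c0).
rewrite /lift_pos max_l ?subr_ge0 ?(ltW xc)//.
set y := c^-1 * (c - x).
have y0 : 0 < y by rewrite mulr_gt0 ?invr_gt0// subr_gt0.
have -> : x + c^-1 ^+ 2 * (c - x) ^+ 3 = c * (1 - y + y ^+ 3).
  by rewrite /y; field; rewrite gt_eqF.
rewrite mulr_gt0//.
(* y^3 - y + 1 > 0 on the positive half-line *)
by have := sqr_ge0 (y - 1); nra.
Qed.

Lemma is_derive_max_sqr x : is_derive x 1 (fun z => (Num.max z 0) ^+ 2) (2 * Num.max x 0).
Proof.
have [x0|x0|->] := ltgtP x 0.
- rewrite mulr0; apply: near_eq_is_derive (is_derive_cst 0 x 1).
  have : \forall z \near x, z < 0 by exact: lt_nbhsl.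
  by apply: filterS => z z0; rewrite max_r ?ltW// expr0n.
- have d2 : is_derive x 1 (fun z : R => z * z) (2 * x).
    apply: is_derive_eq (is_deriveM (is_derive_id x 1) (is_derive_id x 1)) _.
    by rewrite /GRing.scale/=; ring.
  apply: near_eq_is_derive d2.
  have : \forall z \near x, 0 < z by exact: lt_nbhsr.
  by apply: filterS => z z0; rewrite [Num.max _ _]max_l ?expr2// ltW.
- rewrite mulr0; apply/is_derive1_caratheodory.
  exists (fun z => Num.max z 0); split.
  + move=> z; rewrite maxxx expr0n/= !subr0.
    by have [z0|z0] := leP z 0; rewrite ?expr0n ?mul0r// expr2.
  + by apply: continuous_max; [exact: cvg_id|exact: cvg_cst].
  + exact: maxxx.
Qed.

End C2_calculus.
Section C2_lift.
Context {R : realType}.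
Implicit Types (D : set R) (f g : R -> R) (x c : R).

Lemma has_C2_max_cube D : has_C2 D (fun x : R => (Num.max x 0) ^+ 3)
  (fun x => 3 * (Num.max x 0) ^+ 2) (fun x => 6 * Num.max x 0).
Proof.
have cm : continuous (fun x : R => Num.max x 0).
  by move=> x; apply: continuous_max; [exact: cvg_id|exact: cvg_cst].
have E (z : R) : (Num.max z 0) ^+ 3 = z * (Num.max z 0) ^+ 2.
  have [z0|z0] := leP z 0; first by rewrite !expr0n/= mulr0.
  by rewrite exprS.
have -> : (fun x : R => (Num.max x 0) ^+ 3) = (fun x => x * (Num.max x 0) ^+ 2).
  by apply/funext => z; rewrite E.
move=> x _; split.
- apply: is_derive_eq (is_deriveM (is_derive_id x 1) (is_derive_max_sqr x)) _.
  rewrite /GRing.scale/=.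
  have [z0|z0] := leP x 0; first by rewrite !expr0n/=; ring.
  by ring.
- have := is_deriveZ 3 (is_derive_max_sqr x).
  by move/is_derive_eq; apply; rewrite /GRing.scale/=; ring.
- by apply: cvgM; [exact: cvg_cst|exact: cm].
Qed.

Lemma has_C2_lift_pos c : exists f1 f2, has_C2 setT (lift_pos c) f1 f2.
Proof.
have h1 : has_C2 setT (fun x : R => c + (-1) * x) _ _ :=
  has_C2D (@has_C2_cst R setT c) (has_C2M (@has_C2_cst R setT (-1)) (@has_C2_id R setT)).
have h2 := has_C2_comp (@has_C2_max_cube setT) h1 (fun x _ => I).
have h3 := has_C2D (@has_C2_id R setT) (has_C2M (@has_C2_cst R setT (c^-1 ^+ 2)) h2).
do 2 eexists.
have E : lift_pos c = (fun x => x + c^-1 ^+ 2 * (Num.max (c + (-1) * x) 0) ^+ 3).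
  by apply/funext => z; rewrite mulN1r.
by rewrite E; exact: h3.
Qed.

Lemma C2_on_lift c f : 0 < c -> C2_on [set x : R | 0 < x] f ->
  C2_on setT (f \o lift_pos c).
Proof.
move=> c0 /has_C2P hf; have [g1 [g2 hg]] := has_C2_lift_pos c.
have := has_C2_comp hf hg (fun x _ => lift_pos_gt0 x c0).
exact: has_C2_on openT.
Qed.

Lemma C2_lift_val c f x : 0 < c -> C2_on [set x : R | 0 < x] f -> c < x ->
  [/\ (f \o lift_pos c) x = f x, (f \o lift_pos c)^`() x = f^`() x &
      (f \o lift_pos c)^`(2) x = f^`(2) x].
Proof.
move=> c0 /has_C2P hf cx.
have oD : open [set y : R | c < y] by exact: open_gt.
have hf' : has_C2 [set y : R | c < y] f f^`() f^`(2).
  by move=> y /= cy; apply: hf => /=; exact: lt_trans cy.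
have hl : has_C2 [set y : R | c < y] (f \o lift_pos c) f^`() f^`(2).
  by apply: has_C2_ext hf' _ _ _ => // y /= cy; rewrite lift_posE// ltW.
have [-> ->] := has_C2_val oD hl cx.
by split => //=; rewrite lift_posE// ltW.
Qed.

End C2_lift.

(** * The Young functions tau_q *)

Section compact_bounds.
Context {R : realType}.
Implicit Types (f : R -> R) (x y c M : R).

Local Notation pos := [set x : R | 0 < x].

Lemma C2_cont f : C2_on pos f ->
  [/\ forall x, 0 < x -> {for x, continuous f},
      forall x, 0 < x -> {for x, continuous (f^`())%classic} &
      forall x, 0 < x -> {for x, continuous (f^`(2))%classic}].
Proof.
move=> /has_C2P hf; split => x x0; have [d1 d2 c] := hf x x0.
- exact: is_derive_cont d1.
- exact: is_derive_cont d2.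
- exact: c.
Qed.

Lemma continuous_bounded f c M : 0 < c -> (forall x, 0 < x -> {for x, continuous f}) ->
  exists2 K, 0 < K & forall x, c <= x -> x <= M -> `|f x| <= K.
Proof.
move=> c0 fc; have [cM|Mc] := leP c M; last first.
  exists 1 => // x cx xM; have := le_trans cx xM.
  by move=> /(lt_le_trans Mc); rewrite ltxx.
have [||z _ hz] := @EVT_max R (fun x => `|f x|) c M => //.
  apply: continuous_in_subspaceT => x; rewrite inE/= in_itv/= => /andP[cx _].
  have fx : {for x, continuous f} by apply: fc; exact: lt_le_trans cx.
  exact: (cvg_norm fx).
exists (`|f z| + 1); first by rewrite ltr_wpDl.
by move=> x cx xM; rewrite (le_trans (hz x _)) ?lerDl// in_itv/= cx.
Qed.

Lemma mvt_pos f (f1 : R -> R) x y : 0 < x -> 0 < y ->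
  (forall z : R, 0 < z -> is_derive z 1 f (f1 z)) ->
  exists z : R, [/\ Num.min x y <= z, z <= Num.max x y & f y - f x = f1 z * (y - x)].
Proof.
move=> x0 y0 fd.
have key a b : 0 < a -> a <= b -> exists2 z, z \in `[a, b]%R & f b - f a = f1 z * (b - a).
  move=> a0 ab; apply: MVT_segment => //.
    by move=> z; rewrite in_itv/= => /andP[az _]; apply: fd; exact: lt_trans az.
  apply: continuous_in_subspaceT => z; rewrite inE/= in_itv/= => /andP[az _].
  by apply: (@is_derive_cont _ f z (f1 z)); apply: fd; exact: lt_le_trans az.
have [xy|/ltW yx] := leP x y.
  have [z] := key x y x0 xy; rewrite in_itv/= => /andP[xz zy] E.
  by exists z; rewrite ?xz ?zy.
have [z] := key y x y0 yx; rewrite in_itv/= => /andP[yz zx] E.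
exists z; rewrite ?yz ?zx; split => //.
by rewrite -opprB E; ring.
Qed.

Lemma between_bounds c M x y z : c <= x -> c <= y -> x <= M -> y <= M ->
  Num.min x y <= z -> z <= Num.max x y -> (c <= z <= M) /\ `|z - x| <= `|y - x|.
Proof.
move=> cx cy xM yM; have [xy|/ltW yx] := leP x y => h1 h2.
- split; first by apply/andP; split; lra.
  by rewrite !ger0_norm ?subr_ge0//; lra.
- split; first by apply/andP; split; lra.
  by rewrite !ler0_norm ?subr_le0//; lra.
Qed.

Lemma lipschitz_pos f (f1 : R -> R) c M : 0 < c ->
  (forall z : R, 0 < z -> is_derive z 1 f (f1 z)) ->
  (forall z : R, 0 < z -> {for z, continuous f1}) ->
  exists2 K, 0 < K & forall x y, c <= x -> x <= M -> c <= y -> y <= M ->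
    `|f y - f x| <= K * `|y - x|.
Proof.
move=> c0 fd fc; have [K K0 hK] := continuous_bounded M c0 fc; exists K => // x y cx xM cy yM.
have [z [h1 h2 ->]] := mvt_pos (lt_le_trans c0 cx) (lt_le_trans c0 cy) fd.
have [/andP[cz zM] _] := between_bounds cx cy xM yM h1 h2.
by rewrite normrM ler_wpM2r// hK.
Qed.

(** Mean value theorem for f, then Lipschitz continuity of f'. *)
Lemma taylor2_pos f c M : 0 < c -> C2_on pos f ->
  exists2 K, 0 < K & forall x y, c <= x -> x <= M -> c <= y -> y <= M ->
    f y <= f x + (f^`())%classic x * (y - x) + K * (y - x) ^+ 2.
Proof.
move=> c0 hf; have [_ _ c2] := C2_cont hf; have hf' := has_C2P hf.
have [K K0 hK] := @lipschitz_pos (f^`())%classic (f^`(2))%classic c M c0 (fun (z : R) z0 => let: And3 _ h _ := hf' z z0 in h) c2.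
exists K => // x y cx xM cy yM.
have [z [h1 h2 E]] := mvt_pos (lt_le_trans c0 cx) (lt_le_trans c0 cy)
  (fun (z : R) z0 => let: And3 h _ _ := hf' z z0 in h).
have [/andP[cz zM] zx] := between_bounds cx cy xM yM h1 h2.
rewrite -lerBlDl opprD addrA E -mulrBl.
apply: le_trans (ler_norm _) _; have <- : `|y - x| ^+ 2 = (y - x) ^+ 2 by rewrite real_normK ?num_real.
rewrite normrM expr2 mulrA.
rewrite ler_wpM2r//; apply: le_trans (hK x z cx xM cz zM) _.
by rewrite ler_wpM2l// ltW.
Qed.

End compact_bounds.

Definition nondecreasing_pos {R : realType} (F : R -> R) :=
  forall x y : R, 0 < x -> x <= y -> F x <= F y.

Section tau.
Context {R : realType}.
Variables (p : R) (F : R -> R).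
Hypotheses (hp : 1 < p) (F_C2 : C2_on [set x | 0 < x] F)
  (F_nondecr : nondecreasing_pos F) (F_1 : F 1 = 0).
Implicit Types (q x y a : R).

Local Notation pos := [set x : R | 0 < x].
Local Notation tau := (tau p F).

Let p0 : 0 < p. Proof. exact: lt_trans hp. Qed.
Let pn0 : p != 0. Proof. by rewrite gt_eqF. Qed.

Lemma tau_0 q : tau q 0 = 0.
Proof. by rewrite /Defs.tau powR0// mul0r. Qed.

Lemma tau_1 q : tau q 1 = 1.
Proof. by rewrite /Defs.tau powR1 F_1 mulr0 expR0 mulr1. Qed.

Lemma tau_ge0 q x : 0 <= tau q x.
Proof. by rewrite mulr_ge0 ?powR_ge0 ?expR_ge0. Qed.

Lemma tau_gt0 q x : 0 < x -> 0 < tau q x.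
Proof. by move=> x0; rewrite mulr_gt0 ?powR_gt0 ?expR_gt0. Qed.

Lemma tau_shift q a x : tau (q + a) x = tau q x * expR (a * F (x `^ p)).
Proof. by rewrite /Defs.tau mulrDl expRD mulrA. Qed.

Lemma tau_q0 x : tau 0 x = x `^ p.
Proof. by rewrite /Defs.tau mul0r expR0 mulr1. Qed.

Lemma le_tau q x y : 0 <= q -> 0 <= x -> x <= y -> tau q x <= tau q y.
Proof.
move=> q0; rewrite le_eqVlt => /predU1P[<- _|x0 xy]; first by rewrite tau_0 tau_ge0.
have y0 := lt_le_trans x0 xy.
have xyp : x `^ p <= y `^ p by rewrite ge0_ler_powR ?nnegrE// ltW.
apply: ler_pM; [exact: powR_ge0|exact: expR_ge0|by []|].
by rewrite ler_expR; apply: ler_wpM2l => //; apply: F_nondecr => //; exact: powR_gt0.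
Qed.

(** Dilating the argument by e^{-a/p} costs at least a factor e^{-a}. *)
Lemma tau_scale q x a : 0 <= q -> 0 < x -> 0 <= a ->
  tau q (x / expR (a / p)) <= expR (- a) * tau q x.
Proof.
move=> q0 x0 a0.
have ea : 1 <= expR (a / p) by rewrite -expR0 ler_expR divr_ge0// ltW.
have xa : x / expR (a / p) <= x by rewrite ler_pdivrMr ?expR_gt0// ler_peMr// ltW.
have xa0 : 0 < x / expR (a / p) by rewrite divr_gt0// expR_gt0.
have E : (x / expR (a / p)) `^ p = expR (- a) * x `^ p.
  rewrite -expRN powRM ?expR_ge0 ?(ltW x0)// -expRM mulNr divfK// mulrC.
  by [].
have h1 : (x / expR (a / p)) `^ p <= x `^ p by rewrite ge0_ler_powR ?nnegrE// ltW.
have h2 : expR (q * F ((x / expR (a / p)) `^ p)) <= expR (q * F (x `^ p)).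
  by rewrite ler_expR; apply: ler_wpM2l => //; apply: F_nondecr; rewrite // powR_gt0.
have -> : tau q (x / expR (a / p)) =
    expR (- a) * (x `^ p * expR (q * F ((x / expR (a / p)) `^ p))).
  by rewrite mulrA -E.
by apply: ler_wpM2l; [exact: expR_ge0|apply: ler_wpM2l; [exact: powR_ge0|]].
Qed.

Lemma C2_onM (f g : R -> R) : C2_on pos f -> C2_on pos g -> C2_on pos (fun x => f x * g x).
Proof. by move=> /has_C2P hf /has_C2P hg; apply: has_C2_on open_pos (has_C2M hf hg). Qed.

Lemma C2_on_powR_comp a (f : R -> R) : C2_on pos f -> (forall x, 0 < x -> 0 < f x) ->
  C2_on pos (fun x => f x `^ a).
Proof.
move=> /has_C2P hf f0.
exact: has_C2_on open_pos (has_C2_comp (has_C2_powR a) hf f0).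
Qed.

Lemma C2_on_powR a : C2_on pos (fun x => x `^ a).
Proof. exact: has_C2_on open_pos (has_C2_powR a). Qed.

Lemma C2_on_F_powR : C2_on pos (fun x => F (x `^ p)).
Proof.
apply: has_C2_on open_pos (has_C2_comp (has_C2P F_C2) (has_C2_powR p) _).
by move=> x /= x0; exact: powR_gt0.
Qed.

Lemma tau_C2 q : C2_on pos (tau q).
Proof.
apply: C2_onM (C2_on_powR p) _.
have h := has_C2M (@has_C2_cst R pos q) (has_C2P C2_on_F_powR).
exact: has_C2_on open_pos (has_C2_comp (@has_C2_expR R setT) h (fun _ _ => I)).
Qed.

Definition sqrt_tau q x := tau q x `^ (2^-1).

Lemma sqrt_tau_C2 q : C2_on pos (sqrt_tau q).
Proof. apply: C2_on_powR_comp (tau_C2 q) _ => x; exact: tau_gt0. Qed.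

Lemma sqrt_tau_sqr q x : sqrt_tau q x ^+ 2 = tau q x.
Proof.
rewrite /sqrt_tau -powR_mulrn ?powR_ge0// -powRrM.
by rewrite mulVf// powRr1// tau_ge0.
Qed.

(** That is, (sqrt tau)' = tau' / (2 sqrt tau). *)
Lemma sqrt_tau_derive q x : 0 < x ->
  4 * tau q x * ((sqrt_tau q)^`())%classic x ^+ 2 = ((tau q)^`())%classic x ^+ 2.
Proof.
move=> x0; have [d1 _ _] := has_C2P (@sqrt_tau_C2 q) x0.
have E : tau q = (fun x => sqrt_tau q x * sqrt_tau q x).
  by apply/funext => z; rewrite -expr2 sqrt_tau_sqr.
have -> : ((tau q)^`())%classic x = 2 * sqrt_tau q x * ((sqrt_tau q)^`())%classic x.
  rewrite {1}E; apply: derive1_eq.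
  by apply: is_derive_eq (is_deriveM d1 d1) _; rewrite /GRing.scale/=; ring.
by rewrite !exprMn sqrt_tau_sqr; ring.
Qed.

End tau.

(** Through e^z <= 1 / (1 - z). *)
Lemma expR_quadratic {R : realType} (z : R) : z <= 2^-1 -> expR z <= 1 + z + 2 * z ^+ 2.
Proof.
move=> z1; have h1 : 0 < 1 - z by lra.
have : expR z <= (1 - z)^-1.
  by rewrite -[X in expR X]opprK expRN lef_pV2 ?posrE ?expR_gt0//; exact: expR_ge1Dx.
move/le_trans; apply; rewrite -[_^-1]mul1r ler_pdivrMr//.
have -> : (1 + z + 2 * z ^+ 2) * (1 - z) = 1 + z ^+ 2 * (1 - 2 * z) by ring.
by rewrite lerDl mulr_ge0 ?sqr_ge0//; lra.
Qed.

Lemma expR_le2 {R : realType} (z : R) : 0 <= z -> z <= 4^-1 -> expR z <= 2.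
Proof.
move=> z0 z1; apply: (le_trans (expR_quadratic _)); first by lra.
have : z ^+ 2 <= 4^-1 * 4^-1 by rewrite expr2; apply: ler_pM.
lra.
Qed.

Lemma half_le {R : realType} (c x : R) : 0 < c -> c <= x -> c / 2 <= x.
Proof. lra. Qed.

(** * The generator and the carre du champ *)

Section diffusion.
Context d (T : measurableType d) (R : realType).
Variable mu : probability T R.
Variables (P : R -> (T -> R) -> (T -> R)) (L : (T -> R) -> (T -> R)).
Hypothesis hPL : symmetric_diffusion_semigroup mu P L.
Implicit Types (f g v : T -> R) (t s a c M h e : R).

Local Notation L1 f := (f \in Lfun mu 1%E).
Local Notation E f := (\int[mu]_x f x).
Local Notation N1 := (L1norm mu).
Local Notation Gamma f := (carre_du_champ L f f).
Local Notation pos := [set x : R | 0 < x].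

Let hP : symmetric_Markov_semigroup mu P := diff_markov hPL.

Lemma generator_P f : dom mu P f -> [/\ L1 f, L1 (L f) & forall e, 0 < e ->
  \forall h \near 0^'+, N1 (fun x => P h f x - f x - h * L f x) <= e * h].
Proof. by move=> /(diff_generator hPL)/(generates_P hP). Qed.

Lemma dom_P t f : 0 <= t -> dom mu P f -> dom mu P (P t f).
Proof.
move=> t0 /generator_P[f1 Lf1 hf]; exists (P t (L f)).
apply/(generates_P hP); split; [exact: (P_L1 hP)..|] => e e0.
have h0 : \forall h \near (0:R)^'+, 0 < h by exact: nbhs_right_gt.
apply: filterS2 h0 (hf e e0) => h h0; apply: le_trans.
have Ph1 := P_L1 hP (ltW h0) f1.
have D1 := L1B Ph1 f1.
apply: le_trans (P_N1 hP t0 (L1B D1 (L1Z h Lf1))).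
apply: le_N1.
- by apply: L1B; [apply: L1B|apply: L1Z]; do ?apply: (P_L1 hP) => //; exact: ltW.
- by apply: (P_L1 hP) => //; apply: L1B => //; exact: L1Z.
have e1 := P_B hP t0 D1 (L1Z h Lf1).
have e2 := P_B hP t0 Ph1 f1.
have e3 := P_Z hP h t0 Lf1.
have e4 := sg_add hP t0 (ltW h0) f1.
have e5 := sg_add hP (ltW h0) t0 f1.
apply: filterS3 (filterI e1 e2) (filterI e3 e4) e5 => x [x1 x2] [x3 x4] x5.
by rewrite x1 x2 x3 -x4 -x5 (addrC h t).
Qed.

Lemma dom_Z a f : dom mu P f -> dom mu P (fun x => a * f x).
Proof.
move=> /generator_P[f1 Lf1 hf]; exists (fun x => a * L f x).
apply/(generates_P hP); split; [exact: L1Z..|] => e e0.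
have a0 : 0 < `|a| + 1 by rewrite ltr_wpDl.
have h0 : \forall h \near (0:R)^'+, 0 < h by exact: nbhs_right_gt.
apply: filterS2 h0 (hf (e / (`|a| + 1)) (divr_gt0 e0 a0)) => h h0 hN.
have Ph1 := P_L1 hP (ltW h0) f1.
have D1 := L1B (L1B Ph1 f1) (L1Z h Lf1).
rewrite (@eq_N1 _ _ _ _ _ (fun x => a * (P h f x - f x - h * L f x))).
- rewrite N1Z//; apply: le_trans (_ : (`|a| + 1) * (e / (`|a| + 1) * h) <= _).
    by apply: ler_pM; rewrite ?N1_ge0// lerDl.
  by rewrite mulrCA mulrA divfK ?gt_eqF// mulrC.
- apply: L1B; last by apply: L1Z; exact: L1Z.
  by apply: L1B; [apply: (P_L1 hP); [exact: ltW|]|]; exact: L1Z.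
- exact: L1Z.
- by apply: filterS (P_Z hP a (ltW h0) f1) => x ->; ring.
Qed.

(** Invariance of the measure, infinitesimally. *)
Lemma mean_L f : dom mu P f -> E (L f) = 0.
Proof.
move=> /generator_P[f1 Lf1 hf]; apply/eqP; rewrite -normr_le0.
apply/ler_addgt0Pr => e e0; rewrite add0r.
have h0 : \forall h \near (0:R)^'+, 0 < h by exact: nbhs_right_gt.
have [h [{}h0 hN]] := @filter_ex _ _ (at_right_proper_filter 0) _ (filterI h0 (hf e e0)).
have Ph1 := P_L1 hP (ltW h0) f1.
have D1 := L1B Ph1 f1.
have := le_trans (normE_le (L1B D1 (L1Z h Lf1))) hN.
rewrite EB//; last exact: L1Z.
rewrite EB// EZ// (P_mean hP) ?(ltW h0)// subrr sub0r normrN normrM gtr0_norm//.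
by rewrite mulrC ler_pM2r.
Qed.

Lemma smoothP f : smooth mu P f <-> ess_bdd mu f /\ dom mu P f.
Proof. by split=> -[/ess_bddP h1 h2]; split => //; apply/ess_bddP. Qed.

Lemma smooth_P t v : 0 <= t -> smooth mu P v -> smooth mu P (P t v).
Proof.
move=> t0 /smoothP[bv dv]; apply/smoothP; split; first exact: (P_bdd hP).
exact: dom_P.
Qed.

Lemma smooth_Z a v : smooth mu P v -> smooth mu P (fun x => a * v x).
Proof.
move=> /smoothP[bv dv]; apply/smoothP; split; last exact: dom_Z.
by apply: ess_bddM => //; exact: ess_bdd_cst.
Qed.

Lemma smooth_L1 v : smooth mu P v -> L1 v.
Proof. by move=> /smoothP[/L1_bdd]. Qed.

Lemma ess_bdd_comp v (phi : R -> R) : ess_bdd mu v -> C2_on setT phi ->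
  ess_bdd mu (phi \o v).
Proof.
move=> [mv [M vM]] /has_C2P hphi.
have cphi : continuous phi.
  by move=> x; have [d1 _ _] := hphi x I; exact: is_derive_cont d1.
split; first by apply: measurableT_comp => //; exact: continuous_measurable_fun.
have [M0|M0] := ltP M 0.
  exists 0; apply: filterS vM => x /le_lt_trans/(_ M0).
  by rewrite ltNge normr_ge0.
have [||z _ hz] := @EVT_max R (fun x => `|phi x|) (- M) M.
- by lra.
- by apply: continuous_subspaceT => x; apply: cvg_norm; exact: cphi.
exists `|phi z|; apply: filterS vM => x.
by rewrite ler_norml => hx; apply: hz; rewrite in_itv.
Qed.

Lemma smooth_comp v (phi : R -> R) : smooth mu P v -> C2_on setT phi -> smooth mu P (phi \o v).
Proof.
move=> sv hphi; have [bv dv] := (smoothP v).1 sv.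
by apply/smoothP; split; [exact: ess_bdd_comp|exact: (diff_chain hPL sv hphi).1].
Qed.

Lemma C2_on_sqr (phi : R -> R) : C2_on setT phi -> C2_on setT (fun x => phi x * phi x).
Proof. by move=> /has_C2P h; exact: has_C2_on openT (has_C2M h h). Qed.

Lemma C2_on_id : C2_on setT (fun x : R => x).
Proof. exact: has_C2_on openT (@has_C2_id R setT). Qed.

Lemma dom_sqr v : smooth mu P v -> dom mu P (fun x => v x * v x).
Proof. by move=> sv; have [] := diff_chain hPL sv (C2_on_sqr C2_on_id). Qed.

Lemma Gamma_L1 v : smooth mu P v -> L1 (Gamma v).
Proof.
move=> sv; have [bv dv] := (smoothP v).1 sv.
have [_ L1v _] := generator_P dv.
have [_ L2v _] := generator_P (dom_sqr sv).
have M1 := L1M bv L1v.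
exact: L1Z (L1B (L1B L2v M1) M1).
Qed.

(** Jensen's inequality for the square, from positivity of
    P_h ((f - a)^2) at all rational [a]. *)
Lemma P_sqr h v : 0 <= h -> ess_bdd mu v ->
  {ae mu, forall x, P h v x ^+ 2 <= P h (fun y => v y * v y) x}.
Proof.
move=> h0 bv; have v1 := L1_bdd bv.
have vv1 : L1 (fun y => v y * v y) by exact: L1M.
pose r n : R := ratr (odflt 0 (unpickle n : option rat)).
have key n : {ae mu, forall x, 0 <= P h (fun y => v y * v y) x + (-2 * r n * P h v x + r n ^+ 2)}.
  have Zv1 := L1Z (-2 * r n) v1.
  have c1 := L1_cst mu (r n ^+ 2).
  have e1 := P_D hP h0 vv1 (L1D Zv1 c1).
  have e2 := P_D hP h0 Zv1 c1.
  have e3 := P_Z hP (-2 * r n) h0 v1.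
  have e4 := P_cst hP (r n ^+ 2) h0.
  have e5 : {ae mu, forall x, 0 <= P h (fun y => v y * v y + (-2 * r n * v y + r n ^+ 2)) x}.
    apply: (sg_ge0 hP h0); first by apply: L1D => //; exact: L1D.
    apply: aeW => x; have -> : v x * v x + (-2 * r n * v x + r n ^+ 2) = (v x - r n) ^+ 2 by ring.
    exact: sqr_ge0.
  apply: filterS3 (filterI e1 e2) (filterI e3 e4) e5 => x [x1 x2] [x3 x4].
  by rewrite x1 x2 x3 x4.
apply: filterS (ae_foralln key) => x hx.
rewrite leNgt; apply/negP; set a := P h _ x; set b := P h v x => ab.
have b0 : 0 < b ^+ 2 - a by rewrite subr_gt0.
have m0 : 0 < Num.min 1 (b ^+ 2 - a) by rewrite lt_min ltr01.
have [q] := @rat_in_itvoo _ b (b + Num.min 1 (b ^+ 2 - a)) (ltr_pwDr m0 (lexx b)).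
rewrite in_itv/= => /andP[bq].
rewrite -ltrBlDl lt_min => /andP[q1 q2].
have := hx (pickle q); rewrite /r pickleK/= -/a -/b.
by nra.
Qed.

(** The cone of nonnegative functions is closed in L^1. *)
Lemma ae_ge0_limit f : L1 f ->
  (forall e, 0 < e -> exists g, [/\ L1 g, {ae mu, forall x, 0 <= g x} &
     N1 (fun x => f x - g x) <= e]) ->
  {ae mu, forall x, 0 <= f x}.
Proof.
move=> f1 hf.
have mf : measurable_fun [set: T] (fun x => Num.max (- f x) 0).
  by apply: measurable_maxr; [exact: measurableT_comp (L1_meas f1)|exact: measurable_cst].
have m1 : L1 (fun x => Num.max (- f x) 0).
  apply: L1_dom mf (L1_norm f1) _; apply: aeW => x.
  by have [h|h] := leP (- f x) 0; rewrite ?normr0// normrN.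
have : N1 (fun x => Num.max (- f x) 0) <= 0.
  apply/ler_addgt0Pr => e e0; rewrite add0r.
  have [g [g1 g0 fg]] := hf e e0.
  apply: le_trans fg; apply: le_N1 => //; first exact: L1B.
  apply: filterS g0 => x gx.
  have [h|h] := leP (- f x) 0; first by rewrite normr0.
  rewrite gtr0_norm// ler0_norm; lra.
move=> /(N1_eq0 m1); apply: filterS => x.
by have [|h] := leP (- f x) 0; lra.
Qed.

(** Up to terms that vanish in L^1 as h tends to 0, 2 h Gamma(v) is
    P_h(v^2) - 2 v P_h v + v^2 >= (P_h v - v)^2. *)
Lemma Gamma_ge0 v : smooth mu P v -> {ae mu, forall x, 0 <= Gamma v x}.
Proof.
move=> sv; have [bv dv] := (smoothP v).1 sv.
have [mv [M vM]] := bv.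
have [v1 Lv1 hv] := generator_P dv.
have [v2 Lv2 hv2] := generator_P (dom_sqr sv).
apply: ae_ge0_limit; first exact: Gamma_L1.
move=> e e0.
pose e' := e / (`|M| + 1).
have M0 : 0 < `|M| + 1 by rewrite ltr_wpDl.
have e'0 : 0 < e' by rewrite divr_gt0.
have h0 : \forall h \near (0:R)^'+, 0 < h by exact: nbhs_right_gt.
have [h [{}h0 [h1 h2]]] := @filter_ex _ _ (at_right_proper_filter 0) _
  (filterI h0 (filterI (hv e' e'0) (hv2 e' e'0))).
have h0' := ltW h0.
have Pv1 := P_L1 hP h0' v1; have Pv2 := P_L1 hP h0' v2.
pose r1 x := P h v x - v x - h * L v x.
pose r2 x := P h (fun y => v y * v y) x - v x * v x - h * L (fun y => v y * v y) x.
have r11 : L1 r1 by apply: L1B; [exact: L1B|exact: L1Z].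
have r21 : L1 r2 by apply: L1B; [exact: L1B|exact: L1Z].
pose g x := Gamma v x + (2 * h)^-1 * (r2 x - 2 * (v x * r1 x)).
have s1 : L1 (fun x => r2 x - 2 * (v x * r1 x)).
  by apply: L1B => //; apply: L1Z; exact: L1M.
have gE x : g x = (2 * h)^-1 * (P h (fun y => v y * v y) x - 2 * v x * P h v x + v x * v x).
  by rewrite /g /r1 /r2 /carre_du_champ; field; rewrite gt_eqF.
exists g; split.
- by apply: L1D; [exact: Gamma_L1|exact: L1Z].
- apply: filterS (P_sqr h0' bv) => x hx; rewrite gE mulr_ge0 ?invr_ge0 ?mulr_ge0//.
  by have := sqr_ge0 (P h v x - v x); nra.
- have -> : (fun x => Gamma v x - g x) = (fun x => - (2 * h)^-1 * (r2 x - 2 * (v x * r1 x))).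
    by apply/funext => x; rewrite /g; ring.
  rewrite N1Z// normrN ger0_norm ?invr_ge0 ?mulr_ge0// ler_pdivrMl ?mulr_gt0//.
  have n1 : N1 (fun x => v x * r1 x) <= `|M| * N1 r1.
    by apply: N1_bddM => //; apply: filterS vM => x /le_trans; apply; exact: ler_norm.
  have n2 : N1 (fun x => r2 x - 2 * (v x * r1 x)) <= N1 r2 + 2 * N1 (fun x => v x * r1 x).
    have vr1 := L1M bv r11.
    apply: le_trans (N1D r21 (L1N (L1Z 2 vr1))) _.
    by rewrite N1N N1Z// ger0_norm.
  apply: le_trans n2 _.
  have n3 : `|M| * N1 r1 <= `|M| * (e' * h) by rewrite ler_wpM2l.
  have eE : e = e' * `|M| + e' by rewrite /e'; field; rewrite gt_eqF.
  have : 0 <= e' * h by rewrite mulr_ge0// ltW.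
  have h2' : N1 r2 <= e' * h := h2.
  rewrite {1}eE; nra.
Qed.

(** Although [v] is differentiable along the semigroup only in L^1, symmetry
    makes the L^2 variation of order o(h). *)
Lemma quadratic_variation v e : smooth mu P v -> 0 < e ->
  \forall h \near 0^'+, E (fun x => (P h v x - v x) ^+ 2) <= e * h.
Proof.
move=> sv e0; have [bv dv] := (smoothP v).1 sv.
have [mv [M vM]] := bv.
have [v1 Lv1 hv] := generator_P dv.
pose e' := e / (4 * (`|M| + 1)).
have M0 : 0 < `|M| + 1 by rewrite ltr_wpDl.
have e'0 : 0 < e' by rewrite divr_gt0// mulr_gt0.
have /near_rightP[r r0 hr] := hv e' e'0.
apply/near_rightP; exists (r / 2); first by rewrite divr_gt0.
move=> h h0; rewrite add0r => hr2.
have h0' := ltW h0.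
have r1 : N1 (fun x => P h v x - v x - h * L v x) <= e' * h by apply: hr => //; lra.
have r2 : N1 (fun x => P (h + h) v x - v x - (h + h) * L v x) <= e' * (h + h).
  by apply: hr; lra.
have hh0 : 0 <= h + h by lra.
have Pv1 := P_L1 hP h0' v1; have Pv2 := P_L1 hP hh0 v1.
have bPv := P_bdd hP h0' bv; have bPPv := P_bdd hP h0' bPv.
have PP1 := L1_bdd bPPv.
(* by symmetry E[(P_h v - v)^2] = E[v P_{2h} v] - 2 E[v P_h v] + E[v^2], where the
   first-order terms cancel *)
have E1 : E (fun x => P h v x * P h v x) = E (fun x => v x * P (h + h) v x).
  rewrite (P_sym hP h0' v1 bPv); apply: E_ae; [exact: L1M..|].
  by apply: filterS (sg_add hP h0' h0' v1) => x ->.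
pose q1 x := P h v x - v x - h * L v x.
pose q2 x := P (h + h) v x - v x - (h + h) * L v x.
have q11 : L1 q1 by apply: L1B; [exact: L1B|exact: L1Z].
have q21 : L1 q2 by apply: L1B; [exact: L1B|exact: L1Z].
have vq1 := L1M bv q11; have vq2 := L1M bv q21.
have -> : E (fun x => (P h v x - v x) ^+ 2) = E (fun x => v x * q2 x) - 2 * E (fun x => v x * q1 x).
  rewrite -EZ// -EB//; last exact: L1Z.
  have -> : (fun x => (P h v x - v x) ^+ 2) =
    (fun x => P h v x * P h v x + (v x * v x - 2 * (v x * P h v x))).
    by apply/funext => x; ring.
  have -> : (fun x => v x * q2 x - 2 * (v x * q1 x)) =
    (fun x => v x * P (h + h) v x + (v x * v x - 2 * (v x * P h v x))).
    by apply/funext => x; rewrite /q1 /q2; ring.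
  have w1 : L1 (fun x => v x * v x - 2 * (v x * P h v x)).
    by apply: L1B; [exact: L1M|apply: L1Z; exact: L1M].
  rewrite (ED (L1M bPv Pv1) w1) (ED (L1M bv Pv2) w1) E1.
  by [].
have vM' : {ae mu, forall x, `|v x| <= `|M|}.
  by apply: filterS vM => x /le_trans; apply; exact: ler_norm.
have b1 : `|E (fun x => v x * q1 x)| <= `|M| * (e' * h).
  apply: le_trans (normE_le vq1) _; apply: le_trans (N1_bddM mv vM' q11) _.
  by rewrite ler_wpM2l.
have b2 : `|E (fun x => v x * q2 x)| <= `|M| * (e' * (h + h)).
  apply: le_trans (normE_le vq2) _; apply: le_trans (N1_bddM mv vM' q21) _.
  by rewrite ler_wpM2l.
have eE : e = 4 * (e' * `|M|) + 4 * e' by rewrite /e'; field; rewrite gt_eqF.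
have : 0 <= e' * h by rewrite mulr_ge0// ltW.
move: b1 b2; rewrite !ler_norml => /andP[b1 _] /andP[_ b2] eh.
rewrite {1}eE.
have -> : (4 * (e' * `|M|) + 4 * e') * h = 4 * (`|M| * (e' * h)) + 4 * (e' * h) by ring.
have b2' : `|M| * (e' * (h + h)) = 2 * (`|M| * (e' * h)) by ring.
rewrite b2' in b2; lra.
Qed.

(** The chain rule for phi and for phi^2 together. *)
Lemma Gamma_comp v (phi : R -> R) : smooth mu P v -> C2_on setT phi ->
  {ae mu, forall x, Gamma (phi \o v) x = (phi^`())%classic (v x) ^+ 2 * Gamma v x}.
Proof.
move=> sv hphi.
have [_ e1] := diff_chain hPL sv hphi.
have [_ e2] := diff_chain hPL sv (C2_on_sqr hphi).
have hh := has_C2P hphi.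
apply: filterS2 e1 e2 => x x1.
have [-> ->] := has_C2_val openT (has_C2M hh hh) (I : [set: R] (v x)).
move=> x2.
have x2' : L (fun y => (phi \o v) y * (phi \o v) y) x = _ := x2.
by rewrite [LHS]/carre_du_champ x2' x1 /=; field.
Qed.

(** The chain rule for functions that are C^2 on the positive half-line only;
    [lift_pos] makes them C^2 on the line. *)
Lemma chain_pos v c (phi : R -> R) : smooth mu P v -> 0 < c ->
  {ae mu, forall x, c <= v x} -> C2_on pos phi ->
  let w := (phi \o lift_pos (c / 2)) \o v in
  [/\ smooth mu P w, {ae mu, forall x, w x = phi (v x)},
      {ae mu, forall x, L w x =
        (phi^`())%classic (v x) * L v x + (phi^`(2))%classic (v x) * Gamma v x} &
      {ae mu, forall x, Gamma w x = (phi^`())%classic (v x) ^+ 2 * Gamma v x}].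
Proof.
move=> sv c0 cv hphi w.
have c20 : 0 < c / 2 by rewrite divr_gt0.
have hl := C2_on_lift c20 hphi.
have cl x : c <= v x -> c / 2 < v x by move=> h; lra.
split.
- exact: smooth_comp.
- apply: filterS cv => x /cl vx.
  by rewrite /w/= lift_posE// ltW.
- have [_] := diff_chain hPL sv hl; apply: filterS2 cv => x /cl vx ->.
  by have [_ -> ->] := C2_lift_val c20 hphi vx.
- have := Gamma_comp sv hl; apply: filterS2 cv => x /cl vx ->.
  by have [_ -> _] := C2_lift_val c20 hphi vx.
Qed.

End diffusion.

(** * First-order expansion along the semigroup *)

Section measurability.
Context {R : realType}.
Variables (p : R) (F : R -> R).
Hypotheses (hp : 1 < p) (F_C2 : C2_on [set x | 0 < x] F).

Local Notation tau := (tau p F).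
Local Notation pos := [set x : R | 0 < x].

(** The value of [F] at 0 only appears multiplied by 0, so [F] may be replaced
    by its extension by 0, which is measurable. *)
Lemma measurable_restrict_F : measurable_fun [set: R] (F \_ pos).
Proof.
have op := @open_pos R.
have mp := open_measurable op.
have [H _] := measurable_restrictT F mp; apply: H => /=.
have [h _ _] := C2_cont F_C2.
by apply: (open_continuous_measurable_fun op) => x /set_mem; exact: h.
Qed.

Lemma restrict_FE y : y != 0 -> 0 <= y -> (F \_ pos) y = F y.
Proof. by move=> y0 y1; rewrite patchE mem_set//= lt0r y0. Qed.

Lemma measurable_F_powR : measurable_fun [set: R] (fun x => (F \_ pos) (x `^ p)).
Proof. by apply: measurableT_comp measurable_restrict_F _; exact: measurable_powR. Qed.

Lemma measurable_tau q : measurable_fun [set: R] (tau q).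
Proof.
have -> : tau q = (fun x => x `^ p * expR (q * (F \_ pos) (x `^ p))).
  apply/funext => x; rewrite /Defs.tau.
  have [->|x0] := eqVneq (x `^ p) 0; first by rewrite !mul0r.
  by rewrite restrict_FE// powR_ge0.
apply: measurable_funM; first exact: measurable_powR.
apply: measurableT_comp => //.
by apply: measurable_funM; [exact: measurable_cst|exact: measurable_F_powR].
Qed.

Lemma measurable_tauF q : measurable_fun [set: R] (fun x => tau q x * F (x `^ p)).
Proof.
have -> : (fun x => tau q x * F (x `^ p)) = (fun x => tau q x * (F \_ pos) (x `^ p)).
  apply/funext => x; rewrite /Defs.tau.
  have [->|x0] := eqVneq (x `^ p) 0; first by rewrite !mul0r.
  by rewrite restrict_FE// powR_ge0.
by apply: measurable_funM; [exact: measurable_tau|exact: measurable_F_powR].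
Qed.

End measurability.

Section derivative.
Context d (T : measurableType d) (R : realType).
Variable mu : probability T R.
Variables (P : R -> (T -> R) -> (T -> R)) (L : (T -> R) -> (T -> R)).
Hypothesis hPL : symmetric_diffusion_semigroup mu P L.
Variables (p : R) (F : R -> R).
Hypotheses (hp : 1 < p) (F_C2 : C2_on [set x | 0 < x] F).
Implicit Types (f g v : T -> R) (t s a c M h e : R).

Local Notation L1 f := (f \in Lfun mu 1%E).
Local Notation E f := (\int[mu]_x f x).
Local Notation N1 := (L1norm mu).
Local Notation Gamma f := (carre_du_champ L f f).
Local Notation pos := [set x : R | 0 < x].
Local Notation tau := (tau p F).

Let hP : symmetric_Markov_semigroup mu P := diff_markov hPL.

Definition ae_between c M v := {ae mu, forall x, c <= v x} /\ {ae mu, forall x, v x <= M}.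

Lemma ess_bdd_between v c M (G : R -> R) : 0 < c -> measurable_fun [set: T] v ->
  measurable_fun [set: R] G -> (forall x, 0 < x -> {for x, continuous G}) ->
  ae_between c M v -> ess_bdd mu (fun x => G (v x)).
Proof.
move=> c0 mv mG cG [cv vM]; split; first exact: measurableT_comp.
have [K K0 hK] := continuous_bounded M c0 cG.
by exists K; apply: filterS2 cv vM => x; exact: hK.
Qed.

(** [lift_pos] makes [G] measurable along [v]: [G] is assumed continuous on the
    positive half-line only. *)
Lemma ess_bdd_lift v c M (G : R -> R) : 0 < c -> measurable_fun [set: T] v ->
  (forall x, 0 < x -> {for x, continuous G}) ->
  ae_between c M v -> ess_bdd mu (fun x => G (lift_pos (c / 2) (v x))).
Proof.
move=> c0 mv cG [cv vM].
have c20 : 0 < c / 2 by rewrite divr_gt0.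
split.
  have cl : continuous (fun x => G (lift_pos (c / 2) x)).
    move=> x; have [g1 [g2 hg]] := has_C2_lift_pos (c / 2).
    have [d1 _ _] := hg x I.
    have cG' := cG (lift_pos (c / 2) x) (lift_pos_gt0 x c20).
    exact: (continuous_comp (is_derive_cont d1) cG').
  by apply: (measurableT_comp (continuous_measurable_fun cl)).
have [K K0 hK] := continuous_bounded M c0 cG.
exists K; apply: filterS2 cv vM => x cx xM.
by rewrite lift_posE ?hK//; lra.
Qed.

Lemma tau_shift_le q0 a z : a * F (z `^ p) <= 2^-1 ->
  tau (q0 + a) z <= tau q0 z + a * (tau q0 z * F (z `^ p))
     + a ^+ 2 * (2 * (tau q0 z * F (z `^ p) * F (z `^ p))).
Proof.
move=> h; rewrite tau_shift.
apply: le_trans (ler_wpM2l (tau_ge0 p F q0 z) (expR_quadratic h)) _.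
by rewrite le_eqVlt; apply/orP; left; apply/eqP; ring.
Qed.

(** First-order expansion of h |-> E[tau_{q0 + eta(h)}(P_h v)] at h = 0+. The
    drift E[tau'(v) L v] = - E[tau''(v) Gamma(v)] is bounded by the energy of
    sqrt(tau(v)) through the hypothesis on [k]. *)
Lemma tau_expansion v c M q0 k (eta : R -> R) (eta' X : R) :
  smooth mu P v -> 0 < c -> ae_between c M v ->
  (forall x, 0 < x -> k / 4 * ((tau q0)^`())%classic x ^+ 2 <=
     ((tau q0)^`(2))%classic x * tau q0 x) ->
  (forall e, 0 < e -> \forall h \near 0^'+, `|eta h - eta' * h| <= e * h) ->
  eta' * E (fun x => tau q0 (v x) * F (v x `^ p))
    - k * E (Gamma ((sqrt_tau p F q0 \o lift_pos (c / 2)) \o v)) < X ->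
  \forall h \near 0^'+, E (fun x => tau (q0 + eta h) (P h v x)) <=
     E (fun x => tau q0 (v x)) + h * X.
Proof.
move=> sv c0 vcM hk heta hX.
have c20 : 0 < c / 2 by rewrite divr_gt0.
have [cv vM] := vcM.
have [bv dv] := (smoothP mu P v).1 sv.
have [v1 Lv1 hv] := generator_P hPL dv.
have mv := L1_meas v1.
have tC2 := tau_C2 p F_C2 q0.
have FpC2 := C2_on_F_powR p F_C2.
pose D x := tau q0 x * F (x `^ p).
have DC2 : C2_on pos D by exact: C2_onM.
have GC2 : C2_on pos (fun x => 2 * (D x * F (x `^ p))).
  by apply: C2_onM; [exact: has_C2_on open_pos (@has_C2_cst R pos 2)|exact: C2_onM].
have [ct ct1 ct2] := C2_cont tC2.
have [cD _ _] := C2_cont DC2.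
have [cG _ _] := C2_cont GC2.
have [cF _ _] := C2_cont FpC2.
have [B B0 hB] := continuous_bounded M c0 cF.
have [K3 K30 hK3] := continuous_bounded M c0 cG.
have [K K0 hK] := taylor2_pos M c0 tC2.
have [K1 K10 hK1] := @lipschitz_pos R D (D^`())%classic c M c0
   (fun z z0 => let: And3 h _ _ := has_C2P DC2 z0 in h) (let: And3 _ h _ := C2_cont DC2 in h).
have mD := measurable_tauF p F_C2 q0.
have mt q := measurable_tau p F_C2 q.
have btv := ess_bdd_between c0 mv (mt q0) ct vcM.
have bDv := ess_bdd_between c0 mv mD cD vcM.
pose lv x := lift_pos (c / 2) (v x).
pose t1 x := ((tau q0)^`())%classic (lv x).
pose t2 x := ((tau q0)^`(2))%classic (lv x).
have bt1 : ess_bdd mu t1 := ess_bdd_lift c0 mv ct1 vcM.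
have bt2 : ess_bdd mu t2 := ess_bdd_lift c0 mv ct2 vcM.
have [mt1 [B1 hB1]] := bt1.
set w := (sqrt_tau p F q0 \o lift_pos (c / 2)) \o v in hX.
have [sw _ _ Gw] := chain_pos hPL sv c0 cv (sqrt_tau_C2 p F_C2 q0).
rewrite -/w in sw Gw.
have lvE : {ae mu, forall x, lv x = v x}.
  by apply: filterS cv => x cx; rewrite /lv lift_posE//; lra.
have G1 := Gamma_L1 hPL sv; have Gw1 := Gamma_L1 hPL sw.
(* integration by parts: L (tau(v)) has mean 0 *)
have drift : E (fun x => t1 x * L v x) <= - k * E (Gamma w).
  have [st _ Lt _] := chain_pos hPL sv c0 cv tC2.
  have [_ dt] := (smoothP mu P _).1 st.
  have t2G := L1M bt2 G1; have t1L := L1M bt1 Lv1.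
  have : E (fun x => t1 x * L v x + t2 x * Gamma v x) = 0.
    rewrite -(mean_L hPL dt); apply: E_ae; [exact: L1D|by have [] := generator_P hPL dt|].
    by apply: filterS2 Lt lvE => x -> lx; rewrite /t1 /t2 lx.
  rewrite ED// => /eqP; rewrite addr_eq0 => /eqP ->.
  rewrite mulNr lerN2 -EZ//; apply: le_E => //; first exact: L1Z.
  have G0 := Gamma_ge0 hPL sv.
  apply: filterS3 (filterI Gw lvE) (filterI cv cv) G0 => x [-> lx] [cx _] G0.
  rewrite /t2 lx mulrA ler_wpM2r//.
  have x0 : 0 < v x by exact: lt_le_trans cx.
  have tx := tau_gt0 p F q0 x0.
  rewrite -(ler_pM2r tx); apply: le_trans (hk _ x0).
  by rewrite -(sqrt_tau_derive p F_C2 q0 x0) le_eqVlt; apply/orP; left; apply/eqP; field.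
pose I0 := E (fun x => tau q0 (v x)).
set ID := E (fun x => tau q0 (v x) * F (v x `^ p)) in hX.
pose gap := X - (eta' * ID - k * E (Gamma w)).
have gap0 : 0 < gap by rewrite subr_gt0.
(* the errors are absorbed in the gap *)
pose Q := `|B1| + K + `|ID| + (`|eta'| + 1) * K1 + (`|eta'| + 1) ^+ 2 * K3.
have E10 : 0 < `|eta'| + 1 by rewrite ltr_wpDl.
have Q0 : 0 < Q.
  rewrite /Q ltr_wpDr ?mulr_ge0 ?exprn_ge0 ?(ltW E10) ?(ltW K30)//.
  by rewrite ltr_wpDr ?mulr_ge0 ?(ltW E10) ?(ltW K10)// ltr_wpDr// ltr_wpDl.
pose e := Num.min 1 (gap / Q).
have e0 : 0 < e by rewrite lt_min ltr01 divr_gt0.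
have e1 : e <= 1 by rewrite ge_min lexx.
have eQ : Q * e <= gap by rewrite mulrC -ler_pdivlMr// ge_min lexx orbT.
clearbody e.
have [r1 r10 hr1] := P_cont hP v1 e0.
have near_h : \forall h \near (0:R)^'+, [/\ 0 < h, h < r1, h <= e &
    h <= (2 * B * (`|eta'| + 1))^-1].
  apply/near_rightP; exists (Num.min (Num.min r1 e) (2 * B * (`|eta'| + 1))^-1).
    by rewrite !lt_min r10 e0 invr_gt0 !mulr_gt0.
  by move=> h h0; rewrite add0r !lt_min => /andP[/andP[h1 h2] h3]; split => //; exact: ltW.
apply: filterS3 (filterI near_h (hv e e0)) (heta e e0) (quadratic_variation hPL sv e0).
move=> h [[h0 hr hle hF] hN] he hQV.
have h0' := ltW h0.
have Pv1 := P_L1 hP h0' v1.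
have mPv := L1_meas Pv1.
have cPv := P_ge hP h0' v1 cv; have PvM := P_le hP h0' v1 vM.
have PcM : ae_between c M (P h v) by [].
have N1Pv : N1 (fun x => P h v x - v x) <= e by exact: hr1.
have eta_h : `|eta h| <= (`|eta'| + 1) * h.
  have -> : eta h = (eta h - eta' * h) + eta' * h by ring.
  apply: le_trans (ler_normD _ _) _; rewrite normrM (gtr0_norm h0) mulrDl addrC lerD2l.
  by apply: le_trans he _; rewrite ler_wpM2r.
have etaF z : c <= z -> z <= M -> eta h * F (z `^ p) <= 2^-1.
  move=> cz zM; apply: le_trans (ler_norm _) _; rewrite normrM.
  apply: le_trans (ler_pM _ _ eta_h (hB z cz zM)) _ => //.
  have hF1 : h * (2 * B * (`|eta'| + 1)) <= 1.
    by rewrite -ler_pdivlMr ?div1r// !mulr_gt0.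
  have -> : (`|eta'| + 1) * h * B = h * (2 * B * (`|eta'| + 1)) / 2 by field.
  by rewrite ler_pdivrMr// mulVf.
have bt1P := L1M bt1 (L1B Pv1 v1).
have bPv := P_bdd hP h0' bv.
have sq1 : L1 (fun x => (P h v x - v x) ^+ 2).
  have b : ess_bdd mu (fun x => P h v x - v x).
    have := ess_bddD bPv (ess_bddM (ess_bdd_cst mu (-1)) bv).
    by under eq_fun do rewrite mulN1r.
  by have := L1_bdd (ess_bddM b b); under eq_fun do rewrite -expr2.
have ab1 := L1_norm (L1B Pv1 v1).
have tv1 := L1_bdd btv; have Dv1 := L1_bdd bDv.
have cC := L1_cst mu (eta h ^+ 2 * K3).
pose rhs x := tau q0 (v x) + (t1 x * (P h v x - v x) + (K * (P h v x - v x) ^+ 2 +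
   (eta h * D (v x) + (`|eta h| * K1 * `|P h v x - v x| + eta h ^+ 2 * K3)))).
have l1 := L1Z (`|eta h| * K1) ab1.
have l2 := L1D l1 cC.
have l3 := L1Z (eta h) Dv1.
have l4 := L1D l3 l2.
have l5 := L1Z K sq1.
have l6 := L1D l5 l4.
have l7 := L1D bt1P l6.
have rhs1 : L1 rhs := L1D tv1 l7.
have ctau : forall x, 0 < x -> {for x, continuous (tau (q0 + eta h))}.
  by have [] := C2_cont (tau_C2 p F_C2 (q0 + eta h)).
apply: le_trans (_ : E rhs <= _).
  apply: le_E; [exact: L1_bdd (ess_bdd_between c0 mPv (mt _) ctau PcM)|exact: rhs1|].
  apply: filterS3 (filterI cv vM) (filterI cPv PvM) lvE => x [cx xM] [cz zM] lx.
  apply: le_trans (tau_shift_le q0 (etaF _ cz zM)) _.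
  rewrite /rhs /t1 lx.
  have T2 := hK _ _ cx xM cz zM.
  have LD : eta h * D (P h v x) <= eta h * D (v x) + `|eta h| * K1 * `|P h v x - v x|.
    rewrite -lerBlDl -mulrBr; apply: le_trans (ler_norm _) _.
    by rewrite normrM -mulrA ler_wpM2l// hK1.
  have L3 : eta h ^+ 2 * (2 * (D (P h v x) * F (P h v x `^ p))) <= eta h ^+ 2 * K3.
    by rewrite ler_wpM2l ?sqr_ge0// (le_trans (ler_norm _))// hK3.
  by apply: le_trans (lerD (lerD T2 LD) L3) _; rewrite -!addrA.
have -> : E rhs = I0 + (E (fun x => t1 x * (P h v x - v x)) + (K * E (fun x => (P h v x - v x) ^+ 2) +
   (eta h * ID + (`|eta h| * K1 * N1 (fun x => P h v x - v x) + eta h ^+ 2 * K3)))).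
  rewrite /rhs (ED tv1 l7) (ED bt1P l6) (ED l5 l4) (ED l3 l2) (ED l1 cC) E_cst.
  by rewrite (EZ _ sq1) (EZ _ Dv1) (EZ _ ab1).
have s1 : E (fun x => t1 x * (P h v x - v x)) <= h * (- k * E (Gamma w)) + `|B1| * e * h.
  have R1 := L1B (L1B Pv1 v1) (L1Z h Lv1).
  have tR1 := L1M bt1 R1; have t1L := L1M bt1 Lv1.
  have -> : (fun x => t1 x * (P h v x - v x)) =
     (fun x => h * (t1 x * L v x) + t1 x * (P h v x - v x - h * L v x)).
    by apply/funext => x; ring.
  rewrite ED//; last exact: L1Z.
  rewrite EZ// lerD ?ler_wpM2l//.
  apply: le_trans (ler_norm _) _; apply: le_trans (normE_le tR1) _.
  have hB1' : {ae mu, forall x, `|t1 x| <= `|B1|}.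
    by apply: filterS hB1 => x /le_trans; apply; exact: ler_norm.
  by apply: le_trans (N1_bddM mt1 hB1' R1) _; rewrite -mulrA ler_wpM2l.
have s2 : K * E (fun x => (P h v x - v x) ^+ 2) <= K * e * h.
  by rewrite -mulrA ler_wpM2l// ltW.
have s3 : eta h * ID <= h * (eta' * ID) + `|ID| * e * h.
  have -> : eta h * ID = h * (eta' * ID) + (eta h - eta' * h) * ID by ring.
  rewrite lerD2l; apply: le_trans (ler_norm _) _.
  by rewrite normrM mulrC -mulrA ler_wpM2l.
have s4 : `|eta h| * K1 * N1 (fun x => P h v x - v x) <= (`|eta'| + 1) * K1 * e * h.
  have := ler_pM (normr_ge0 _) (N1_ge0 _ _) eta_h N1Pv.
  move=> /(ler_wpM2l (ltW K10)); rewrite -!mulrA (mulrCA K1 `|eta h|).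
  by move/le_trans; apply; rewrite le_eqVlt; apply/orP; left; apply/eqP; ring.
have s5 : eta h ^+ 2 * K3 <= (`|eta'| + 1) ^+ 2 * K3 * e * h.
  have -> : (`|eta'| + 1) ^+ 2 * K3 * e * h = ((`|eta'| + 1) ^+ 2 * (h * e)) * K3 by ring.
  rewrite ler_wpM2r ?(ltW K30)//.
  have -> : eta h ^+ 2 = `|eta h| ^+ 2 by rewrite real_normK ?num_real.
  apply: le_trans (_ : ((`|eta'| + 1) * h) ^+ 2 <= _).
    by rewrite ler_sqr ?nnegrE// mulr_ge0// ltW.
  by rewrite exprMn ler_wpM2l ?sqr_ge0// expr2 ler_wpM2l.
have Qeh : Q * e * h <= gap * h by rewrite ler_wpM2r.
have XE : h * X = h * (eta' * ID) + h * (- k * E (Gamma w)) + gap * h by rewrite /gap; ring.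
rewrite XE -/I0 lerD2l.
apply: (le_trans (lerD s1 (lerD s2 (lerD s3 (lerD s4 s5))))).
have -> : forall a b c1 c2 c3 c4 c5 : R, (a + c1) + (c2 + ((b + c3) + (c4 + c5))) =
  (b + a) + (c1 + c2 + c3 + c4 + c5) by move=> *; ring.
rewrite lerD2l; apply: le_trans Qeh.
by rewrite /Q !mulrDl.
Qed.

End derivative.

(** * Propagation of the bound in time *)

Section real_line.
Context {R : realType}.
Implicit Types (S : R -> Prop) (t s h e : R).

(** Induction on [0, b]: a property that holds at 0, extends a little to the
    right, and passes to left limits. *)
Lemma real_induction S (b : R) : 0 <= b -> S 0 ->
  (forall t, 0 <= t -> t < b -> S t ->
     exists2 r, 0 < r & forall s, t < s -> s < t + r -> s <= b -> S s) ->
  (forall t, 0 < t -> t <= b -> (forall s, 0 <= s -> s < t -> S s) -> S t) ->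
  S b.
Proof.
move=> b0 S0 Sright Sleft.
pose Z := [set t | 0 <= t /\ t <= b /\ forall s, 0 <= s -> s <= t -> S s].
have Z0 : Z 0.
  by split => //; split => // s s0 s1; have -> : s = 0 by apply/eqP; rewrite eq_le s0 s1.
have supZ : has_sup Z by split; [exists 0|exists b => t [_ []]].
pose t := sup Z.
have t0 : 0 <= t by apply: sup_upper_bound.
have tb : t <= b by apply: (ge_sup (ex_intro _ 0 Z0)) => s [_ []].
have below s : 0 <= s -> s < t -> S s.
  move=> s0 st; have [z [_ [_ hz]] sz] := sup_gt (ex_intro _ 0 Z0) st.
  by apply: hz => //; exact: ltW.
have St : S t.
  move: t0; rewrite le_eqVlt => /predU1P[<- //|t0].
  exact: Sleft.
move: tb; rewrite le_eqVlt => /predU1P[<- //|tb].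
have [r r0 hr] := Sright t t0 tb St.
pose t' := Num.min b (t + r / 2).
have tt' : t < t' by rewrite lt_min tb ltrDl divr_gt0.
have : Z t'.
  split; first by rewrite (le_trans t0)// ltW.
  split; first by rewrite ge_min lexx.
  move=> s s0 st'; have [st|ts] := ltP s t; first exact: below.
  move: ts; rewrite le_eqVlt => /predU1P[<- //|ts].
  move: st'; rewrite le_min => /andP[sb sr].
  by apply: hr => //; lra.
by move/(sup_upper_bound supZ) => /(lt_le_trans tt'); rewrite -/t ltxx.
Qed.

Lemma derivative_Rplus_eps (q : R -> R) t (dq e : R) :
  has_derivative_Rplus q t dq -> 0 < e ->
  exists2 r, 0 < r & forall s, 0 <= s -> `|s - t| < r ->
    `|q s - q t - dq * (s - t)| <= e * `|s - t|.
Proof.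
move=> /cvgrPdist_le hq e0; have := hq e e0.
rewrite near_withinE near_withinE => /nbhs_ballP[r /= r0 hr]; exists r => // s s0 st.
have [->|snt] := eqVneq s t; first by rewrite !subrr mulr0 subrr normr0 mulr0.
have := hr s; rewrite /ball/= distrC => /(_ st snt s0) h.
have st0 : s - t != 0 by rewrite subr_eq0.
have -> : q s - q t - dq * (s - t) = - ((dq - (q s - q t) / (s - t)) * (s - t)).
  by field.
by rewrite normrN normrM ler_wpM2r.
Qed.

Lemma derivative_Rplus_ge0 (q : R -> R) t (dq : R) : 0 <= t -> nondecreasing_Rplus q ->
  has_derivative_Rplus q t dq -> 0 <= dq.
Proof.
move=> t0 nq hq; rewrite leNgt; apply/negP => dq0.
have e0 : 0 < - dq / 2 by rewrite divr_gt0// oppr_gt0.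
have [r r0 hr] := derivative_Rplus_eps hq e0.
have r20 : 0 < r / 2 by rewrite divr_gt0.
have := hr (t + r / 2); rewrite (addrAC t) subrr add0r gtr0_norm// => h.
have {h} : `|q (t + r / 2) - q t - dq * (r / 2)| <= - dq / 2 * (r / 2).
  by apply: h; [rewrite addr_ge0// ltW|lra].
have : q t <= q (t + r / 2) by apply: nq => //; lra.
move=> h1; rewrite ler_norml => /andP[_]; nra.
Qed.

End real_line.

Section core.
Context d (T : measurableType d) (R : realType).
Variable mu : probability T R.
Variables (P : R -> (T -> R) -> (T -> R)) (L : (T -> R) -> (T -> R)).
Hypothesis hPL : symmetric_diffusion_semigroup mu P L.
Variables (p : R) (F : R -> R).
Hypotheses (hp : 1 < p) (F_C2 : C2_on [set x | 0 < x] F)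
  (F_nondecr : nondecreasing_pos F).
Implicit Types (f g v : T -> R) (t s a c M h e : R).

Local Notation L1 f := (f \in Lfun mu 1%E).
Local Notation E f := (\int[mu]_x f x).
Local Notation N1 := (L1norm mu).
Local Notation Gamma f := (carre_du_champ L f f).
Local Notation pos := [set x : R | 0 < x].
Local Notation tau := (tau p F).

Let hP : symmetric_Markov_semigroup mu P := diff_markov hPL.

Lemma Sobolev_real C Ct f : F_Sobolev mu P L F C Ct -> smooth mu P f ->
  L1 (fun x => f x ^+ 2 * F (f x ^+ 2 / E (fun y => f y ^+ 2))) ->
  E (fun x => f x ^+ 2 * F (f x ^+ 2 / E (fun y => f y ^+ 2))) <=
    C * E (Gamma f) + Ct * E (fun x => f x ^+ 2).
Proof.
move=> hS sf f1; have := hS f sf.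
have G1 := Gamma_L1 hPL sf.
have f2 : L1 (fun x => f x ^+ 2).
  have [bf _] := (smoothP mu P f).1 sf.
  by have := L1_bdd (ess_bddM bf bf); under eq_fun do rewrite -expr2.
by rewrite (E_fin f1) (E_fin G1) (E_fin f2) -!EFinM -EFinD lee_fin.
Qed.

(** The F-Sobolev inequality applied to sqrt(tau(v)) controls the growth of
    the exponent q by the dissipation. *)
Lemma drift_bound v c M q0 k l C Ct m eta' :
  smooth mu P v -> 0 < c -> ae_between mu c M v -> 
  F_Sobolev mu P L F C Ct -> 0 <= l -> 0 <= eta' -> eta' * (l * C) <= k ->
  (forall x, 0 <= x -> tau q0 x * F (x `^ p) <= l * (tau q0 x * F (tau q0 x)) + m) ->
  E (fun x => tau q0 (v x)) = 1 ->
  eta' * E (fun x => tau q0 (v x) * F (v x `^ p))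
    - k * E (Gamma ((sqrt_tau p F q0 \o lift_pos (c / 2)) \o v)) <= eta' * (m + l * Ct).
Proof.
move=> sv c0 vcM hS l0 eta0 hk hl Ev.
have [cv vM] := vcM.
have [sw we _ _] := chain_pos hPL sv c0 cv (sqrt_tau_C2 p F_C2 q0).
set w := (_ \o v) in sw we *.
have mv := L1_meas (smooth_L1 sv).
have tC2 := tau_C2 p F_C2 q0.
have [ct _ _] := C2_cont tC2.
have [cD _ _] := C2_cont (C2_onM tC2 (C2_on_F_powR p F_C2)).
have [cF _ _] := C2_cont F_C2.
have mD := measurable_tauF p F_C2 q0.
have Dv1 := L1_bdd (ess_bdd_between c0 mv mD cD vcM).
have tv1 := L1_bdd (ess_bdd_between c0 mv (measurable_tau p F_C2 q0) ct vcM).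
have w2 : {ae mu, forall x, w x ^+ 2 = tau q0 (v x)}.
  by apply: filterS we => x ->; rewrite sqrt_tau_sqr.
have w2L : L1 (fun x => w x ^+ 2).
  have [bw _] := (smoothP mu P w).1 sw.
  by have := L1_bdd (ess_bddM bw bw); under eq_fun do rewrite -expr2.
have Ew : E (fun x => w x ^+ 2) = 1 by rewrite -Ev; exact: E_ae.
have wF1 : L1 (fun x => w x ^+ 2 * F (w x ^+ 2 / 1)).
  have ctF x : 0 < x -> {for x, continuous (fun x => tau q0 x * F (tau q0 x))}.
    move=> x0; apply: cvgM; first exact: ct.
    exact: (continuous_comp (ct x x0) (cF _ (tau_gt0 p F q0 x0))).
  have := L1_bdd (ess_bdd_lift c0 mv ctF vcM).
  have -> // : (fun x => tau q0 (lift_pos (c / 2) (v x)) * F (tau q0 (lift_pos (c / 2) (v x)))) =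
    (fun x => w x ^+ 2 * F (w x ^+ 2 / 1)).
  by apply/funext => x; rewrite divr1 /w/= sqrt_tau_sqr.
have := Sobolev_real hS sw; rewrite Ew => /(_ wF1); rewrite mulr1 => SOB.
have D_le : E (fun x => tau q0 (v x) * F (v x `^ p)) <=
    l * E (fun x => w x ^+ 2 * F (w x ^+ 2 / 1)) + m.
  have cm := L1_cst mu m; have lw := L1Z l wF1.
  rewrite -[X in _ + X](E_cst mu m) -(EZ l wF1) -(ED lw cm).
  apply: le_E; [exact: Dv1|exact: L1D|].
  apply: filterS2 w2 cv => x -> cx; rewrite divr1; apply: hl.
  by rewrite (le_trans _ cx)// ltW.
have GE : 0 <= E (Gamma w) by apply: E_ge0; [exact: (Gamma_L1 hPL)|exact: (Gamma_ge0 hPL)].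
have h1 : eta' * E (fun x => tau q0 (v x) * F (v x `^ p)) <=
   eta' * (l * (C * E (Gamma w) + Ct) + m).
  by rewrite ler_wpM2l// (le_trans D_le)// lerD2r ler_wpM2l.
have h2 : eta' * (l * C) * E (Gamma w) <= k * E (Gamma w) by rewrite ler_wpM2r.
apply: le_trans (lerB h1 h2) _.
by rewrite le_eqVlt; apply/orP; left; apply/eqP; ring.
Qed.

Definition nondecreasing_upto b (A : R -> R) :=
  forall s t, 0 <= s -> s <= t -> t <= b -> A s <= A t.

Definition tau_convexity (k : R -> R) := forall q x : R, 0 <= q -> 0 < x ->
  k q / 4 * ((tau q)^`())%classic x ^+ 2 <= ((tau q)^`(2))%classic x * tau q x.

(** In this section [A] is the logarithm of the barrier, up to the factor 1/p.
    [A_step] says that at every time it grows faster than what [drift_bound]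
    allows for the mean of tau. *)
Section evolution.
Variables (C Ct m : R) (k q dq A : R -> R) (b lam : R) (f : T -> R) (c M : R).
Hypotheses (hS : F_Sobolev mu P L F C Ct)
  (hk : tau_convexity k)
  (q_ge0 : nonnegative_Rplus q) (q_nd : nondecreasing_Rplus q)
  (q_der : forall t : R, 0 <= t -> has_derivative_Rplus q t (dq t))
  (b_ge0 : 0 <= b) (lam_gt0 : 0 < lam)
  (sf : smooth mu P f) (c_gt0 : 0 < c) (fcM : ae_between mu c M f)
  (A_nd : nondecreasing_upto b A)
  (A_step : forall t, 0 <= t -> t < b -> exists l' X, [/\ 0 <= l',
     (forall x, 0 <= x -> tau (q t) x * F (x `^ p) <=
        l' * (tau (q t) x * F (tau (q t) x)) + m),
     dq t * (l' * C) <= k (q t), dq t * (m + l' * Ct) < X &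
     \forall h \near 0^'+, t + h <= b -> h * X <= A (t + h) - A t]).

Definition level t : R := lam * expR (A t / p).

Definition tau_mean t : R := E (fun x => tau (q t) (P t f x / level t)).

Let p0 : 0 < p. Proof. exact: lt_trans hp. Qed.

Lemma level_gt0 t : 0 < level t.
Proof. by rewrite mulr_gt0// expR_gt0. Qed.

Lemma Pf_between t : 0 <= t -> ae_between mu c M (P t f).
Proof.
by move=> t0; split; [apply: (P_ge hP)|apply: (P_le hP)] => //;
  [exact: smooth_L1 sf|exact: fcM.1|exact: smooth_L1 sf|exact: fcM.2].
Qed.

Lemma Pf_div_between t a : 0 <= t -> 0 < a ->
  ae_between mu (c / a) (M / a) (fun x => P t f x / a).
Proof.
move=> t0 a0; have [h1 h2] := Pf_between t0.
by split; [apply: filterS h1|apply: filterS h2] => x hx; rewrite ler_pM2r// invr_gt0.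
Qed.

Lemma tau_Pf_L1 t q0 a : 0 <= t -> 0 < a -> L1 (fun x => tau q0 (P t f x / a)).
Proof.
move=> t0 a0; apply: L1_bdd.
have [ct _ _] := C2_cont (tau_C2 p F_C2 q0).
apply: (@ess_bdd_between _ _ _ mu (fun x => P t f x / a) (c / a) (M / a)) => //.
- exact: divr_gt0.
- apply: measurable_funM; last exact: measurable_cst.
  by apply: L1_meas; apply: (P_L1 hP) => //; exact: smooth_L1 sf.
- exact: measurable_tau.
- exact: Pf_div_between.
Qed.

Lemma level_change s t : 0 <= s -> s <= t -> t <= b ->
  E (fun x => tau (q t) (P t f x / level t)) <=
  expR (- (A t - A s)) * E (fun x => tau (q t) (P t f x / level s)).
Proof.
move=> s0 st tb; have t0 := le_trans s0 st.
have tL := tau_Pf_L1 (q t) t0.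
rewrite -EZ; last exact: tL (level_gt0 s).
apply: le_E; [exact: tL (level_gt0 t)|exact: L1Z (tL _ (level_gt0 s))|].
have [h _] := Pf_between t0; apply: filterS h => x cx.
have -> : P t f x / level t = P t f x / level s / expR ((A t - A s) / p).
  rewrite /level mulrBl expRB; field.
  by rewrite !gt_eqF ?expR_gt0.
apply: tau_scale => //; first exact: q_ge0.
  by rewrite divr_gt0 ?level_gt0// (lt_le_trans c_gt0).
by rewrite subr_ge0 A_nd.
Qed.

(** If the mean is 1, the growth of the barrier wins over the drift; if it is less
    than 1, any first-order bound will do. *)
Lemma tau_mean_right t : 0 <= t -> t < b -> tau_mean t <= 1 ->
  exists2 r, 0 < r & forall s, t < s -> s < t + r -> s <= b -> tau_mean s <= 1.
Proof.
move=> t0 tb mt1; have lt0 := level_gt0 t.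
pose v x := (level t)^-1 * P t f x.
have sv : smooth mu P v by apply: (smooth_Z hPL); exact: (smooth_P hPL).
have cl0 : 0 < c / level t by rewrite divr_gt0.
have vE x : v x = P t f x / level t by rewrite /v mulrC.
have vcM : ae_between mu (c / level t) (M / level t) v.
  have [h1 h2] := Pf_div_between t0 lt0.
  by split; [apply: filterS h1|apply: filterS h2] => x; rewrite vE.
have meanE : tau_mean t = E (fun x => tau (q t) (v x)).
  by congr Rintegral; apply/funext => x; rewrite vE.
have qt0 := q_ge0 t0.
have dq0 := derivative_Rplus_ge0 t0 q_nd (q_der t0).
pose eta h := q (t + h) - q t.
have heta e : 0 < e -> \forall h \near 0^'+, `|eta h - dq t * h| <= e * h.
  move=> e0; have [r r0 hr] := derivative_Rplus_eps (q_der t0) e0.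
  apply/near_rightP.
  exists r.
    exact: r0.
  move=> h h0; rewrite add0r => hr0.
  have thE : t + h - t = h by ring.
  have nh : `|h| = h by exact: gtr0_norm.
  have th0 : 0 <= t + h by exact: addr_ge0 t0 (ltW h0).
  have := hr (t + h) th0; rewrite thE nh => hrh.
  exact: hrh.
have f1 := smooth_L1 sf.
(* P_h v is P_{t+h} f at the level of time t *)
have PvE h : 0 <= h -> E (fun x => tau (q t + eta h) (P h v x)) =
    E (fun x => tau (q (t + h)) (P (t + h) f x / level t)).
  move=> h0; have th0 : 0 <= t + h by exact: addr_ge0.
  rewrite /eta addrC subrK.
  have Pt1 := P_L1 hP t0 f1.
  have e1 := P_Z hP (level t)^-1 h0 Pt1.
  have e2 := sg_add hP h0 t0 f1.
  have PE : {ae mu, forall x, P h v x = P (t + h) f x / level t}.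
    by apply: filterS2 e1 e2 => x -> x2; rewrite -x2 (addrC h t) mulrC.
  apply: E_ae; last by apply: filterS PE => x ->.
    apply: L1_ae (tau_Pf_L1 (q (t + h)) th0 lt0) _.
      apply: measurableT_comp; first exact: measurable_tau.
      exact: (L1_meas (P_L1 hP h0 (L1Z (level t)^-1 Pt1))).
    by apply: filterS PE => x ->.
  exact: tau_Pf_L1.
have key X : dq t * E (fun x => tau (q t) (v x) * F (v x `^ p))
    - k (q t) * E (Gamma ((sqrt_tau p F (q t) \o lift_pos (c / level t / 2)) \o v)) < X ->
    \forall h \near 0^'+, t + h <= b ->
      tau_mean (t + h) <= expR (- (A (t + h) - A t)) * (tau_mean t + h * X).
  move=> hX; have := tau_expansion hPL F_C2 sv cl0 vcM (fun x => @hk (q t) x qt0) heta hX.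
  have h0 : \forall h \near (0:R)^'+, 0 < h by exact: nbhs_right_gt.
  apply: filterS2 h0 => h h0 hE thb.
  have tth : t <= t + h by rewrite lerDl; exact: ltW.
  apply: (le_trans (level_change t0 tth thb)).
  apply: ler_wpM2l; first exact: expR_ge0.
  rewrite meanE -(PvE h (ltW h0)).
  exact: hE.
suff near1 : \forall h \near 0^'+, t + h <= b -> tau_mean (t + h) <= 1.
  have /near_rightP[r r0 hr] := near1; exists r; first exact: r0.
  move=> s ts sr sb.
  have ss : t + (s - t) = s by ring.
  have st0 : 0 < s - t by rewrite subr_gt0.
  have sr' : s - t < 0 + r by rewrite add0r ltrBlDl.
  by have Hs := hr (s - t) st0 sr'; rewrite ss in Hs; exact: (Hs sb).
have h0 : \forall h \near (0:R)^'+, 0 < h by exact: nbhs_right_gt.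
have /orP[/eqP m1|m1] : (tau_mean t == 1) || (tau_mean t < 1).
  by rewrite -(le_eqVlt (tau_mean t) 1); exact: mt1.
- have [l' [X [l'0 hl' hkl hX hA]]] := A_step t0 tb.
  have DB := drift_bound sv cl0 vcM hS l'0 dq0 hkl hl'.
  have {}DB := le_lt_trans (DB (etrans (esym meanE) m1)) hX.
  apply: filterS3 h0 hA (key _ DB) => h h0 hA hk' thb.
  apply: (le_trans (hk' thb)); rewrite m1.
  have e1 : expR (- (h * X)) * expR (h * X) = 1 by rewrite -expRD addNr expR0.
  apply: (le_trans (ler_wpM2l (expR_ge0 _) (expR_ge1Dx (h * X)))).
  rewrite -[leRHS]e1; apply: ler_wpM2r; first exact: expR_ge0.
  by rewrite ler_expR lerN2; exact: (hA thb).
- set X0 := _ - _ in key; clearbody X0.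
  have X1 : X0 < `|X0| + 1 := ltr_pwDr ltr01 (ler_norm X0).
  have X2 : 0 < `|X0| + 1 := ltr_pwDr ltr01 (normr_ge0 X0).
  have hsmall : \forall h \near (0:R)^'+, h < (1 - tau_mean t) / (`|X0| + 1).
    by apply: nbhs_right_lt; apply: divr_gt0; [rewrite subr_gt0; exact: m1|exact: X2].
  apply: filterS3 h0 hsmall (key _ X1) => h h0 hs hk' thb.
  apply: (le_trans (hk' thb)).
  have tth : t <= t + h by rewrite lerDl; exact: ltW.
  have a1 : expR (- (A (t + h) - A t)) <= 1.
    by rewrite -expR0 ler_expR oppr_le0 subr_ge0; exact: A_nd.
  have uz : h * (`|X0| + 1) < 1 - tau_mean t by rewrite -ltr_pdivlMr; [exact: hs|exact: X2].
  have z0 : 0 <= tau_mean t.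
    apply: E_ge0; first exact: tau_Pf_L1.
    by apply: aeW => x; exact: tau_ge0.
  have a0 := expR_ge0 (- (A (t + h) - A t)).
  have u0 : 0 < h * (`|X0| + 1) by exact: mulr_gt0.
  move: uz u0 a0 a1 z0.
  set u := h * _; set a := expR _; set z := tau_mean t.
  move=> uz u0 a0 a1 z0; rewrite -[leRHS]mulr1; apply: ler_pM.
  + exact: a0.
  + exact: addr_ge0 z0 (ltW u0).
  + exact: a1.
  + by rewrite addrC -lerBrDr; exact: ltW.
Qed.

(** Left continuity of t |-> P_t f in L^1, with tau Lipschitz on the range. *)
Lemma tau_mean_left t : 0 < t -> t <= b -> (forall s, 0 <= s -> s < t -> tau_mean s <= 1) ->
  tau_mean t <= 1.
Proof.
move=> t0 tb hs; have t0' := ltW t0; have lt0 := level_gt0 t.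
have cl0 : 0 < c / level t by rewrite divr_gt0.
have tC2 := tau_C2 p F_C2 (q t).
have hC2 := has_C2P tC2.
have [_ ct1 _] := C2_cont tC2.
have [K1 K10 hK1] := @lipschitz_pos R (tau (q t)) ((tau (q t))^`())%classic (c / level t) (M / level t) cl0
   (fun z z0 => let: And3 h _ _ := hC2 z z0 in h) ct1.
have [cD _ _] := C2_cont (C2_onM tC2 (C2_on_F_powR p F_C2)).
have [K2 K20 hK2] := continuous_bounded (M / level t) cl0 cD.
have f1 := smooth_L1 sf.
apply/ler_addgt0Pr => e e0.
have e10 : 0 < e / 2 / K1 * level t by rewrite mulr_gt0// divr_gt0// divr_gt0.
have [r1 r10 hr1] := P_cont hP f1 e10.
have dq0 := derivative_Rplus_ge0 t0' q_nd (q_der t0').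
have [r2 r20 hr2] := derivative_Rplus_eps (q_der t0') ltr01.
pose A1 := (dq t + 1) * K2.
have A10 : 0 < A1 by rewrite mulr_gt0// ltr_wpDl.
pose r := Num.min (Num.min r1 r2) (Num.min t (e / 2 / A1)).
have r0 : 0 < r by rewrite !lt_min r10 r20 t0 !divr_gt0.
pose h := r / 2; have h0 : 0 < h by rewrite divr_gt0.
have hr : h < r by rewrite /h; lra.
move: (hr); rewrite /r !lt_min => /andP[/andP[hr1' hr2'] /andP[ht hA]].
pose s := t - h.
have s0 : 0 <= s by rewrite subr_ge0 ltW.
have st : s < t by rewrite ltrBlDr ltrDl.
have tsE : t = s + h by rewrite subrK.
have q_close : 0 <= q t - q s <= (dq t + 1) * h.
  rewrite subr_ge0 q_nd ?(ltW st)//=.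
  have := hr2 s s0; rewrite distrC.
  have -> : t - s = h by rewrite /s; ring.
  rewrite gtr0_norm// => /(_ hr2').
  have -> : s - t = - h by rewrite /s; ring.
  rewrite ler_norml => /andP[+ _]; lra.
have Pclose : N1 (fun x => P t f x - P s f x) <= e / 2 / K1 * level t.
  by rewrite {1}tsE; apply: le_trans (P_shift hP s0 (ltW h0) f1) _; apply: hr1 => //; exact: ltW.
have Pt1 := P_L1 hP t0' f1; have Ps1 := P_L1 hP s0 f1.
have st1 := tau_Pf_L1 (q s) s0 lt0.
have D1 := L1_norm (L1B Pt1 Ps1).
have cC := L1_cst mu ((q t - q s) * K2).
have step : tau_mean t <= E (fun x => tau (q s) (P s f x / level t)) +
    (K1 / level t * N1 (fun x => P t f x - P s f x) + (q t - q s) * K2).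
  rewrite -EZ// -[X in _ + (_ + X)](E_cst mu) -ED//; last exact: L1Z.
  rewrite -ED//; last by apply: L1D => //; exact: L1Z.
  apply: le_E; [exact: tau_Pf_L1|by apply: L1D => //; apply: L1D => //; exact: L1Z|].
  have [c1 c2] := Pf_div_between t0' lt0; have [c3 c4] := Pf_div_between s0 lt0.
  apply: filterS2 (filterI c1 c2) (filterI c3 c4) => x [y1 y2] [y3 y4].
  set y := P t f x / level t; set y' := P s f x / level t.
  have i1 : tau (q t) y <= tau (q t) y' + K1 / level t * `|P t f x - P s f x|.
    rewrite -lerBlDl; apply: le_trans (ler_norm _) _.
    apply: le_trans (hK1 _ _ y3 y4 y1 y2) _.
    rewrite /y /y' -mulrBl normrM (_ : `|(level t)^-1| = (level t)^-1).
      by rewrite le_eqVlt; apply/orP; left; apply/eqP; ring.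
    by apply: gtr0_norm; rewrite invr_gt0.
  have i2 : tau (q t) y' <= tau (q s) y' + (q t - q s) * K2.
    have -> : q s = q t + (q s - q t) by ring.
    rewrite tau_shift; have := expR_ge1Dx ((q s - q t) * F (y' `^ p)).
    have := tau_ge0 p F (q t) y'.
    have := hK2 _ y3 y4; rewrite -/y' ler_norml => /andP[_ j1].
    have /andP[j2 _] := q_close.
    have -> : q t - (q t + (q s - q t)) = q t - q s by ring.
    move=> j3 j4.
    have j5 := ler_wpM2l j3 j4.
    have j6 := ler_wpM2l j2 j1.
    rewrite -lerBlDr; apply: le_trans j5.
    have -> : forall a b : R, a * (1 + (q s - q t) * b) = a - (q t - q s) * (a * b).
      by move=> *; ring.
    by rewrite lerD2l lerN2.
  apply: (le_trans i1).
  by rewrite [X in _ <= _ + X]addrC addrA lerD2r; exact: i2.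
apply: (le_trans step); apply: lerD.
- apply: le_trans (hs s s0 st).
  apply: le_E; [exact: st1|exact: tau_Pf_L1 (level_gt0 s)|].
  have [c1 _] := Pf_between s0; apply: filterS c1 => x cx.
  have u0 : 0 <= P s f x by exact: le_trans (ltW c_gt0) cx.
  have lst : level s <= level t.
    apply: ler_wpM2l; first exact: ltW.
    rewrite ler_expR; apply: ler_wpM2r; first by rewrite invr_ge0; exact: ltW.
    exact: A_nd s0 (ltW st) tb.
  apply: (le_tau hp F_nondecr (q_ge0 s0)).
    exact: divr_ge0 u0 (ltW lt0).
  apply: ler_wpM2l; first exact: u0.
  by rewrite lef_pV2; [exact: lst|exact: lt0|exact: level_gt0].
- have -> : e = e / 2 + e / 2 by lra.
  apply: lerD.
    have -> : e / 2 = K1 / level t * (e / 2 / K1 * level t).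
      by field; rewrite (gt_eqF K10) (gt_eqF lt0).
    apply: ler_wpM2l; last exact: Pclose.
    exact: divr_ge0 (ltW K10) (ltW lt0).
  have /andP[_ j] := q_close.
  apply: le_trans (ler_wpM2r (ltW K20) j) _.
  have -> : (dq t + 1) * h * K2 = h * A1 by rewrite /A1; ring.
  by rewrite -ler_pdivlMr; [exact: ltW|exact: A10].
Qed.

Theorem tau_mean_le1 : tau_mean 0 <= 1 -> tau_mean b <= 1.
Proof.
move=> h0.
exact: (@real_induction R (fun t => tau_mean t <= 1) b b_ge0 h0 tau_mean_right tau_mean_left).
Qed.

End evolution.
End core.

(** * The rate function l *)

Section least_rate.
Context {R : realType}.
Variables (p : R) (F : R -> R) (l : R -> R) (m : R).
Hypotheses (hp : 1 < p) (F_C2 : C2_on [set x | 0 < x] F).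
Local Notation tau := (tau p F).

Definition tau_rate q r := forall x, 0 <= x ->
  tau q x * F (x `^ p) <= r * (tau q x * F (tau q x)) + m.

Hypotheses (l_ge0 : nonnegative_Rplus l) (m_ge0 : 0 <= m)
  (hl : forall q : R, 0 <= q -> tau_rate q (l q)).

Lemma tau_continuous_q x : continuous (fun q => tau q x).
Proof.
move=> q; apply: cvgM; first exact: cvg_cst.
have c1 : {for q, continuous (fun z : R => z * F (x `^ p))}.
  by apply: cvgM; [exact: cvg_id|exact: cvg_cst].
exact: (continuous_comp c1 (@continuous_expR R (q * F (x `^ p)))).
Qed.

Lemma tauF_continuous_q x : 0 < x -> continuous (fun q => tau q x * F (tau q x)).
Proof.
move=> x0 q; apply: cvgM; first exact: tau_continuous_q.
have [cF _ _] := C2_cont F_C2.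
exact: (continuous_comp (@tau_continuous_q x q) (cF _ (tau_gt0 p F q x0))).
Qed.

(** The least admissible rate at [s]. As a supremum of functions continuous in
    [s] it is lower semicontinuous, so integrals of [l] to the right of [s] are
    bounded below by it. *)
Lemma least_rate s : 0 <= s -> exists l', [/\ 0 <= l', l' <= l s, tau_rate s l' &
  forall e, 0 < e -> exists2 r, 0 < r & forall u, s <= u -> u < s + r -> l' - e <= l u].
Proof.
move=> s0.
pose a u x := tau u x * F (x `^ p) - m.
pose b u x := tau u x * F (tau u x).
have ab u x : 0 <= u -> 0 < x -> a u x <= l u * b u x.
  by move=> u0 x0; rewrite lerBlDr; exact: (hl u0 (ltW x0)).
pose Z := [set z | z = 0 \/ exists2 x, 0 < x & 0 < b s x /\ z = a s x / b s x].
have Zub z : Z z -> z <= l s.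
  move=> [->|[x x0 [b0 ->]]]; first exact: l_ge0.
  by rewrite ler_pdivrMr; [exact: ab|exact: b0].
have supZ : has_sup Z by split; [exists 0; left|exists (l s)].
exists (sup Z); split.
- by apply: (sup_upper_bound supZ); left.
- by apply: (ge_sup (proj1 supZ)).
- move=> x; rewrite le_eqVlt => /predU1P[<-|x0].
    by rewrite (tau_0 F hp) !mul0r mulr0 add0r.
  rewrite -lerBlDr -/(a s x) -/(b s x).
  have lsup : sup Z <= l s by apply: (ge_sup (proj1 supZ)).
  have [b0|b0|b0] := ltgtP (b s x) 0.
  (* the constraint at a point where b is negative bounds the rate from above, so
     that it is inherited from [l s] *)
  + apply: (le_trans (ab s x s0 x0)).
    by rewrite (ler_nM2r b0).
  + rewrite -(ler_pdivrMr _ _ b0); apply: (sup_upper_bound supZ).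
    by right; exists x.
  + by have := ab s x s0 x0; rewrite b0 !mulr0.
- move=> e e0.
  have [z Zz ez] := sup_adherent e0 supZ.
  case: Zz => [zE|[x x0 [b0 zE]]].
    exists 1; first exact: ltr01.
    move=> u su _; rewrite zE in ez.
    by apply: (le_trans (ltW ez)); apply: l_ge0; exact: le_trans su.
  have cb : {for s, continuous (fun u => b u x)} by exact: tauF_continuous_q.
  have ca : {for s, continuous (fun u => a u x)}.
    apply: cvgB; last exact: cvg_cst.
    by apply: cvgM; [exact: tau_continuous_q|exact: cvg_cst].
  have cab : a u x / b u x @[u --> s] --> a s x / b s x.
    by apply: cvgM; [exact: ca|apply: cvgV; [rewrite gt_eqF|exact: cb]].
  have n1 : \forall u \near s, 0 < b u x by exact: (cvgr_gt _ cb _ b0).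
  have n2 : \forall u \near s, sup Z - e < a u x / b u x.
    by apply: (cvgr_gt _ cab); rewrite -zE.
  have /nbhs_ballP[r /= r0 hr] : \forall u \near s, 0 < b u x /\ sup Z - e < a u x / b u x.
    by apply: filterS2 n1 n2.
  exists r; first exact: r0.
  move=> u su ur.
  have [|bu eu] := hr u.
    by rewrite /ball/= distrC ger0_norm ?subr_ge0// ltrBlDl.
  apply: (le_trans (ltW eu)).
  by rewrite ler_pdivrMr; [apply: ab => //; exact: le_trans su|exact: bu].
Qed.

End least_rate.

Section rate_integral.
Context {R : realType}.
Variables (l : R -> R) (Q : R).
Hypotheses (ml : measurable_fun [set u : R | 0 <= u] l).
Local Notation leb := (@lebesgue_measure R).
Hypothesis il : (\int[leb]_(u in `[0%R, Q]) (l u)%:E < +oo)%E.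
Hypothesis l_ge0 : nonnegative_Rplus l.

Lemma integrable_rate : leb.-integrable `[0%R, Q] (EFin \o l).
Proof.
apply/integrableP; split.
  apply/measurable_EFinP; apply: measurable_funS ml => //.
    have -> : [set u : R | 0 <= u] = `[0, +oo[%classic by apply/seteqP; split => x /=; rewrite in_itv/= andbT.
    exact: measurable_itv.
  by move=> x /=; rewrite in_itv/= => /andP[].
under eq_integral.
  move=> x; rewrite inE/= in_itv/= => /andP[x0 _].
  rewrite ger0_norm; last exact: l_ge0.
  over.
exact: il.
Qed.

Lemma rate_integral_ge x y a : 0 <= x -> x <= y -> y <= Q ->
  (forall u, x <= u -> u <= y -> a <= l u) ->
  a * (y - x) <= \int[leb]_(u in `[0%R, y]) l u - \int[leb]_(u in `[0%R, x]) l u.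
Proof.
move=> x0 xy yQ al.
have iy : leb.-integrable `[0%R, y] (EFin \o l).
  apply: integrableS integrable_rate => //.
  by move=> u; rewrite /= !in_itv/= => /andP[-> uy]; exact: le_trans uy yQ.
rewrite Rintegral_itvB//.
have ixy : leb.-integrable `]x, y] (EFin \o l).
  apply: integrableS iy => //.
  by move=> u; rewrite /= !in_itv/= => /andP[xu ->]; rewrite andbT ltW// (le_lt_trans x0).
have [a0|a0] := leP a 0.
  apply: (@le_trans _ _ 0); first by rewrite mulr_le0_ge0// subr_ge0.
  apply: Rintegral_ge0 => u; rewrite /= in_itv/= => /andP[xu _].
  by apply: l_ge0; exact: le_trans (ltW xu).
have -> : a * (y - x) = \int[leb]_(u in `]x, y]) a.
  rewrite Rintegral_cst; last exact: measurable_itv.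
  have E := @lebesgue_measure_itv R `]x, y]%R; rewrite /= lte_fin in E.
  have {}E : fine (lebesgue_measure [set` `]x, y]%R]) = y - x.
    rewrite E; move: xy; rewrite le_eqVlt => /predU1P[->|xy]; last by rewrite xy.
    by rewrite ltxx subrr.
  by congr (_ * _); exact: esym E.
have au u : u \in `]x, y]%R -> a <= l u.
  by rewrite in_itv/= => /andP[xu uy]; apply: al => //; exact: ltW.
apply: le_Rintegral => //.
  apply: le_integrable ixy; [exact: measurable_itv|exact/measurable_EFinP|].
  move=> u hu; have alu := au u hu; rewrite /= lee_fin gtr0_norm//.
  exact: le_trans alu (ler_norm _).
Qed.

End rate_integral.

(** * The bound for regular initial data *)

Section smooth_bound.
Context d (T : measurableType d) (R : realType).
Variable mu : probability T R.
Variables (P : R -> (T -> R) -> (T -> R)) (L : (T -> R) -> (T -> R)).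
Hypothesis hPL : symmetric_diffusion_semigroup mu P L.
Variables (p : R) (F : R -> R).
Hypotheses (hp : 1 < p) (F_C2 : C2_on [set x | 0 < x] F) (F_nondecr : nondecreasing_pos F).
Variables (k l : R -> R) (m C Ct : R) (q dq : R -> R).

Definition tau_rates (m : R) (l : R -> R) := forall q : R, 0 <= q -> tau_rate p F m q (l q).

Definition growth_condition (C : R) (k l q dq : R -> R) := forall t : R, 0 <= t -> dq t * (l (q t) * C) <= k (q t).

Hypotheses (k_ge0 : nonnegative_Rplus k) (hk : tau_convexity p F k)
  (l_ge0 : nonnegative_Rplus l) (m_ge0 : 0 <= m) (hl : tau_rates m l)
  (hS : F_Sobolev mu P L F C Ct) (Ct_ge0 : 0 <= Ct)
  (q_ge0 : nonnegative_Rplus q) (q_nd : nondecreasing_Rplus q)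
  (q_der : forall t : R, 0 <= t -> has_derivative_Rplus q t (dq t)) (q0 : q 0 = 0)
  (hq : growth_condition C k l q dq).

Local Notation L1 f := (f \in Lfun mu 1%E).
Local Notation E f := (\int[mu]_x f x).
Local Notation tau := (tau p F).

(** [Psi] stands for x |-> Ct \int_0^x l. *)
Definition rate_primitive (Psi : R -> R) (Q : R) := forall x y a : R,
  0 <= x -> x <= y -> y <= Q -> (forall u, x <= u -> u <= y -> a <= l u) ->
  Ct * (a * (y - x)) <= Psi y - Psi x.

Variables (b : R) (Psi : R -> R) (ep : R).
Hypotheses (b_ge0 : 0 <= b) (hPsi : rate_primitive Psi (q b)) (Psi0 : Psi 0 = 0) (ep_gt0 : 0 < ep).

Let A t := m * q t + Psi (q t) + ep * t.

Lemma Psi_nd x y : 0 <= x -> x <= y -> y <= q b -> Psi x <= Psi y.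
Proof.
move=> x0 xy yQ; rewrite -subr_ge0.
have := @hPsi x y 0 x0 xy yQ; rewrite mul0r mulr0; apply => u xu _.
by apply: l_ge0; exact: le_trans x0 xu.
Qed.

Lemma log_level_nondecreasing : nondecreasing_upto b A.
Proof.
move=> s t s0 st tb; rewrite /A.
have t0 := le_trans s0 st.
apply: lerD; first apply: lerD.
- by apply: ler_wpM2l => //; exact: q_nd.
- by apply: Psi_nd; [exact: q_ge0|exact: q_nd|exact: q_nd].
- by apply: ler_wpM2l => //; exact: ltW.
Qed.

(** The bounds on [q'] and on the least rate lose errors of order e1 and de, both
    paid by the slack ep. When C <= 0 the growth condition for the least rate
    holds because its left-hand side is nonpositive. *)
Lemma log_level_step t : 0 <= t -> t < b -> exists l' X, [/\ 0 <= l',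
     (forall x, 0 <= x -> tau (q t) x * F (x `^ p) <=
        l' * (tau (q t) x * F (tau (q t) x)) + m),
     dq t * (l' * C) <= k (q t), dq t * (m + l' * Ct) < X &
     \forall h \near 0^'+, t + h <= b -> h * X <= A (t + h) - A t].
Proof.
move=> t0 tb.
have qt0 := q_ge0 t0.
have dq0 := derivative_Rplus_ge0 t0 q_nd (q_der t0).
have [l' [l'0 l'l vl' lsc]] := least_rate hp F_C2 l_ge0 m_ge0 hl qt0.
exists l', (dq t * (m + l' * Ct) + ep / 2); split.
- exact: l'0.
- exact: vl'.
- have [C0|C0] := leP 0 C.
    apply: le_trans (hq t0); apply: ler_wpM2l => //.
    exact: ler_wpM2r.
  apply: (@le_trans _ _ 0); last exact: k_ge0.
  by apply: mulr_ge0_le0 => //; apply: mulr_ge0_le0 => //; exact: ltW.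
- by rewrite ltrDl divr_gt0.
have dq10 : 0 < dq t + 1 by exact: ltr_pwDr ltr01 dq0.
pose e1 := Num.min 1 (ep / 4 / (m + l' * Ct + 1)).
have ml0 : 0 <= m + l' * Ct by rewrite addr_ge0 // mulr_ge0.
have ml10 : 0 < m + l' * Ct + 1 by exact: ltr_pwDr ltr01 ml0.
have e10 : 0 < e1 by rewrite lt_min ltr01 divr_gt0 // divr_gt0.
have e11 : e1 <= 1 by rewrite ge_min lexx.
have e12 : e1 * (m + l' * Ct) <= ep / 4.
  apply: (@le_trans _ _ (e1 * (m + l' * Ct + 1))).
    by apply: ler_wpM2l; [exact: ltW|rewrite lerDl].
  by rewrite -ler_pdivlMr // ge_min lexx orbT.
pose de := ep / 4 / ((Ct + 1) * (dq t + 1)).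
have Ct10 : 0 < Ct + 1 by exact: ltr_pwDr ltr01 Ct_ge0.
have de0 : 0 < de by rewrite divr_gt0 ?mulr_gt0 // divr_gt0.
have deE : de * (Ct + 1) * (dq t + 1) = ep / 4.
  by rewrite /de; field; rewrite (gt_eqF Ct10) (gt_eqF dq10).
have [r r0 hr] := lsc de de0.
have [r' r'0 hr'] := derivative_Rplus_eps (q_der t0) e10.
apply/near_rightP; exists (Num.min r' (r / (dq t + 1))).
  by rewrite lt_min r'0 divr_gt0.
move=> h h0; rewrite add0r lt_min => /andP[h1 h2] thb.
have th0 : 0 <= t + h by exact: addr_ge0 t0 (ltW h0).
have tth : t <= t + h by rewrite lerDl; exact: ltW.
have thE : t + h - t = h by ring.
have := hr' (t + h) th0; rewrite thE (gtr0_norm h0) => /(_ h1).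
set Dq := q (t + h) - q t; rewrite ler_norml => /andP[q1 q2].
have Dq0 : 0 <= Dq by rewrite subr_ge0; exact: q_nd.
have Dqle : Dq <= (dq t + 1) * h.
  have : e1 * h <= 1 * h by apply: ler_wpM2r; [exact: ltW|].
  lra.
have qlt : q (t + h) < q t + r.
  rewrite -ltrBlDl; apply: (le_lt_trans Dqle).
  by rewrite mulrC -ltr_pdivlMr.
have PS : Ct * ((l' - de) * Dq) <= Psi (q (t + h)) - Psi (q t).
  apply: hPsi => //; [exact: q_nd|exact: q_nd|].
  by move=> u qu uq; apply: hr => //; exact: le_lt_trans uq qlt.
rewrite /A.
have -> : m * q (t + h) + Psi (q (t + h)) + ep * (t + h) - (m * q t + Psi (q t) + ep * t) =
   m * Dq + (Psi (q (t + h)) - Psi (q t)) + ep * h by rewrite /Dq; ring.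
have i1 : (m + l' * Ct) * (dq t * h - Dq) <= ep / 4 * h.
  apply: (@le_trans _ _ ((m + l' * Ct) * (e1 * h))).
    by apply: ler_wpM2l => //; lra.
  by rewrite mulrA (mulrC (m + _)); apply: ler_wpM2r; [exact: ltW|].
have i2 : de * Ct * Dq <= ep / 4 * h.
  rewrite -deE -(mulrA _ (dq t + 1)); apply: ler_pM => //.
  - by apply: mulr_ge0 => //; exact: ltW.
  - by apply: ler_wpM2l; [exact: ltW|rewrite lerDl].
have i3 : Ct * ((l' - de) * Dq) = l' * Ct * Dq - de * Ct * Dq by ring.
have i4 : h * (dq t * (m + l' * Ct) + ep / 2) =
  (m + l' * Ct) * (dq t * h - Dq) + (m * Dq + l' * Ct * Dq) + ep / 2 * h by ring.
rewrite i4; rewrite i3 in PS; lra.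
Qed.

Lemma smooth_bound_eps f c M lam : smooth mu P f -> 0 < c -> ae_between mu c M f ->
  0 < lam -> E (fun x => f x `^ p) <= lam `^ p ->
  E (fun x => tau (q b) (P b f x / (lam * expR (A b / p)))) <= 1.
Proof.
move=> sf c0 fcM lam0 hf.
have hP := diff_markov hPL.
have f1 := smooth_L1 sf.
apply: (tau_mean_le1 hPL hp F_C2 F_nondecr hS hk q_ge0 q_nd q_der b_ge0 lam0 sf c0 fcM
  log_level_nondecreasing log_level_step).
rewrite /tau_mean /level.
have A0 : A 0 = 0 by rewrite /A q0 Psi0 !mulr0 !addr0.
rewrite A0 mul0r expR0 mulr1 q0.
have [cf fM] := fcM.
have [cpow _ _] := C2_cont (C2_on_powR p).
have fp1 : L1 (fun x => f x `^ p).
  by apply: L1_bdd; apply: (ess_bdd_between c0 (L1_meas f1) (measurable_powR p) cpow fcM).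
have E1 : {ae mu, forall x, tau 0 (P 0 f x / lam) = (lam `^ p)^-1 * f x `^ p}.
  apply: filterS2 (sg_0 hP f1) cf => x -> cx.
  have fx0 : 0 <= f x by exact: le_trans (ltW c0) cx.
  rewrite tau_q0 powRM //; last by rewrite invr_ge0 ltW.
  have -> : lam^-1 `^ p = (lam `^ p)^-1.
    by rewrite -(powR_inv1 (ltW lam0)) -powRrM mulN1r powRN.
  by rewrite mulrC.
have lp0 : 0 < lam `^ p by exact: powR_gt0.
rewrite (@E_ae _ _ _ mu _ (fun x => (lam `^ p)^-1 * f x `^ p)).
- by rewrite EZ // mulrC ler_pdivrMr // mul1r.
- apply: L1_ae (L1Z (lam `^ p)^-1 fp1) _; last by apply: filterS E1 => x ->.
  apply: measurableT_comp; first exact: measurable_tau.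
  apply: measurable_funM; last exact: measurable_cst.
  by apply: L1_meas; exact: (P_L1 hP (lexx 0) f1).
- exact: L1Z.
- exact: E1.
Qed.

End smooth_bound.

(** * Approximation in L^p *)

Section Lp_tools.
Context d (T : measurableType d) (R : realType).
Variable mu : probability T R.
Variables (p : R).
Hypothesis (hp : 1 < p).
Implicit Types f g : T -> R.

Local Notation L1 f := (f \in Lfun mu 1%E).
Local Notation E f := (\int[mu]_x f x).
Local Notation N1 := (L1norm mu).

Let p0 : 0 < p. Proof. exact: lt_trans hp. Qed.

Definition Np f : R := fine ('N[mu]_p%:E[EFin \o f])%E.

Lemma Np_fin f : f \in Lfun mu p%:E -> ('N[mu]_p%:E[EFin \o f])%E = (Np f)%:E.
Proof.
move=> /andP[_]; rewrite inE/= /finite_norm => h.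
by rewrite /Np fineK// ge0_fin_numE// Lnorm_ge0.
Qed.

Lemma Np_ge0 f : 0 <= Np f.
Proof. by rewrite fine_ge0// Lnorm_ge0. Qed.

Lemma Lp_L1 f : f \in Lfun mu p%:E -> L1 f.
Proof.
have pe : (1 <= p%:E :> \bar R)%E by rewrite lee_fin ltW.
have fm : mu [set: T] \is a fin_num by exact: fin_num_measure.
exact: (@Lfun_subset _ _ _ mu 1%E p%:E (lexx _) pe fm pe f).
Qed.

Lemma Lp_pow_L1 f : f \in Lfun mu p%:E -> (fun x => `|f x| `^ p) \in Lfun mu 1%E.
Proof. by move=> fp; apply/Lfun1_integrable; apply: Lfun_integrable => //; exact: ltW. Qed.

Lemma Np_pow f : f \in Lfun mu p%:E -> E (fun x => `|f x| `^ p) = Np f `^ p.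
Proof.
move=> fp; have pn0 : p != 0 by rewrite gt_eqF.
have := powR_Lnorm mu (EFin \o f) pn0; rewrite (Np_fin fp) poweR_EFin.
have -> : (\int[mu]_x (`|(EFin \o f) x| `^ p))%E = (\int[mu]_x (`|f x| `^ p)%:E)%E.
  by [] || apply: eq_integral => x _; reflexivity.
by rewrite (E_fin (Lp_pow_L1 fp)) => -[->].
Qed.

Lemma bdd_Lp f : ess_bdd mu f -> f \in Lfun mu p%:E.
Proof.
move=> [mf [M fM]]; apply/andP; rewrite !inE/=; split => //.
rewrite /finite_norm unlock; apply: poweR_lty.
have mp : measurable_fun [set: T] (fun x => `|f x| `^ p).
  exact: (measurableT_comp (measurable_powR p) (measurableT_comp (@normr_measurable _ setT) mf)).
have L : L1 (fun x => `|f x| `^ p).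
  apply: L1_bdd; split => //; exists (`|M| `^ p); apply: filterS fM => x fM.
  rewrite ger0_norm ?powR_ge0 //; apply: ge0_ler_powR; rewrite ?nnegrE // ?(ltW p0) //.
  exact: le_trans fM (ler_norm _).
have -> : (\int[mu]_x (`|(EFin \o f) x| `^ p))%E = (\int[mu]_x (`|f x| `^ p)%:E)%E.
  by [] || apply: eq_integral => x _; reflexivity.
by rewrite (E_fin L) ltry.
Qed.

(** Bounded functions with a positive lower bound in the domain of the
    generator approximate the modulus of any f in L^p, in L^1 and without
    increasing the L^p norm much. *)
Lemma approx_Lp (P : R -> (T -> R) -> (T -> R)) f e : symmetric_Markov_semigroup mu P ->
  f \in Lfun mu p%:E -> 0 < e ->
  exists g c M, [/\ smooth mu P g, 0 < c, ae_between mu c M g,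
    N1 (fun x => g x - `|f x|) <= e &
    E (fun x => g x `^ p) <= E (fun x => `|f x| `^ p) + e].
Proof.
move=> hP fp e0.
have e20 : 0 < e / 2 by rewrite divr_gt0.
have f1 := Lp_L1 fp; have af1 := L1_norm f1; have fpow := Lp_pow_L1 fp.
have mf := L1_meas f1.
pose u (n : nat) x := Num.max (Num.min `|f x| n%:R) n.+1%:R^-1.
have invn (n : nat) : (0 : R) < n.+1%:R^-1 by rewrite invr_gt0.
have invn1 (n : nat) : (n.+1%:R^-1 : R) <= 1 by rewrite invf_le1 // ler1n.
have mu_ n : measurable_fun [set: T] (u n).
  apply: measurable_maxr; last exact: measurable_cst.
  by apply: measurable_minr; [exact: measurableT_comp|exact: measurable_cst].
have u0 n x : n.+1%:R^-1 <= u n x by rewrite le_max lexx orbT.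
have uM n x : u n x <= n%:R + 1.
  by rewrite ge_max !ge_min lerDl ler01 orbT /= (le_trans (invn1 n)) // lerDr.
have uf n x : u n x <= `|f x| + n.+1%:R^-1.
  by rewrite ge_max ge_min lerDl (ltW (invn n)) lerDr normr_ge0.
have bu n : ess_bdd mu (u n).
  split; first exact: mu_.
  exists (n%:R + 1); apply: aeW => x.
  by rewrite ger0_norm ?uM // (le_trans _ (u0 n x)) // ltW.
have u1 n : L1 (u n) by exact: L1_bdd.
have ucvg x : u n x @[n --> \oo] --> `|f x|.
  apply/cvgrPdist_le => de de0.
  have n1 : \forall n \near \oo, `|f x| <= n%:R.
    exact: nbhs_infty_ger.
  have n2 : \forall n \near \oo, n.+1%:R^-1 <= de.
    by apply: filterS (near_infty_natSinv_lt (PosNum de0)) => n /ltW.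
  apply: filterS2 n1 n2 => n n1 n2.
  rewrite distrC; have := uf n x; have : `|f x| <= u n x.
    by rewrite /u (min_idPl n1) le_max lexx.
  move=> h1 h2; rewrite ger0_norm; last by rewrite subr_ge0.
  by rewrite lerBlDl (le_trans h2) // lerD2l.
have udom x n : `|u n x| <= `|f x| + 1.
  rewrite ger0_norm; first by rewrite (le_trans (uf n x)) // lerD2l.
  by rewrite (le_trans _ (u0 n x)) // ltW.
have [_ uN1] := @N1_cvg_dominated _ _ _ mu u (fun x => `|f x|) (fun x => `|f x| + 1) u1
   (measurableT_comp (@normr_measurable _ setT) mf) (L1D af1 (L1_cst mu 1))
   (aeW mu ucvg) (aeW mu udom).
have n2 : \forall n \near \oo, n.+1%:R^-1 <= e / 2.
  by apply: filterS (near_infty_natSinv_lt (PosNum e20)) => n /ltW.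
have [n [hn1 hn2]] := @filter_ex _ \oo _ _ (filterI (uN1 _ e20) n2).
pose c : R := n.+1%:R^-1; pose M : R := n%:R + 1.
have c0 : 0 < c := invn n.
(* x^p is Lipschitz on the range of the truncation, so that closeness in L^1
   controls the p-th moment *)
have [K K0 hK] := @lipschitz_pos R (fun x => x `^ p) (fun x => p * x `^ (p - 1)) c M c0
   (fun z z0 => let: And3 h _ _ := has_C2_powR p z0 in h)
   (fun z z0 => let: And3 _ h _ := has_C2_powR p z0 in is_derive_cont h).
pose e' := Num.min (e / 2) (e / 2 / K).
have e'0 : 0 < e' by rewrite lt_min e20 divr_gt0.
have [g [dg gu gc gM]] := dom_dense hP (u1 n) e'0.
have gcM : ae_between mu c M g.
  by split; [apply: gc|apply: gM]; apply: aeW => x; [exact: u0|exact: uM].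
have g1 : L1 g by case: dg => g' [].
have bg : ess_bdd mu g.
  split; first exact: L1_meas g1.
  exists M; case: gcM => h1 h2; apply: filterS2 h1 h2 => x h1 h2.
  by rewrite ger0_norm // (le_trans _ h1) // ltW.
exists g, c, M; split.
- by apply/smoothP.
- exact: c0.
- exact: gcM.
- apply: le_trans (N1_trans (h := u n) g1 af1 (u1 n)) _.
  have e'e : e' <= e / 2 by rewrite ge_min lexx.
  by have := lerD (le_trans gu e'e) hn1; move/le_trans; apply; lra.
have cpow : forall x : R, 0 < x -> {for x, continuous (fun z : R => z `^ p)}.
  by have [] := C2_cont (C2_on_powR p).
have gp1 : L1 (fun x => g x `^ p).
  by apply: L1_bdd; apply: (ess_bdd_between c0 (L1_meas g1) (measurable_powR p) cpow gcM).
have D1 := L1_norm (L1B g1 (u1 n)).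
have cc := L1_cst mu (e / 2).
have KD := L1Z K D1.
apply: (@le_trans _ _ (E (fun x => (`|f x| `^ p + e / 2) + K * `|g x - u n x|))).
  apply: le_E; [exact: gp1|by apply: L1D => //; exact: L1D|].
  case: gcM => h1 h2; apply: filterS2 h1 h2 => x h1 h2.
  have upf : u n x `^ p <= `|f x| `^ p + e / 2.
    rewrite /u; set a := Num.min _ _.
    have a0 : 0 <= a by rewrite le_min normr_ge0 ler0n.
    have af : a <= `|f x| by rewrite ge_min lexx.
    have afp : a `^ p <= `|f x| `^ p by apply: ge0_ler_powR; rewrite ?nnegrE // ltW.
    have [ac|ca] := leP a n.+1%:R^-1.
      apply: (@le_trans _ _ (0 + e / 2)); last by rewrite lerD2r powR_ge0.
      rewrite add0r (le_trans _ hn2) //.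
      by apply: ge1r_powR; [rewrite invn invn1|exact: ltW].
    by rewrite (le_trans afp) // lerDl ltW.
  apply: (@le_trans _ _ (u n x `^ p + K * `|g x - u n x|)); last by rewrite lerD2r.
  rewrite -lerBlDl (le_trans (ler_norm _)) //.
  exact: hK (u0 n x) (uM n x) h1 h2.
rewrite ED //; last exact: L1D.
rewrite ED // E_cst EZ // -addrA lerD2l.
have : K * N1 (fun x => g x - u n x) <= e / 2.
  by rewrite mulrC -ler_pdivlMr // (le_trans gu) // ge_min lexx orbT.
rewrite /L1norm => h; lra.
Qed.

Lemma limn_einf_ge0 (w : nat -> \bar R) : (forall n, (0 <= w n)%E) -> (0 <= limn_einf w)%E.
Proof.
move=> w0; rewrite limn_einf_lim; apply: lime_ge; first exact: is_cvg_einfs.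
by apply: nearW => n; apply: le_ereal_inf_tmp => _ [j _ <-]; exact: w0.
Qed.

End Lp_tools.

(** * From the F-Sobolev inequality to the gauge norm bound *)

Section gauge.
Context d (T : measurableType d) (R : realType).
Variable mu : probability T R.
Variables (p : R) (F : R -> R).
Hypotheses (hp : 1 < p) (F_C2 : C2_on [set x | 0 < x] F) (F_nondecr : nondecreasing_pos F)
  (F_1 : F 1 = 0).
Implicit Types f g : T -> R.

Local Notation L1 f := (f \in Lfun mu 1%E).
Local Notation E f := (\int[mu]_x f x).
Local Notation N1 := (L1norm mu).
Local Notation tau := (tau p F).

Lemma gauge_norm_le q0 f B : 0 <= B ->
  (forall lam, B < lam -> (\int[mu]_x (tau q0 (`|f x| / lam))%:E <= 1%:E)%E) ->
  (gauge_norm mu (tau q0) f <= B%:E)%E.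
Proof.
move=> B0 h; apply/lee_addgt0Pr => e e0.
apply: ereal_inf_lbound; exists (B + e) => //; split; first exact: ltr_wpDl.
by rewrite (tau_1 p F_1 q0); apply: h; rewrite ltrDl.
Qed.

(** Admissible levels form an up-set, because tau is nondecreasing. *)
Lemma gauge_norm_lt q0 f B lam : 0 <= q0 -> measurable_fun [set: T] f ->
  (gauge_norm mu (tau q0) f <= B%:E)%E -> B < lam ->
  (\int[mu]_x (tau q0 (`|f x| / lam))%:E <= 1%:E)%E.
Proof.
move=> q00 mf hB Bl.
have : (gauge_norm mu (tau q0) f < lam%:E)%E by rewrite (le_lt_trans hB) // lte_fin.
move=> /ereal_inf_lt[_ [s [s0 hs] <-]]; rewrite lte_fin => sl.
rewrite (tau_1 p F_1 q0) in hs; apply: le_trans hs.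
have lam0 : 0 < lam by exact: lt_trans sl.
have mt a : measurable_fun [set: T] (fun x => (tau q0 (`|f x| / a))%:E).
  apply/measurable_EFinP; apply: measurableT_comp; first exact: measurable_tau.
  by apply: measurable_funM; [exact: measurableT_comp|exact: measurable_cst].
apply: ge0_le_integral; [exact: measurableT|by move=> x _; rewrite lee_fin tau_ge0|exact: mt|exact: mt|].
move=> x _; rewrite lee_fin; apply: le_tau => //.
  by rewrite divr_ge0 // ltW.
by apply: ler_wpM2l => //; rewrite lef_pV2 ?posrE // ltW.
Qed.

(** Passage to the limit along an L^1-fast approximation of |f|: positivity of
    P_t dominates P_t f, and Fatou's lemma keeps the bound. *)
Lemma fatou_step (P : R -> (T -> R) -> (T -> R)) t lam q0 f (g : nat -> T -> R) :
  symmetric_Markov_semigroup mu P -> 0 <= t -> 0 < lam -> 0 <= q0 -> L1 f ->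
  (forall j, ess_bdd mu (g j)) -> (forall j, {ae mu, forall x, 0 <= g j x}) ->
  (forall j, N1 (fun x => g j x - `|f x|) <= 2^-1 ^+ j) ->
  (forall j, (\int[mu]_x (tau q0 (P t (g j) x / lam))%:E <= 1%:E)%E) ->
  (\int[mu]_x (tau q0 (`|P t f x| / lam))%:E <= 1%:E)%E.
Proof.
move=> hP t0 lam0 q00 f1 bg g0 gf hg.
have af1 := L1_norm f1.
have g1 j : L1 (g j) by exact: L1_bdd.
have Pg1 j := P_L1 hP t0 (g1 j).
have Pf1 := P_L1 hP t0 f1.
have Paf1 := P_L1 hP t0 af1.
have cvg : {ae mu, forall x, P t (g j) x @[j --> \oo] --> P t (fun x => `|f x|) x}.
  apply: (fast_cvg_ae Pg1 Paf1) => j.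
  exact: le_trans (P_N1B hP t0 (g1 j) af1) (gf j).
have mt (v : T -> R) : measurable_fun [set: T] v ->
    measurable_fun [set: T] (fun x => (tau q0 (v x / lam))%:E).
  move=> mv; apply/measurable_EFinP; apply: measurableT_comp; first exact: measurable_tau.
  by apply: measurable_funM; [exact: mv|exact: measurable_cst].
have mtg j := mt _ (L1_meas (Pg1 j)).
have t_ge0 (v : T -> R) x : (0 <= (tau q0 (v x / lam))%:E)%E by rewrite lee_fin tau_ge0.
apply: (@le_trans _ _ (\int[mu]_x limn_einf (fun j => (tau q0 (P t (g j) x / lam))%:E))%E).
  apply: ae_ge0_le_integral => //.
  - by move=> x _; exact: (t_ge0 (fun x => `|P t f x|)).
  - by apply: (mt (fun x => `|P t f x|)); apply: measurableT_comp => //; exact: L1_meas Pf1.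
  - by move=> x _; apply: limn_einf_ge0 => j; exact: t_ge0.
  - apply: measurableT_comp => //.
    apply: measurable_fun_limn_esup => j.
    by apply: measurableT_comp.
  apply: filterS2 cvg (P_abs hP t0 f1) => x xcvg xabs _.
  set y := P t (fun x => `|f x|) x in xcvg xabs.
  have y0 : 0 <= y by exact: le_trans xabs.
  move: (y0); rewrite le_eqVlt => /predU1P[yE|ygt].
    have -> : `|P t f x| = 0 by apply/eqP; rewrite eq_le normr_ge0 andbT yE.
    by rewrite mul0r tau_0 //; apply: limn_einf_ge0 => j.
  have yl : 0 < y / lam by exact: divr_gt0.
  have [ct _ _] := C2_cont (tau_C2 p F_C2 q0).
  have tc : (tau q0 (P t (g j) x / lam))%:E @[j --> \oo] --> (tau q0 (y / lam))%:E.
    apply: cvg_EFin; first exact: nearW.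
    have xl : P t (g j) x / lam @[j --> \oo] --> y / lam.
      by apply: cvgM; [exact: xcvg|exact: cvg_cst].
    exact: (cvg_comp _ _ xl (ct _ yl)).
  rewrite (cvg_limn_einf_sup tc).1 lee_fin; apply: le_tau => //.
    by rewrite divr_ge0 // ltW.
  by rewrite ler_pM2r // invr_gt0.
apply: le_trans (fatou mu measurableT mtg (fun j x _ => t_ge0 _ x)) _.
rewrite limn_einf_lim; apply: lime_le; first exact: is_cvg_einfs.
apply: nearW => n; apply: ge_ereal_inf.
by eexists; [exists n => //=|exact: hg].
Qed.

End gauge.

Section hypercontractivity.
Context d (T : measurableType d) (R : realType).
Variable mu : probability T R.
Variables (P : R -> (T -> R) -> (T -> R)) (L : (T -> R) -> (T -> R)).
Hypothesis hPL : symmetric_diffusion_semigroup mu P L.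
Variables (p : R) (F : R -> R).
Hypotheses (hp : 1 < p) (F_C2 : C2_on [set x | 0 < x] F) (F_nondecr : nondecreasing_pos F)
  (F_1 : F 1 = 0).

Local Notation L1 f := (f \in Lfun mu 1%E).
Local Notation E f := (\int[mu]_x f x).
Local Notation N1 := (L1norm mu).
Local Notation tau := (tau p F).

(** Testing the inequality on constants. *)
Lemma Sobolev_ge0 C Ct : F_Sobolev mu P L F C Ct -> 0 <= Ct.
Proof.
move=> hS; have hP := diff_markov hPL.
have d1 : dom mu P (fun _ => 1).
  exists (fun _ => 0); apply/(generates_P hP); split; [exact: L1_cst..|] => e e0.
  have h0 : \forall h \near (0:R)^'+, 0 < h by exact: nbhs_right_gt.
  apply: filterS h0 => h h0.
  have Ph1 := P_L1 hP (ltW h0) (L1_cst mu 1).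
  have D1 := L1B (L1B Ph1 (L1_cst mu 1)) (L1Z h (L1_cst mu 0)).
  rewrite (@eq_N1 _ _ _ mu _ (fun _ => 0) D1 (L1_cst mu 0)).
    by rewrite N1_cst normr0 mulr_ge0 // ltW.
  by apply: filterS (sg_1 hP (ltW h0)) => x ->; rewrite subrr mulr0 subr0.
have s1 : smooth mu P (fun _ => 1) by apply/smoothP; split => //; exact: ess_bdd_cst.
have := Sobolev_real hPL hS s1; rewrite expr1n E_cst divr1 F_1 mulr0 E_cst.
move=> /(_ (L1_cst mu 0)).
have -> : E (carre_du_champ L (fun _ => 1) (fun _ => 1)) = 0.
  have d2 := dom_sqr hPL s1.
  have [_ L1a _] := generator_P hPL d1; have [_ L1b _] := generator_P hPL d2.
  have z1 := L1Z 1 L1a.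
  rewrite /carre_du_champ (EZ _ (L1B (L1B L1b z1) z1)) (EB (L1B L1b z1) z1) (EB L1b z1).
  by rewrite (EZ 1 L1a) (mean_L hPL d1) (mean_L hPL d2) mulr0 !subr0 mulr0.
by rewrite mulr0 mulr1 add0r.
Qed.

Variables (k l : R -> R) (m C Ct : R) (q dq : R -> R).
Hypotheses (k_ge0 : nonnegative_Rplus k) (hk : tau_convexity p F k)
  (l_ge0 : nonnegative_Rplus l) (m_ge0 : 0 <= m) (hl : tau_rates p F m l)
  (hS : F_Sobolev mu P L F C Ct)
  (q_ge0 : nonnegative_Rplus q) (q_nd : nondecreasing_Rplus q)
  (q_der : forall t : R, 0 <= t -> has_derivative_Rplus q t (dq t)) (q0 : q 0 = 0)
  (hq : growth_condition C k l q dq).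

(** For lam above the bound, the room between them is shared: lam0 exceeds the
    L^p norm of f, to accommodate the approximation, and the slack ep t is chosen
    so that the barrier at time t stays below lam. *)
Lemma gauge_bound t (Psi : R -> R) f : 0 <= t -> rate_primitive l Ct Psi (q t) -> Psi 0 = 0 ->
  f \in Lfun mu p%:E ->
  (gauge_norm mu (tau (q t)) (P t f) <= (expR ((m * q t + Psi (q t)) / p) * Np mu p f)%:E)%E.
Proof.
move=> t0 hPsi Psi0 fp.
have Ct0 := Sobolev_ge0 hS.
have hP := diff_markov hPL.
have p0 : 0 < p by exact: lt_trans hp.
set S := m * q t + Psi (q t).
have N0 := Np_ge0 mu p f.
apply: gauge_norm_le => //; first by rewrite mulr_ge0 // expR_ge0.
move=> lam hlam.
have eS0 := expR_gt0 (S / p).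
have hlam' : Np mu p f < lam / expR (S / p) by rewrite ltr_pdivlMr // mulrC.
pose lam0 := (Np mu p f + lam / expR (S / p)) / 2.
have l1 : Np mu p f < lam0 by rewrite /lam0; lra.
have l2 : lam0 < lam / expR (S / p) by rewrite /lam0; lra.
have lam00 : 0 < lam0 by exact: le_lt_trans l1.
have l3 : lam0 * expR (S / p) < lam by rewrite -ltr_pdivlMr.
have lamgt : 0 < lam by apply: lt_trans l3; exact: mulr_gt0.
pose ratio := lam / (lam0 * expR (S / p)).
have ratio1 : 1 < ratio by rewrite ltr_pdivlMr ?mul1r // mulr_gt0.
have t1 : 0 < t + 1 by exact: ltr_pwDr ltr01 t0.
pose ep := p * ln ratio / (t + 1).
have lnr : 0 < ln ratio by exact: ln_gt0.
have ep0 : 0 < ep by rewrite divr_gt0 // mulr_gt0.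
have lev : lam0 * expR ((S + ep * t) / p) <= lam.
  have : (S + ep * t) / p <= S / p + ln ratio.
    rewrite mulrDl lerD2l ler_pdivrMr // /ep mulrAC ler_pdivrMr //.
    rewrite (mulrC p); apply: ler_wpM2l; first by rewrite mulr_ge0 // ltW.
    by rewrite lerDl.
  rewrite -ler_expR expRD lnK ?posrE; last by exact: lt_trans ltr01 ratio1.
  move=> /(ler_wpM2l (ltW lam00)); move/le_trans; apply.
  rewrite le_eqVlt; apply/orP; left; apply/eqP; rewrite /ratio; field.
  by rewrite (gt_eqF eS0) (gt_eqF lam00).
have Ep : E (fun x => `|f x| `^ p) < lam0 `^ p.
  by rewrite (Np_pow hp fp); apply: gt0_ltr_powR; rewrite ?nnegrE // ltW.
pose gap := lam0 `^ p - E (fun x => `|f x| `^ p).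
have gap0 : 0 < gap by rewrite subr_gt0.
have : forall j, exists gcM : (T -> R) * R * R, [/\ smooth mu P gcM.1.1, 0 < gcM.1.2,
    ae_between mu gcM.1.2 gcM.2 gcM.1.1, N1 (fun x => gcM.1.1 x - `|f x|) <= 2^-1 ^+ j &
    E (fun x => gcM.1.1 x `^ p) <= lam0 `^ p].
  move=> j.
  have e0 : 0 < Num.min (2^-1 ^+ j) gap by rewrite lt_min gap0 andbT exprn_gt0.
  have [g [c [M [h1 h2 h3 h4 h5]]]] := approx_Lp hp hP fp e0.
  exists (g, c, M); split; [exact: h1|exact: h2|exact: h3|rewrite /=|rewrite /=].
    by apply: (le_trans h4); rewrite ge_min lexx.
  apply: (le_trans h5); rewrite -lerBrDl -/gap.
  by rewrite ge_min lexx orbT.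
move=> /choice[G hG].
apply: (@fatou_step _ _ _ mu p F hp F_C2 F_nondecr P t lam (q t) f (fun j => (G j).1.1)) => //.
- exact: q_ge0.
- exact: (Lp_L1 hp fp).
- by move=> j; have [/smoothP[]] := hG j.
- move=> j; have [_ c0 [h1 _] _ _] := hG j; apply: filterS h1 => x.
  by apply: le_trans; exact: ltW.
- by move=> j; have [] := hG j.
move=> j; have [sg c0 gcM _ Eg] := hG j.
have H := smooth_bound_eps hPL hp F_C2 F_nondecr k_ge0 hk l_ge0 m_ge0 hl hS Ct0 q_ge0 q_nd
  q_der q0 hq t0 hPsi Psi0 ep0 sg c0 gcM lam00 Eg.
have tL a : 0 < a -> L1 (fun x => tau (q t) (P t (G j).1.1 x / a)).
  by move=> a0; exact: (tau_Pf_L1 hPL p F_C2 sg c0 gcM (q t) t0 a0).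
rewrite (E_fin (tL _ lamgt)) lee_fin; apply: le_trans H.
have lev0 : 0 < lam0 * expR ((S + ep * t) / p) by rewrite mulr_gt0 // expR_gt0.
apply: le_E; [exact: tL|exact: tL|].
have [h1 _] := gcM; apply: filterS (P_ge hP t0 (smooth_L1 sg) h1) => x cx.
have Px0 : 0 <= P t (G j).1.1 x by exact: le_trans (ltW c0) cx.
apply: (le_tau hp F_nondecr (q_ge0 t0)).
  by rewrite divr_ge0 // ltW.
by apply: ler_wpM2l => //; rewrite lef_pV2 ?posrE.
Qed.

(** If the integral of [l] diverges the right-hand side is infinite, unless Ct = 0
    or f vanishes. *)
Theorem hypercontractivity f t : measurable_fun [set u : R | 0 <= u] l ->
  f \in Lfun mu p%:E -> 0 <= t ->
  (gauge_norm mu (tau (q t)) (P t f) <=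
       expeR ((p^-1)%:E *
         ((m * q t)%:E +
          Ct%:E * \int[lebesgue_measure]_(u in `[0%R, q t]) (l u)%:E)) *
       'N[mu]_p%:E[EFin \o f])%E.
Proof.
move=> ml fp t0; rewrite (Np_fin fp).
have p0 : 0 < p by exact: lt_trans hp.
have := Sobolev_ge0 hS; rewrite le_eqVlt => /predU1P[CtE|Ct0].
  have -> : (Ct%:E * \int[lebesgue_measure]_(u in `[0%R, q t]) (l u)%:E = 0)%E by rewrite -CtE mul0e.
  rewrite adde0 (_ : expeR _ = (expR ((m * q t + 0) / p))%:E); last first.
    by rewrite /= addr0 mulrC.
  rewrite -EFinM; apply: (@gauge_bound t (fun _ => 0) f t0 _ erefl fp).
  by move=> x y a *; rewrite -CtE mul0r subrr.
have [fin|inf] := ltP (\int[lebesgue_measure]_(u in `[0%R, q t]) (l u)%:E)%E +oo%E.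
  pose Psi x := Ct * \int[lebesgue_measure]_(u in `[0%R, x]) l u.
  have int := integrable_rate ml fin l_ge0.
  have -> : (\int[lebesgue_measure]_(u in `[0%R, q t]) (l u)%:E =
      (\int[lebesgue_measure]_(u in `[0%R, q t]) l u)%:E)%E.
    by rewrite /Rintegral fineK //; exact: integrable_fin_num int.
  rewrite (_ : expeR _ = (expR ((m * q t + Psi (q t)) / p))%:E); last first.
    by rewrite /= mulrC.
  rewrite -EFinM; apply: (@gauge_bound t Psi f t0 _ _ fp); rewrite /Psi.
    move=> x y a x0 xy yQ al; rewrite -mulrBr; apply: ler_wpM2l; first exact: ltW.
    exact: (rate_integral_ge ml fin l_ge0).
  by rewrite set_itv1 Rintegral_set1 mulr0.
have -> : (\int[lebesgue_measure]_(u in `[0%R, q t]) (l u)%:E = +oo)%E.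
  by apply/eqP; rewrite eq_le inf leey.
rewrite gt0_muley ?lte_fin // addey // gt0_muley ?lte_fin ?invr_gt0 //=.
have := Np_ge0 mu p f; rewrite le_eqVlt => /predU1P[N0|N0]; last first.
  by rewrite gt0_mulye ?lte_fin // leey.
(* here f = 0 almost everywhere, and +oo * 0 = 0 *)
rewrite -N0 mule0; apply: gauge_norm_le => // lam lam0.
have hP := diff_markov hPL; have f1 := Lp_L1 hp fp; have fpow := Lp_pow_L1 hp fp.
have : N1 (fun x => `|f x| `^ p) <= 0.
  rewrite (_ : N1 _ = E (fun x => `|f x| `^ p)); last first.
    by congr Rintegral; apply/funext => x; rewrite ger0_norm // powR_ge0.
  by rewrite (Np_pow hp fp) -N0 powR0 // gt_eqF.
move=> /(N1_eq0 fpow) f0.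
have {}f0 : {ae mu, forall x, f x = 0}.
  by apply: filterS f0 => x /powR_eq0_eq0/eqP; rewrite normr_eq0 => /eqP.
have t00 : {ae mu, forall x, (fun _ => 0) x = tau (q t) (`|P t f x| / lam)}.
  apply: filterS2 (P_ae hP t0 f1 (L1_cst mu 0) f0) (P_0 hP t0) => x -> ->.
  by rewrite normr0 mul0r tau_0.
have mt : measurable_fun [set: T] (fun x => tau (q t) (`|P t f x| / lam)).
  apply: measurableT_comp; first exact: measurable_tau.
  apply: measurable_funM; last exact: measurable_cst.
  by apply: measurableT_comp => //; exact: L1_meas (P_L1 hP t0 f1).
have tL := L1_ae mt (L1_cst mu 0) t00.
by rewrite (E_fin tL) lee_fin -(E_ae (L1_cst mu 0) tL t00) E_cst.
Qed.

End hypercontractivity.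

(** * The derivative at time 0 *)

Section converse.
Context d (T : measurableType d) (R : realType).
Variable mu : probability T R.
Variables (P : R -> (T -> R) -> (T -> R)) (L : (T -> R) -> (T -> R)).
Hypothesis hPL : symmetric_diffusion_semigroup mu P L.
Variables (p : R) (F : R -> R).
Hypotheses (hp : 1 < p) (F_C2 : C2_on [set x | 0 < x] F) (F_nondecr : nondecreasing_pos F)
  (F_1 : F 1 = 0).

Local Notation L1 f := (f \in Lfun mu 1%E).
Local Notation E f := (\int[mu]_x f x).
Local Notation N1 := (L1norm mu).
Local Notation tau := (tau p F).
Local Notation Gamma f := (carre_du_champ L f f).
Local Notation pos := [set x : R | 0 < x].

Let p0 : 0 < p. Proof. exact: lt_trans hp. Qed.

Lemma powR_convex (x y : R) : 0 < x -> 0 < y ->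
  x `^ p + p * x `^ (p - 1) * (y - x) <= y `^ p.
Proof.
move=> x0 y0.
have [z [h1 h2 E]] := @mvt_pos R (fun x => x `^ p) (fun x => p * x `^ (p - 1)) x y x0 y0
  (fun z z0 => let: And3 h _ _ := has_C2_powR p z0 in h).
rewrite -lerBrDl E -subr_ge0 -mulrBl -mulrBr.
have p10 : 0 <= p - 1 by rewrite subr_ge0 ltW.
have [xy|yx] := leP x y.
- rewrite min_l // in h1.
  apply: mulr_ge0; last by rewrite subr_ge0.
  apply: mulr_ge0; first exact: ltW.
  by rewrite subr_ge0 ge0_ler_powR // nnegrE ?(ltW x0) // (le_trans (ltW x0)).
- rewrite (max_l (ltW yx)) in h2; rewrite (min_r (ltW yx)) in h1.
  apply: mulr_le0; last by rewrite subr_le0 ltW.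
  apply: mulr_ge0_le0; first exact: ltW.
  by rewrite subr_le0 ge0_ler_powR // nnegrE ?(ltW x0) // (le_trans (ltW y0)).
Qed.

Lemma tau_ge_linear q x : tau q x >= x `^ p + q * (x `^ p * F (x `^ p)).
Proof.
have := ler_wpM2l (powR_ge0 x p) (expR_ge1Dx (q * F (x `^ p))).
by apply: le_trans; rewrite mulrDr mulr1 mulrCA.
Qed.

Variables (q r : R -> R) (q1 r1 : R).

Definition gauge_contraction := forall (f : T -> R) (t : R), f \in Lfun mu p%:E -> 0 <= t ->
  (gauge_norm mu (tau (q t)) (P t f) <= (expR (r t))%:E * 'N[mu]_p%:E[EFin \o f])%E.

Hypotheses (q_ge0 : nonnegative_Rplus q) (r_ge0 : nonnegative_Rplus r)
  (r_nd : nondecreasing_Rplus r)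
  (q_der : has_derivative_Rplus q 0 q1) (r_der : has_derivative_Rplus r 0 r1)
  (q0 : q 0 = 0) (r0 : r 0 = 0) (q1_gt0 : 0 < q1)
  (hg : gauge_contraction).

(** Differentiating E[tau_{q(t)}(e^{-r(t)} P_t f)] <= 1 at t = 0, where equality
    holds. Convexity of x^p and e^x >= 1 + x give the lower bounds. *)
Lemma derivative_at_0 f c M : smooth mu P f -> 0 < c -> ae_between mu c M f ->
  E (fun x => f x `^ p) = 1 ->
  q1 * E (fun x => f x `^ p * F (f x `^ p)) <=
    p * r1 + p * (p - 1) *
      E (fun x => (lift_pos (c / 2) (f x)) `^ (p - 1 - 1) * Gamma f x).
Proof.
move=> sf c0 fcM Ef.
have hP := diff_markov hPL.
have [cf fM] := fcM.
have [bf df] := (smoothP mu P f).1 sf.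
have [f1 Lf1 hf] := generator_P hPL df.
have mf := L1_meas f1.
have c20 : 0 < c / 2 by rewrite divr_gt0.
pose lf x := lift_pos (c / 2) (f x).
have lfE : {ae mu, forall x, lf x = f x}.
  by apply: filterS cf => x cx; rewrite /lf lift_posE //; lra.
have cpow a : forall x : R, 0 < x -> {for x, continuous (fun z : R => z `^ a)}.
  by have [] := C2_cont (C2_on_powR a).
pose w x := (lf x) `^ (p - 1).
have bw : ess_bdd mu w := ess_bdd_lift c0 mf (cpow (p - 1)) fcM.
pose w2 x := (lf x) `^ (p - 1 - 1).
have bw2 : ess_bdd mu w2 := ess_bdd_lift c0 mf (cpow (p - 1 - 1)) fcM.
have G1 := Gamma_L1 hPL sf.
have wL := L1M bw Lf1; have w2G := L1M bw2 G1.
(* integration by parts: L (f^p) has mean 0 *)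
set W2 := E (fun x => (lift_pos (c / 2) (f x)) `^ (p - 1 - 1) * Gamma f x).
pose W := E (fun x => w x * L f x).
have WE : W = - (p - 1) * W2.
  have [st _ Lt _] := chain_pos hPL sf c0 cf (C2_on_powR p).
  have [_ dt] := (smoothP mu P _).1 st.
  have i1 := L1Z p wL; have i2 := L1Z (p * (p - 1)) w2G.
  have : E (fun x => p * (w x * L f x) + p * (p - 1) * (w2 x * Gamma f x)) = 0.
    rewrite -(mean_L hPL dt); apply: E_ae; [exact: L1D|by have [] := generator_P hPL dt|].
    apply: filterS3 Lt lfE cf => x -> lx cx.
    have x0 : pos (f x) by exact: lt_le_trans cx.
    have [-> ->] := has_C2_val (@open_pos R) (has_C2_powR p) x0.
    by rewrite /w /w2 lx; ring.
  rewrite (ED i1 i2) (EZ p wL) (EZ _ w2G) -/W -/W2 => h.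
  have : p * (W + (p - 1) * W2) = 0 by rewrite mulrDr mulrA.
  by move/eqP; rewrite mulf_eq0 (gt_eqF p0) /= addr_eq0 mulNr => /eqP.
have W20 : 0 <= W2.
  apply: E_ge0; first exact: w2G.
  apply: filterS (Gamma_ge0 hPL sf) => x gx.
  by apply: mulr_ge0 => //; exact: powR_ge0.
have W0 : W <= 0 by rewrite WE mulNr oppr_le0 mulr_ge0 // subr_ge0 ltW.
suff : q1 * E (fun x => f x `^ p * F (f x `^ p)) <= p * r1 - p * W.
  by rewrite WE; move/le_trans; apply; rewrite le_eqVlt; apply/orP; left; apply/eqP; ring.
have r10 : 0 <= r1 := derivative_Rplus_ge0 (lexx 0) r_nd r_der.
pose D x := x `^ p * F (x `^ p).
have DC2 : C2_on pos D by apply: C2_onM; [exact: C2_on_powR|exact: C2_on_F_powR].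
have [K K0 hK] := @lipschitz_pos R D (D^`())%classic (c / 2) M c20
   (fun z z0 => let: And3 h _ _ := has_C2P DC2 z0 in h) (let: And3 _ h _ := C2_cont DC2 in h).
have [cD _ _] := C2_cont DC2.
have mD : measurable_fun [set: R] D.
  have -> : D = (fun x => tau 0 x * F (x `^ p)) by apply/funext => x; rewrite tau_q0.
  exact: measurable_tauF.
have Df1 := L1_bdd (ess_bdd_between c0 mf mD cD fcM).
have fp1 := L1_bdd (ess_bdd_between c0 mf (measurable_powR p) (cpow p) fcM).
set ID := E (fun x => f x `^ p * F (f x `^ p)).
have [mw [B1 hB1]] := bw.
have Np1 : Np mu p f = 1.
  have := Np_pow hp (bdd_Lp hp bf).
  have -> : E (fun x => `|f x| `^ p) = E (fun x => f x `^ p).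
    apply: E_ae => //; first exact: (Lp_pow_L1 hp (bdd_Lp hp bf)).
    by apply: filterS cf => x cx; rewrite ger0_norm // (le_trans (ltW c0)).
  rewrite Ef => /esym; have N0 := Np_ge0 mu p f => h.
  have : Np mu p f `^ p = 1 `^ p by rewrite h powR1.
  by apply: (powR_injective p0); rewrite nnegrE.
pose Q := `|ID| + (q1 + 1) * K * (1 + (r1 + 2) * N1 f) + p * 2 + p * `|B1|.
have N1f := N1_ge0 mu f.
have Q0 : 0 <= Q.
  rewrite /Q !addr_ge0 ?mulr_ge0 ?addr_ge0 ?mulr_ge0 ?(ltW p0) ?(ltW K0) ?(ltW q1_gt0) //.
  by rewrite addr_ge0.
suff main : forall e, 0 < e -> e <= 1 -> q1 * ID <= p * r1 - p * W + Q * e.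
  apply/ler_addgt0Pr => e e0.
  have Q10 : 0 < Q + 1 by exact: ltr_pwDr ltr01 Q0.
  have e'0 : 0 < Num.min 1 (e / (Q + 1)) by rewrite lt_min ltr01 divr_gt0.
  have e'1 : Num.min 1 (e / (Q + 1)) <= 1 by rewrite ge_min lexx.
  apply: (le_trans (main _ e'0 e'1)); rewrite lerD2l.
  apply: (@le_trans _ _ ((Q + 1) * Num.min 1 (e / (Q + 1)))).
    by apply: ler_wpM2r; [exact: ltW|rewrite lerDl].
  by rewrite mulrC -ler_pdivlMr // ge_min lexx orbT.
move=> e e0 e1.
have [s1 s10 hs1] := derivative_Rplus_eps q_der e0.
have [s2 s20 hs2] := derivative_Rplus_eps r_der e0.
have [s3 s30 hs3] := P_cont hP f1 e0.
have r20 : 0 < r1 + 2 by exact: ltr_wpDl.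
have nt : \forall t \near (0:R)^'+, [/\ 0 < t, t < s1, t < s2, t < s3 & t < e /\ t < 4^-1 / (r1 + 2)].
  apply/near_rightP; exists (Num.min (Num.min (Num.min s1 s2) s3) (Num.min e (4^-1 / (r1 + 2)))).
    by rewrite !lt_min s10 s20 s30 e0 divr_gt0.
  by move=> t t0; rewrite add0r !lt_min => /andP[/andP[/andP[? ?] ?] /andP[? ?]].
have [t [[t0 ts1 ts2 ts3 [te tr]] ht]] := @filter_ex _ _ (at_right_proper_filter 0) _ (filterI nt (hf e e0)).
have t0' := ltW t0.
have nt0 : `|t - 0| = t by rewrite subr0 gtr0_norm.
have hqt : `|q t - q1 * t| <= e * t.
  by have := hs1 t t0'; rewrite nt0 q0 !subr0 => /(_ ts1).
have hrt : `|r t - r1 * t| <= e * t.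
  by have := hs2 t t0'; rewrite nt0 r0 !subr0 => /(_ ts2).
(* a level slightly above e^{r(t)}, so as to be admissible for the gauge norm; the
   excess t^2 does not affect the derivative at 0 *)
pose z := r t + t ^+ 2.
have z0 : 0 < z by apply: ltr_pwDr; [exact: exprn_gt0|exact: r_ge0].
have zle : z <= (r1 + e + e) * t.
  have -> : (r1 + e + e) * t = (e * t + r1 * t) + e * t by ring.
  apply: lerD; last by rewrite expr2 ler_pM2r // ltW.
  by rewrite -lerBlDr; exact: le_trans (ler_norm _) hrt.
have zle2 : z <= (r1 + 2) * t.
  apply: (le_trans zle); rewrite ler_pM2r // -addrA lerD2l.
  exact: lerD.
have z14 : z <= 4^-1 by apply: (le_trans zle2); rewrite mulrC -ler_pdivlMr // ltW.
pose lam := expR z.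
have lam1 : 1 < lam by rewrite /lam expR_gt1.
have lam0 : 0 < lam by exact: lt_trans ltr01 lam1.
have lam2 : lam <= 2 by exact: expR_le2 (ltW z0) z14.
have linv : 1 - lam^-1 <= z.
  by rewrite /lam -expRN lerBlDl -lerBlDr; exact: expR_ge1Dx.
have linv0 : 0 <= 1 - lam^-1 by rewrite subr_ge0 invf_le1 // ltW.
have linv1 : lam^-1 <= 1 by rewrite invf_le1 // ltW.
have li0 : 0 <= lam^-1 by rewrite invr_ge0 ltW.
have Pf1 := P_L1 hP t0' f1.
have mPf := L1_meas Pf1.
have cPf := P_ge hP t0' f1 cf; have PfM := P_le hP t0' f1 fM.
pose y x := P t f x / lam.
have my : measurable_fun [set: T] y by apply: measurable_funM; [exact: mPf|exact: measurable_cst].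
have ycM : ae_between mu (c / 2) M y.
  split; [apply: filterS cPf|apply: filterS2 PfM cPf] => x.
    move=> cx; apply: ler_pM; [exact: ltW|by rewrite invr_ge0|exact: cx|].
    by rewrite lef_pV2 ?posrE //.
  move=> xM cx; rewrite /y ler_pdivrMr //; apply: (le_trans xM).
  by apply: ler_peMr; [exact: le_trans (ltW c0) (le_trans cx xM)|exact: ltW].
have [cy yM] := ycM.
have [ct _ _] := C2_cont (tau_C2 p F_C2 (q t)).
have ty1 := L1_bdd (ess_bdd_between c20 my (measurable_tau p F_C2 (q t)) ct ycM).
have y1 : L1 y by have -> : y = (fun x => lam^-1 * P t f x) by [apply/funext => x; rewrite /y mulrC]; exact: L1Z.
have Ety : E (fun x => tau (q t) (y x)) <= 1.
  have := hg (bdd_Lp hp bf) t0'; rewrite (Np_fin (bdd_Lp hp bf)) Np1 -EFinM mulr1 => hN.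
  have hlam : expR (r t) < lam by rewrite /lam ltr_expR ltrDl exprn_gt0.
  have := gauge_norm_lt hp F_C2 F_nondecr F_1 (q_ge0 t0') mPf hN hlam.
  have aeE : {ae mu, forall x, tau (q t) (y x) = tau (q t) (`|P t f x| / lam)}.
    by apply: filterS cPf => x cx; rewrite ger0_norm // (le_trans (ltW c0)).
  have mt : measurable_fun [set: T] (fun x => tau (q t) (`|P t f x| / lam)).
    apply: measurableT_comp; first exact: measurable_tau.
    by apply: measurable_funM; [exact: measurableT_comp|exact: measurable_cst].
  have tL := L1_ae mt ty1 aeE.
  by rewrite (E_fin tL) lee_fin => hE; rewrite (E_ae ty1 tL aeE); exact: hE.
have yf1 := L1B y1 f1.
have ayf1 := L1_norm yf1.
have wyf := L1M bw yf1.
have qt0 := q_ge0 t0'.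
pose lower x := f x `^ p + (p * (w x * (y x - f x)) + q t * (D (f x) - K * `|y x - f x|)).
have k1 := L1Z p wyf; have k2 := L1B Df1 (L1Z K ayf1); have k3 := L1Z (q t) k2.
have low1 : L1 lower := L1D fp1 (L1D k1 k3).
have step : 1 + (p * E (fun x => w x * (y x - f x)) + q t * (ID - K * N1 (fun x => y x - f x))) <= 1.
  apply: (le_trans _ Ety).
  have <- : E lower = 1 + (p * E (fun x => w x * (y x - f x)) + q t * (ID - K * N1 (fun x => y x - f x))).
    rewrite /lower (ED fp1 (L1D k1 k3)) (ED k1 k3) Ef (EZ p wyf) (EZ _ k2) (EB Df1 (L1Z K ayf1)).
    by rewrite (EZ K ayf1).
  apply: le_E; [exact: low1|exact: ty1|].
  apply: filterS3 (filterI cf fM) (filterI cy yM) lfE => x [cx xM] [c1 c2] lx.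
  have fx0 : 0 < f x by exact: lt_le_trans cx.
  have yx0 : 0 < y x by exact: lt_le_trans c1.
  apply: (le_trans _ (tau_ge_linear (q t) (y x))).
  rewrite /lower addrA; apply: lerD.
    by rewrite /w lx mulrA; exact: powR_convex.
  apply: ler_wpM2l => //.
  have cx2 : c / 2 <= f x by exact: half_le.
  have := hK _ _ cx2 xM c1 c2; rewrite ler_norml => /andP[h _].
  by rewrite -/(D (y x)) lerBlDr -lerBlDl -lerN2 opprB.
have Ny : N1 (fun x => y x - f x) <= e + (r1 + 2) * e * N1 f.
  have -> : (fun x => y x - f x) = (fun x => lam^-1 * (P t f x - f x) + (- (1 - lam^-1)) * f x).
    by apply/funext => x; rewrite /y; ring.
  apply: (le_trans (N1D (L1Z _ (L1B Pf1 f1)) (L1Z _ f1))).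
  rewrite (N1Z _ (L1B Pf1 f1)) (N1Z _ f1) normrN (ger0_norm linv0) (ger0_norm li0).
  apply: lerD.
    apply: (@le_trans _ _ (1 * e)); last by rewrite mul1r.
    by apply: ler_pM => //; [exact: N1_ge0|exact: hs3].
  apply: ler_wpM2r => //; apply: (le_trans linv); apply: (le_trans zle2).
  by apply: ler_wpM2l; exact: ltW.
have Wy : - E (fun x => w x * (y x - f x)) <= - (t * W) + `|B1| * (e * t) + z.
  have ww := L1M bw (L1B Pf1 f1); have wf := L1M bw f1.
  have -> : (fun x => w x * (y x - f x)) =
     (fun x => lam^-1 * (w x * (P t f x - f x)) + (- (1 - lam^-1)) * (w x * f x)).
    by apply/funext => x; rewrite /y; ring.
  rewrite (ED (L1Z _ ww) (L1Z _ wf)) (EZ _ ww) (EZ _ wf).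
  have -> : E (fun x => w x * f x) = 1.
    rewrite -Ef; apply: E_ae => //; apply: filterS2 lfE cf => x lx cx.
    have fx0 : 0 < f x by exact: lt_le_trans cx.
    by rewrite /w lx mulrC mulr_powRB1 // ltW.
  have R1 := L1B (L1B Pf1 f1) (L1Z t Lf1).
  have wR := L1M bw R1.
  have -> : E (fun x => w x * (P t f x - f x)) = t * W + E (fun x => w x * (P t f x - f x - t * L f x)).
    rewrite -(EZ t wL) -(ED (L1Z t wL) wR); congr Rintegral; apply/funext => x; ring.
  have hB1' : {ae mu, forall x, `|w x| <= `|B1|}.
    by apply: filterS hB1 => x /le_trans; apply; exact: ler_norm.
  pose err := E (fun x => w x * (P t f x - f x - t * L f x)).
  have herr : `|err| <= _ := le_trans (normE_le wR) (N1_bddM mw hB1' R1).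
  rewrite -/err.
  have herr2 : `|err| <= `|B1| * (e * t).
    by apply: (le_trans herr); apply: ler_wpM2l.
  have i1 : - (lam^-1 * (t * W + err)) <= - (t * W) + `|B1| * (e * t).
    have j1 : - (lam^-1 * (t * W)) <= - (t * W).
      rewrite lerN2; have : t * W <= 0 by rewrite mulr_ge0_le0.
      by move=> tW; rewrite -subr_ge0 -{2}(mul1r (t * W)) -mulrBl; apply: mulr_le0 => //; rewrite subr_le0.
    have j2 : - (lam^-1 * err) <= `|B1| * (e * t).
      apply: (le_trans (ler_norm _)); rewrite normrN normrM (ger0_norm li0).
      apply: (le_trans _ herr2).
      by rewrite ler_piMl.
    by rewrite mulrDr opprD; exact: lerD.
  by rewrite mulr1 opprD opprK; apply: lerD.
have q1t : q1 * t * ID <= q t * ID + e * t * `|ID|.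
  rewrite -lerBlDl -mulrBl; apply: (le_trans (ler_norm _)); rewrite normrM distrC.
  by apply: ler_wpM2r.
have qtle : q t <= (q1 + 1) * t.
  rewrite mulrDl -lerBlDl; apply: (le_trans (ler_norm _)); apply: (le_trans hqt).
  by rewrite ler_pM2r.
have A1 : q t * ID <= q t * (K * N1 (fun x => y x - f x)) - p * E (fun x => w x * (y x - f x)).
  move: step; rewrite gerDl mulrBr => step.
  by rewrite lerBrDl -subr_le0 -addrA.
have A2 : q t * (K * N1 (fun x => y x - f x)) <= (q1 + 1) * t * (K * (e + (r1 + 2) * e * N1 f)).
  apply: ler_pM => //; first by apply: mulr_ge0; [exact: ltW|exact: N1_ge0].
  by apply: ler_wpM2l; [exact: ltW|].
have A3 : - (p * E (fun x => w x * (y x - f x))) <= p * (- (t * W) + `|B1| * (e * t) + (r1 + e + e) * t).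
  rewrite -mulrN; apply: ler_wpM2l; first exact: ltW.
  by apply: (le_trans Wy); rewrite lerD2l.
rewrite -(ler_pM2r t0).
have -> : q1 * ID * t = q1 * t * ID by ring.
apply: (le_trans q1t).
have -> : (p * r1 - p * W + Q * e) * t = ((q1 + 1) * t * (K * (e + (r1 + 2) * e * N1 f)) +
   p * (- (t * W) + `|B1| * (e * t) + (r1 + e + e) * t)) + e * t * `|ID| by rewrite /Q; ring.
by rewrite lerD2r; apply: (le_trans A1); apply: lerD.
Qed.

End converse.

(** * From the gauge norm bound to the F-Sobolev inequality *)

Section converse_Sobolev.
Context d (T : measurableType d) (R : realType).
Variable mu : probability T R.
Variables (P : R -> (T -> R) -> (T -> R)) (L : (T -> R) -> (T -> R)).
Hypothesis hPL : symmetric_diffusion_semigroup mu P L.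
Variables (p : R) (F : R -> R).
Hypotheses (hp : 1 < p) (F_C2 : C2_on [set x | 0 < x] F) (F_nondecr : nondecreasing_pos F)
  (F_0 : x * F x @[x --> 0^'+] --> 0) (F_1 : F 1 = 0).

Local Notation L1 f := (f \in Lfun mu 1%E).
Local Notation E f := (\int[mu]_x f x).
Local Notation N1 := (L1norm mu).
Local Notation tau := (tau p F).
Local Notation Gamma f := (carre_du_champ L f f).
Local Notation pos := [set x : R | 0 < x].

Let p0 : 0 < p. Proof. exact: lt_trans hp. Qed.

(** [root_energy] concerns f = (ka (g^2 + de))^(1/p), the function to which the
    gauge norm bound is applied. *)
Section root.
Variables (de ka : R).
Hypotheses (de0 : 0 < de) (ka0 : 0 < ka).

Let v (x : R) := ka * (x * x + de).
Let phi (x : R) := v x `^ p^-1.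

Lemma root_arg_gt0 x : 0 < v x.
Proof. by rewrite mulr_gt0 // ltr_wpDl // -expr2 sqr_ge0. Qed.

Lemma root_pow x : phi x `^ p = v x.
Proof. by rewrite /phi -powRrM mulVf ?gt_eqF // powRr1 // ltW // root_arg_gt0. Qed.

Lemma root_has_C2 : exists f2, has_C2 setT phi
  (fun x => p^-1 * v x `^ (p^-1 - 1) * (ka * (x + x))) f2.
Proof.
have h1 := has_C2D (has_C2M (@has_C2_id R setT) (@has_C2_id R setT)) (@has_C2_cst R setT de).
have h2 := has_C2M (@has_C2_cst R setT ka) h1.
have h3 := has_C2_comp (has_C2_powR p^-1) h2 (fun x _ => root_arg_gt0 x).
eexists; apply: has_C2_ext h3 _ _ _ => //; first exact: openT.
by move=> x _; rewrite -/(v x); ring.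
Qed.

Lemma root_C2 : C2_on setT phi.
Proof. by have [f2 h] := root_has_C2; exact: has_C2_on openT h. Qed.

(** With phi^p = v one has phi^(p-1) phi' = v'/p, whence the power of [phi]
    in front of the energy of phi(g) cancels. *)
Lemma root_energy x : phi x `^ (p - 1 - 1) * (phi^`())%classic x ^+ 2 <= 4 * ka / p ^+ 2.
Proof.
have [f2 h] := root_has_C2.
have [-> _] := has_C2_val openT h (I : [set: R] x).
have v0 := root_arg_gt0 x; have vn0 : v x != 0 by rewrite gt_eqF.
have phi0 : 0 < phi x by exact: powR_gt0.
set dphi := p^-1 * _ * _.
have e1 : phi x `^ (p - 1) * dphi = 2 * ka * x / p.
  rewrite /dphi /phi -powRrM.
  have -> : v x `^ (p^-1 * (p - 1)) * (p^-1 * v x `^ (p^-1 - 1) * (ka * (x + x))) =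
     (v x `^ (p^-1 * (p - 1)) * v x `^ (p^-1 - 1)) * (p^-1 * (ka * (x + x))) by ring.
  rewrite -powRD ?vn0 ?implybT //.
  have -> : p^-1 * (p - 1) + (p^-1 - 1) = 0 by field; rewrite gt_eqF.
  by rewrite powRr0; ring.
have e2 : phi x `^ (p - 1 - 1) * v x = (phi x `^ (p - 1)) ^+ 2.
  rewrite -(root_pow x) expr2 -!powRD ?(gt_eqF phi0) ?implybT //.
  have -> : p - 1 - 1 + p = p - 1 + (p - 1) by ring.
  by [].
rewrite -(ler_pM2r v0).
have -> : phi x `^ (p - 1 - 1) * dphi ^+ 2 * v x = (phi x `^ (p - 1) * dphi) ^+ 2.
  by rewrite mulrAC e2 [RHS]exprMn.
rewrite e1.
have -> : (2 * ka * x / p) ^+ 2 = 4 * ka / p ^+ 2 * (ka * (x * x)).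
  by field; rewrite gt_eqF.
apply: ler_wpM2l; first by rewrite divr_ge0 ?sqr_ge0 // mulr_ge0 // ltW.
by apply: ler_wpM2l; [exact: ltW|rewrite lerDl ltW].
Qed.

End root.

Variables (q r : R -> R) (q1 r1 : R).
Hypotheses (q_ge0 : nonnegative_Rplus q) (r_ge0 : nonnegative_Rplus r)
  (r_nd : nondecreasing_Rplus r)
  (q_der : has_derivative_Rplus q 0 q1) (r_der : has_derivative_Rplus r 0 r1)
  (q0 : q 0 = 0) (r0 : r 0 = 0) (q1_gt0 : 0 < q1)
  (hg : gauge_contraction mu P p F q r).

Let C := 4 * (p - 1) / (p * q1).
Let Ct := p * r1 / q1.

Lemma energy_constant_ge0 : 0 <= C.
Proof.
have p10 : 0 <= p - 1 by rewrite subr_ge0 ltW.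
by rewrite divr_ge0 ?mulr_ge0 // ltW.
Qed.

(** The Sobolev inequality for the regularization (g^2 + delta)^(1/2),
    normalized to have mean square 1. *)
Lemma regularized_Sobolev g de : smooth mu P g -> 0 < de ->
  let ka := (E (fun x => g x ^+ 2) + de)^-1 in
  let v x := ka * (g x * g x + de) in
  is_true (E (fun x => v x * F (v x)) <= C * ka * E (Gamma g) + Ct).
Proof.
move=> sg de0 ka v.
have [bg dg] := (smoothP mu P g).1 sg.
have g21 : L1 (fun x => g x * g x) := L1_bdd (ess_bddM bg bg).
set mu2 := E (fun x => g x ^+ 2) in ka v *.
have mu2E : mu2 = E (fun x => g x * g x) by congr Rintegral; apply/funext => x; rewrite expr2.
have mu20 : 0 <= mu2 by apply: Rintegral_ge0 => x _; exact: sqr_ge0.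
have md0 : 0 < mu2 + de by exact: ltr_wpDl.
have ka0 : 0 < ka by rewrite invr_gt0.
pose phi (x : R) := (ka * (x * x + de)) `^ p^-1.
have phiC2 : C2_on setT phi := root_C2 de0 ka0.
pose f := phi \o g.
have sf : smooth mu P f := smooth_comp hPL sg phiC2.
pose c := (ka * de) `^ p^-1.
have kd0 : 0 < ka * de by exact: mulr_gt0.
have c0 : 0 < c by exact: powR_gt0.
have pi0 : 0 <= p^-1 by rewrite invr_ge0 ltW.
have [mg [B gB]] := bg.
have vge x : ka * de <= v x by rewrite ler_pM2l // lerDr -expr2 sqr_ge0.
have v0 x : 0 < v x by exact: lt_le_trans (vge x).
pose M := (ka * (B * B + de)) `^ p^-1.
have fcM : ae_between mu c M f.
  split; [apply: aeW => x|apply: filterS gB => x gB].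
    by apply: ge0_ler_powR; rewrite ?nnegrE ?vge // ltW // v0.
  apply: ge0_ler_powR => //; rewrite ?nnegrE; [exact: ltW (v0 x)| |].
    by rewrite mulr_ge0 ?(ltW ka0) // addr_ge0 ?(ltW de0) // -expr2 sqr_ge0.
  rewrite ler_pM2l // lerD2r.
  have -> : g x * g x = `|g x| * `|g x| by rewrite -!expr2 real_normK ?num_real.
  by apply: ler_pM.
have fpE x : f x `^ p = v x by exact: root_pow.
have Ef : E (fun x => f x `^ p) = 1.
  have -> : (fun x => f x `^ p) = (fun x => ka * (g x * g x + de)) by apply/funext => x; rewrite fpE.
  have dL := L1_cst mu de.
  rewrite (EZ ka (L1D g21 dL)) (ED g21 dL) E_cst.
  have -> : E (fun x => g x * g x) = mu2 by rewrite mu2E.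
  by rewrite mulVf // gt_eqF.
have := derivative_at_0 hPL hp F_C2 F_nondecr F_1 q_ge0 r_ge0 r_nd q_der r_der q0 r0 q1_gt0 hg
  sf c0 fcM Ef.
have -> : E (fun x => f x `^ p * F (f x `^ p)) = E (fun x => v x * F (v x)).
  by congr Rintegral; apply/funext => x; rewrite fpE.
have Gf := Gamma_comp hPL sg phiC2.
have G1 := Gamma_L1 hPL sg; have Gf1 := Gamma_L1 hPL sf.
have energy : E (fun x => (lift_pos (c / 2) (f x)) `^ (p - 1 - 1) * Gamma f x) <=
    4 * ka / p ^+ 2 * E (Gamma g).
  rewrite -EZ //; apply: le_E; [|exact: L1Z|].
    have [cp _ _] := C2_cont (C2_on_powR (p - 1 - 1)).
    exact: (L1M (ess_bdd_lift c0 (L1_meas (smooth_L1 sf)) cp fcM) Gf1).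
  apply: filterS3 Gf (Gamma_ge0 hPL sg) fcM.1 => x Gfx gx cx.
  rewrite Gfx lift_posE; last by lra.
  by rewrite mulrA; apply: ler_wpM2r => //; exact: root_energy.
have p10 : 0 <= p * (p - 1) by rewrite mulr_ge0 ?subr_ge0 // ltW.
move=> /le_trans/(_ (lerD (lexx _) (ler_wpM2l p10 energy))).
set X := E (fun x => v x * F (v x)) => H.
rewrite -(ler_pM2l q1_gt0); apply: (le_trans H).
rewrite le_eqVlt; apply/orP; left; apply/eqP; rewrite /C /Ct; field.
by rewrite !gt_eqF.
Qed.

(** The domination needed to let delta tend to 0. *)
Lemma xF_bounded (B : R) : exists K, forall y : R, 0 < y -> y <= B -> `|y * F y| <= K.
Proof.
have [s s0 hs] : exists2 s, 0 < s & forall y, 0 < y -> y < 0 + s -> `|y * F y| <= 1.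
  have /cvgrPdist_le/(_ 1 ltr01) := F_0.
  by move=> /near_rightP[s s0 hs]; exists s => // y y0 ys; have := hs y y0 ys; rewrite sub0r normrN.
have [cF _ _] := C2_cont F_C2.
have cxF (x : R) : 0 < x -> {for x, continuous (fun y : R => y * F y)}.
  by move=> x0; apply: cvgM; [exact: cvg_id|exact: cF].
have [K K0 hK] := continuous_bounded B s0 cxF.
exists (Num.max 1 K) => y y0 yB; rewrite le_max.
have [ys|sy] := ltP y s; first by rewrite hs ?add0r.
by rewrite hK ?orbT.
Qed.

Theorem converse_Sobolev : F_Sobolev mu P L F C Ct.
Proof.
move=> g sg.
have [bg dg] := (smoothP mu P g).1 sg.
have [mg [B gB]] := bg.
have g21 : L1 (fun x => g x * g x) := L1_bdd (ess_bddM bg bg).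
have sqE : (fun x => g x ^+ 2) = (fun x => g x * g x) by apply/funext => x; rewrite expr2.
have g2L : L1 (fun x => g x ^+ 2) by rewrite sqE.
have G1 := Gamma_L1 hPL sg.
have GE : 0 <= E (Gamma g) by apply: E_ge0; [exact: G1|exact: (Gamma_ge0 hPL)].
rewrite (E_fin G1) (E_fin g2L) -!EFinM -EFinD.
set mu2 := E (fun x => g x ^+ 2).
have mu20 : 0 <= mu2 by apply: Rintegral_ge0 => x _; exact: sqr_ge0.
have mxF : measurable_fun [set: T] (fun x => g x ^+ 2 / mu2 * F (g x ^+ 2 / mu2)).
  have mh : measurable_fun [set: T] (fun x => g x ^+ 2 / mu2).
    apply: measurable_funM; last exact: measurable_cst.
    by rewrite sqE; exact: measurable_funM.
  have -> : (fun x => g x ^+ 2 / mu2 * F (g x ^+ 2 / mu2)) =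
      (fun x => g x ^+ 2 / mu2 * (F \_ pos) (g x ^+ 2 / mu2)).
    apply/funext => x; have [->|h0] := eqVneq (g x ^+ 2 / mu2) 0; first by rewrite !mul0r.
    by rewrite restrict_FE // divr_ge0 // sqr_ge0.
  apply: measurable_funM => //.
  by apply: measurableT_comp => //; exact: measurable_restrict_F.
have [mu2E|mu2n0] := eqVneq mu2 0.
  have g0 : {ae mu, forall x, g x ^+ 2 = 0}.
    apply: (N1_eq0 g2L).
    have N2 : N1 (fun x => g x ^+ 2) = mu2.
      by congr Rintegral; apply/funext => x; rewrite ger0_norm // sqr_ge0.
    by rewrite N2 mu2E.
  have z0 : {ae mu, forall x, (fun _ => 0) x = g x ^+ 2 * F (g x ^+ 2 / mu2)}.
    by apply: filterS g0 => x ->; rewrite !mul0r.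
  have mz : measurable_fun [set: T] (fun x => g x ^+ 2 * F (g x ^+ 2 / mu2)).
    rewrite mu2E; under eq_fun do rewrite invr0 mulr0.
    by apply: measurable_funM; [exact: L1_meas g2L|exact: measurable_cst].
  have zL := L1_ae mz (L1_cst mu 0) z0.
  rewrite (E_fin zL) lee_fin -(E_ae (L1_cst mu 0) zL z0) E_cst mu2E mulr0 addr0.
  by apply: mulr_ge0 => //; exact: energy_constant_ge0.
have mu2gt : 0 < mu2 by rewrite lt0r mu2n0.
pose h x := g x ^+ 2 / mu2 * F (g x ^+ 2 / mu2).
pose v (n : nat) x := (mu2 + n.+1%:R^-1)^-1 * (g x * g x + n.+1%:R^-1).
have invn (n : nat) : (0 : R) < n.+1%:R^-1 by rewrite invr_gt0.
have invn1 (n : nat) : (n.+1%:R^-1 : R) <= 1 by rewrite invf_le1 // ler1n.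
have ka0 n : 0 < (mu2 + n.+1%:R^-1)^-1 by rewrite invr_gt0 addr_gt0.
have v0 n x : 0 < v n x by rewrite mulr_gt0 // ltr_wpDl // -expr2 sqr_ge0.
have [K hK] := xF_bounded (mu2^-1 * (B * B + 1)).
have kale n : (mu2 + n.+1%:R^-1)^-1 <= mu2^-1.
  by rewrite lef_pV2 ?posrE ?addr_gt0 // lerDl ltW.
have vB n : {ae mu, forall x, v n x <= mu2^-1 * (B * B + 1)}.
  apply: filterS gB => x gB; apply: ler_pM => //; first exact: ltW.
    by rewrite addr_ge0 ?(ltW (invn n)) // -expr2 sqr_ge0.
  apply: lerD => //.
  have -> : g x * g x = `|g x| * `|g x| by rewrite -!expr2 real_normK ?num_real.
  exact: ler_pM.
have bnd : {ae mu, forall x n, `|v n x * F (v n x)| <= K}.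
  by apply: filterS (ae_foralln vB) => x hx n; exact: hK.
have mv n : measurable_fun [set: T] (v n).
  apply: measurable_funM; first exact: measurable_cst.
  by apply: measurable_funD; [exact: measurable_funM|exact: measurable_cst].
have u1 n : L1 (fun x => v n x * F (v n x)).
  apply: L1_bdd; split; last by exists K; apply: filterS bnd => x.
  have -> : (fun x => v n x * F (v n x)) = (fun x => v n x * (F \_ pos) (v n x)).
    by apply/funext => x; rewrite restrict_FE ?gt_eqF // ltW.
  apply: measurable_funM => //.
  by apply: measurableT_comp => //; exact: measurable_restrict_F.
have [cF _ _] := C2_cont F_C2.
have de_cvg : n.+1%:R^-1 @[n --> \oo] --> (0 : R) by exact: cvg_harmonic.
have ka_cvg : (mu2 + n.+1%:R^-1)^-1 @[n --> \oo] --> mu2^-1.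
  rewrite -[X in X^-1](addr0 mu2); apply: cvgV; first by rewrite addr0.
  by apply: cvgD => //; exact: cvg_cst.
have vcvg x : v n x @[n --> \oo] --> g x ^+ 2 / mu2.
  rewrite mulrC expr2 -[X in _ * X](addr0 (g x * g x)).
  by apply: cvgM => //; apply: cvgD => //; exact: cvg_cst.
have ucvg x : v n x * F (v n x) @[n --> \oo] --> h x.
  have [gx0|gx0] := eqVneq (g x ^+ 2 / mu2) 0; last first.
    have hpos : 0 < g x ^+ 2 / mu2 by rewrite lt0r gx0 divr_ge0 // sqr_ge0.
    apply: cvgM => //; exact: (cvg_comp _ _ (vcvg x) (cF _ hpos)).
  rewrite /h gx0 mul0r.
  have vr := vcvg x; rewrite gx0 in vr.
  have vr' : v n x @[n --> \oo] --> 0^'+.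
    move=> A /near_rightP[s s0 hs].
    have /cvgrPdist_lt/(_ s s0) := vr.
    apply: filterS => n; rewrite sub0r normrN gtr0_norm // => vs.
    by apply: hs; rewrite ?add0r.
  exact: (cvg_comp _ _ vr' F_0).
have [h1 hN] := N1_cvg_dominated u1 mxF (L1_cst mu K) (aeW mu ucvg) bnd.
have main : E h <= C * mu2^-1 * E (Gamma g) + Ct.
  apply/ler_addgt0Pr => e e0.
  have [n hn] := @filter_ex _ \oo _ _ (hN e e0).
  have R1 : E (fun x => v n x * F (v n x)) <= C * (mu2 + n.+1%:R^-1)^-1 * E (Gamma g) + Ct :=
    regularized_Sobolev sg (invn n).
  have d1 := le_trans (normE_le (L1B (u1 n) h1)) hn.
  rewrite (EB (u1 n) h1) distrC in d1.
  have d2 := le_trans (ler_norm _) d1.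
  have d3 : C * (mu2 + n.+1%:R^-1)^-1 * E (Gamma g) <= C * mu2^-1 * E (Gamma g).
    by apply: ler_wpM2r => //; apply: ler_wpM2l; [exact: energy_constant_ge0|].
  rewrite lerBlDl in d2; apply: (le_trans d2); rewrite lerD2r.
  by apply: (le_trans R1); rewrite lerD2r.
have LE : (fun x => g x ^+ 2 * F (g x ^+ 2 / mu2)) = (fun x => mu2 * h x).
  by apply/funext => x; rewrite /h mulrA mulrCA divff // mulr1.
have hL : L1 (fun x => g x ^+ 2 * F (g x ^+ 2 / mu2)) by rewrite LE; exact: L1Z.
rewrite (E_fin hL) lee_fin LE (EZ _ h1).
apply: (le_trans (ler_wpM2l mu20 main)).
by rewrite le_eqVlt; apply/orP; left; apply/eqP; field.
Qed.

End converse_Sobolev.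

Theorem theorem6 (R : realType) (d : measure_display) (T : measurableType d)
    (mu : probability T R)
    (P : R -> (T -> R) -> (T -> R)) (L : (T -> R) -> (T -> R))
    (hPL : symmetric_diffusion_semigroup mu P L)
    (p : R) (hp : 1 < p)
    (F : R -> R)
    (* implied by C^2 on [0, +oo[; also admits ln, with 0 * ln 0 = 0 *)
    (F_C2 : C2_on [set x | 0 < x] F)
    (F_0 : x * F x @[x --> 0^'+] --> 0)
    (F_nondecr : forall x y : R, 0 < x -> x <= y -> F x <= F y)
    (F_1 : F 1 = 0) :
  (* (i) *)
  (forall (k l : R -> R) (m C Ct : R),
    nonnegative_Rplus k ->
    (forall q x : R, 0 <= q -> 0 < x ->
      k q / 4 * ((tau p F q)^`())%classic x ^+ 2 <= ((tau p F q)^`(2))%classic x * tau p F q x) ->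
    nonnegative_Rplus l ->
    measurable_fun [set u : R | 0 <= u] l ->
    0 <= m ->
    (forall q x : R, 0 <= q -> 0 <= x ->
      tau p F q x * F (x `^ p) <=
        l q * (tau p F q x * F (tau p F q x)) + m) ->
    F_Sobolev mu P L F C Ct ->
    forall q dq : R -> R,
      nonnegative_Rplus q -> nondecreasing_Rplus q -> C1_Rplus q dq ->
      q 0 = 0 ->
      (* q' <= k(q) / (l(q) C), with no constraint where l(q) C = 0 *)
      (forall t : R, 0 <= t -> dq t * (l (q t) * C) <= k (q t)) ->
    forall (f : T -> R) (t : R), f \in Lfun mu p%:E -> 0 <= t ->
      (gauge_norm mu (tau p F (q t)) (P t f) <=
       expeR ((p^-1)%:E *
         ((m * q t)%:E +
          Ct%:E * \int[lebesgue_measure]_(u in `[0%R, q t]) (l u)%:E)) *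
       'N[mu]_p%:E[EFin \o f])%E) /\
  (* (ii) *)
  (forall (q r : R -> R) (q'0 r'0 : R),
    nonnegative_Rplus q -> nondecreasing_Rplus q ->
    nonnegative_Rplus r -> nondecreasing_Rplus r ->
    has_derivative_Rplus q 0 q'0 -> has_derivative_Rplus r 0 r'0 ->
    (* r 0 = 0 cannot be dropped: the hypothesis must be an equality at t = 0 *)
    q 0 = 0 -> r 0 = 0 -> 0 < q'0 ->
    (forall (f : T -> R) (t : R), f \in Lfun mu p%:E -> 0 <= t ->
      (gauge_norm mu (tau p F (q t)) (P t f) <=
       (expR (r t))%:E * 'N[mu]_p%:E[EFin \o f])%E) ->
    F_Sobolev mu P L F (4 * (p - 1) / (p * q'0)) (p * r'0 * expR (r 0) / q'0)).
Proof.
split.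
- move=> k l m C Ct k0 hk l0 ml m0 hl hS q dq q_ge0 q_nd [q_der _] q0 hq f t fp t0.
  apply: (hypercontractivity hPL hp F_C2 F_nondecr F_1 k0 hk l0 m0 _ hS q_ge0 q_nd q_der q0 hq ml fp t0).
  by move=> s s0 x; exact: hl.
- move=> q r q1 r1 q_ge0 q_nd r_ge0 r_nd q_der r_der q0 r0 q1_gt0 hg.
  have := converse_Sobolev hPL hp F_C2 F_nondecr F_0 F_1 q_ge0 r_ge0 r_nd q_der r_der q0 r0 q1_gt0 hg.
  by rewrite r0 expR0 mulr1.
Qed.
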